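(* Consider a simple, non-degenerate, doubling and conductively uniform iterated graph system with generator $G_1=(V_1,E_1)$ and limit space $(X,d,\mu)$. Let $p_1,p_2\in(1,\infty)$ be distinct, and assume that the following three conditions hold. (A) For $p\in\{p_1,p_2\}$ the optimal potential function satisfies $|\nabla U_p(e)|\neq 0$ for all $e\in E_1$. (B) There is $e\in E_1$ such that $|\nabla U_{p_1}(e)|\neq|\nabla U_{p_2}(e)|$. (C) The optimal flows satisfy $\mathcal{J}_{p_1}(v,w)=\mathcal{J}_{p_2}(v,w)$ for all $\{v,w\}\in E_1$. Then $$\mathscr{F}_{p_1}\cap\mathscr{F}_{p_2}=\{f\in L^1(X,\mu): f\text{ is constant }\mu\text{-almost everywhere}\}.$$
   Context: Graphs. A graph $G=(V,E)$ has a finite nonempty vertex set $V$ and a finite multiset $E$ of unordered pairs $\{v,w\}$ of distinct vertices (parallel edges are counted separately). $\deg(v)$ is the number of edges containing $v$; $d_G$ is the shortest-path metric of a connected graph; a vertex set is independent if no edge joins two of its elements, and connected if any two of its points are joined by a path inside it. Iterated graph systems (IGS). An IGS consists of a connected graph $G_1=(V_1,E_1)$ (the generator), a nonempty finite set $I$, and for all $e\in E_1$, $v\in e$ an injective map $\phi_{v,e}:I\to V_1$ with independent image such that $\phi_{v,e}(I)\cap\phi_{w,e}(I)=\emptyset$ if $e=\{v,w\}$. It is simple if there are $\phi_+,\phi_-:I\to V_1$ with $\{\phi_{v,e},\phi_{w,e}\}=\{\phi_+,\phi_-\}$ for all $e=\{v,w\}\in E_1$; then $I_\pm:=\phi_\pm(I)$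 and the ends of $e$ are named $e^+,e^-$ so that $\phi_{e^\pm,e}=\phi_\pm$. It is doubling if $\deg(v)=1$ for all $v\in I_+\cup I_-$ (then $\mathfrak{n}(v)$ is the unique neighbour of $v$), and non-degenerate if no edge joins $I_+$ to $I_-$. Put $L_*:=\operatorname{dist}(I_+,I_-,d_{G_1})\ge2$. Potentials and flows. Let $p\in(1,\infty)$, $q=p/(p-1)$. For $U:V\to\mathbb{R}$ on a graph $(V,E)$ and $e=\{v,w\}\in E$ put $\nabla U(v,w)=U(w)-U(v)$, $|\nabla U(e)|=|\nabla U(v,w)|$, $\mathcal{E}_p(U)=\sum_{e\in E}|\nabla U(e)|^p$. A unit flow from $A$ to $B$ (disjoint nonempty vertex sets) is $\mathcal{J}:V\times V\to\mathbb{R}$ antisymmetric, with $\mathcal{J}(v,w)=0$ unless $\{v,w\}\in E$, $\operatorname{div}(\mathcal{J})(v):=\sum_{\{v,w\}\in E}\mathcal{J}(v,w)=0$ for $v\notin A\cup B$, and $\sum_{v\in A}\operatorname{div}(\mathcal{J})(v)=1$; $|\mathcal{J}(e)|:=|\mathcal{J}(v,w)|$ and $\mathcal{E}_q(\mathcal{J})=\sum_{e\in E}|\mathcal{J}(e)|^q$. On $G_1$, $U_p$ (optimal potential) is the unique minimizer of $\mathcal{E}_p$ among $U$ with $U|_{I_+}\equiv1$, $U|_{I_-}\equiv0$; $\mathcal{M}_p:=\mathcal{E}_p(U_p)$; $\mathcal{J}_p$ (optimal flow) is the unique minimizer of $\mathcal{E}_q$ among unit flows from $I_+$ to $I_-$.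 The IGS is conductively uniform if for all $p\in(1,\infty)$ and $a\in I$, $\mathcal{J}_p(\phi_+(a),\mathfrak{n}(\phi_+(a)))=-\mathcal{J}_p(\phi_-(a),\mathfrak{n}(\phi_-(a)))$; this value is denoted $\mathcal{J}_p(a)$, and $a\mapsto\mathcal{J}_p(a)$ is a probability density on $I$. Replacement graphs. $G_0$ has vertices $v_+,v_-$ and one edge $e_0$ with $e_0^\pm=v_\pm$. Given $G_n=(V_n,E_n)$ whose edges have named ends $e^\pm$ (write $\phi_{v,e}=\phi_\pm$ if $v=e^\pm$), put $V_{n+1}=(V_1\times E_n)/\sim$, where $(\phi_{v,e}(a),e)\sim(\phi_{v,f}(a),f)$ for $e,f\in E_n$ sharing an end $v$ and $a\in I$; classes are written $[z,e]$. For each $e\in E_n$, $f\in E_1$ there is one edge $e\cdot f=\{[f^+,e],[f^-,e]\}\in E_{n+1}$ with $(e\cdot f)^\pm=[f^\pm,e]$. So $E_n$ is identified with words of length $n$ in $E_1$, and $e\cdot f$ denotes concatenation for $e\in E_n$, $f\in E_m$. For $e\in E_n$ define $\sigma_{e,m}:V_m\to V_{n+m}$ by $\sigma_{e,0}(v_\pm)=e^\pm$, $\sigma_{e,m+1}([z,f])=[z,e\cdot f]$, and $e\cdot G_m:=\sigma_{e,m}(V_m)$. For $v\in V_n$, $a\in I$ put $v\cdot a:=[\phi_{v,e}(a),e]\in V_{n+1}$ (any $e\in E_n$ containing $v$), and $v\cdot(a_1\cdots a_m):=(\cdots(v\cdot a_1)\cdots)\cdot a_m$. Write $|e|=n$ for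 $e\in E_n$. Limit space. $\Sigma$ is the set of sequences $(e_i)_{i\ge0}$, $e_i\in E_i$, with $e_i$ the length-$i$ prefix of $e_{i+1}$; $X:=\Sigma/\sim$ with $(e_i)\sim(f_i)$ iff $e_i\cap f_i\neq\emptyset$ for all $i$; $\chi:\Sigma\to X$ is the projection. For $e\in E_n$, $F_e:X\to X$ is given by $F_e(\chi((e_i)_i))=\chi((g_i)_i)$ with $g_{n+i}=e\cdot e_i$, and $X_e:=F_e(X)$. $\mu$ is the push-forward under $\chi$ of the uniform Bernoulli probability measure on $\Sigma\cong E_1^{\mathbb{N}}$. The metric is $d(\chi((e_i)),\chi((f_i))):=\lim_n\min_{v\in e_n,w\in f_n}d_n(v,w)$, where for $v\ne w$ in $V_n$, $d_n(v,w)=\inf_\Omega\sum_{e\in\Omega}L_*^{-|e|}$ over $\Omega\subseteq\bigcup_{j=0}^nE_j$ such that $\bigcup_{e\in\Omega}e\cdot G_{n-|e|}$ is connected in $G_n$ and contains $v,w$; $d_n(v,v)=0$. Energy and Sobolev space. For $v\in e\in E_n$ let $T_{v,e}:I^{\mathbb{N}}\to\Sigma$ send $(a_i)$ to the sequence whose $n$-th term is $e$ and whose $i$-th term, $i>n$, is the unique edge of the form $e\cdot f$, $f\in E_{i-n}$, containing $v\cdot(a_1\cdots a_{i-n})$. $\operatorname{Fib}(v):=\chi(T_{v,e}(I^{\mathbb{N}}))$, and $\mathcal{J}_{p,v}$ is the push-forward by $\chi\circ T_{v,e}$ of the product probability measure on $I^{\mathbb{N}}$ with one-dimensional marginals $\mathcal{J}_p(\cdot)$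 (both independent of $e$). For $f\in C(X)$ let $V_n[f](v):=\int_{\operatorname{Fib}(v)}f\,d\mathcal{J}_{p,v}$, $v\in V_n$, and $\mathsf{E}_p(f):=\lim_n\mathcal{M}_p^{-n}\mathcal{E}_p(V_n[f])\in[0,\infty]$ (a non-decreasing limit). Let $\mathscr{C}_p=\{f\in C(X):\mathsf{E}_p(f)<\infty\}$. For $f\in L^p(X,\mu)$, $\mathscr{E}_p(f):=\lim_i\mathsf{E}_p(f_i)$ for any sequence $f_i\in\mathscr{C}_p$ with $\mathsf{E}_p(f_i-f_j)\to0$ as $i,j\to\infty$ and $f_i\to f$ in $L^p(X,\mu)$ (independent of the sequence by closability), and $\mathscr{E}_p(f):=\infty$ if none exists. $\mathscr{F}_p:=\{f\in L^p(X,\mu):\mathscr{E}_p(f)<\infty\}$. *)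

(* Defs.v *)
From HB Require Import structures.
From mathcomp Require Import all_boot all_order all_algebra generic_quotient.
From mathcomp Require Import all_classical all_reals all_analysis.

Set Implicit Arguments.
Unset Strict Implicit.
Unset Printing Implicit Defensive.

Import Order.TTheory GRing.Theory Num.Theory numFieldNormedType.Exports.

Local Open Scope classical_set_scope.
Local Open Scope ring_scope.
Local Open Scope quotient_scope.

(* The two ends of an edge are labelled, but [adj], [ends], [deg], energies
   and flows do not depend on the labelling.  Parallel edges are distinct
   elements of [edge]. *)
Record mgraph := MGraph {
  vertex : finType;
  edge : finType;
  end1 : edge -> vertex;
  end2 : edge -> vertex
}.
Arguments end1 {m} _.
Arguments end2 {m} _.

Section Graph.
Context (G : mgraph).
Implicit Types (x y v w : vertex G) (e : edge G) (A B : {set vertex G}).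

Definition ends e : seq (vertex G) := [:: end1 e; end2 e].

Definition loopless := forall e, end1 e != end2 e.

Definition other e v := if end1 e == v then end2 e else end1 e.

Definition adj v w : bool :=
  [exists e : edge G, (v \in ends e) && (w == other e v)].

Definition deg v : nat := #|[set e : edge G | v \in ends e]|.

Definition independent A := forall v w, v \in A -> w \in A -> ~~ adj v w.

Definition connected_in A := forall v w, v \in A -> w \in A ->
  exists s : seq (vertex G),
    [/\ path adj v s, last v s = w & all (fun x => x \in A) s].

Definition connected_graph := connected_in [set: vertex G].

(* length of a shortest path; the value is #|vertex G| if there is no path *)
Definition gdist v w : nat :=
  find (fun k => [exists s : k.-tuple (vertex G), path adj v s && (last v s == w)])
       (iota 0 #|vertex G|).

Definition gdist_set A B : nat :=
  \big[minn/#|vertex G|]_(v in A) \big[minn/#|vertex G|]_(w in B) gdist v w.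

(* meaningful when deg v = 1 *)
Definition nbr v := odflt v [pick w | adj v w].

End Graph.

Section PotentialsAndFlows.
Context (R : realType) (G : mgraph).
Implicit Types (U : vertex G -> R) (J : vertex G -> vertex G -> R) (p q : R).

Definition absgrad U (e : edge G) : R := `|U (end2 e) - U (end1 e)|.

Definition energy p U : R := \sum_(e : edge G) absgrad U e `^ p.

Definition divergence J (v : vertex G) : R :=
  \sum_(e : edge G | v \in ends e) J v (other e v).

Definition unit_flow (A B : {set vertex G}) J :=
  [/\ forall v w, J v w = - J w v,
      forall v w, ~~ adj v w -> J v w = 0,
      forall v, v \notin A :|: B -> divergence J v = 0 &
      \sum_(v in A) divergence J v = 1].

Definition flow_energy q J : R :=
  \sum_(e : edge G) `|J (end1 e) (end2 e)| `^ q.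

End PotentialsAndFlows.

(* [phi v e] is only constrained (and only used) when v is an end of e. *)
Record igs := IGS {
  gen : mgraph;
  gen_nonempty : (0 < #|vertex gen|)%N;
  gen_loopless : loopless gen;
  gen_connected : connected_graph gen;
  idx : finType;
  idx_nonempty : (0 < #|idx|)%N;
  phi : vertex gen -> edge gen -> idx -> vertex gen;
  phi_inj : forall e v, v \in ends e -> injective (phi v e);
  phi_indep : forall e v, v \in ends e -> independent [set phi v e a | a : idx];
  phi_disj : forall e a b, phi (end1 e) e a != phi (end2 e) e b
}.

Record simple_igs := SimpleIGS {
  simple_base :> igs;
  phip : idx simple_base -> vertex (gen simple_base);
  phim : idx simple_base -> vertex (gen simple_base);
  simpleP : forall e : edge (gen simple_base),
    (phi (end1 e) e =1 phip /\ phi (end2 e) e =1 phim) \/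
    (phi (end1 e) e =1 phim /\ phi (end2 e) e =1 phip)
}.
Arguments phip {s} _.
Arguments phim {s} _.

Section Simple.
Context (S : simple_igs).

Definition Iplus : {set vertex (gen S)} := [set phip a | a : idx S].
Definition Iminus : {set vertex (gen S)} := [set phim a | a : idx S].

(* e^+ is the end v of e with phi v e = phip, and e^- is the other one *)
Definition eplus (e : edge (gen S)) : vertex (gen S) :=
  if [forall a, phi (end1 e) e a == phip a] then end1 e else end2 e.
Definition eminus (e : edge (gen S)) : vertex (gen S) := other e (eplus e).

Definition doubling := forall v, v \in Iplus :|: Iminus -> deg v = 1%N.

Definition non_degenerate :=
  forall v w, v \in Iplus -> w \in Iminus -> ~~ adj v w.

Definition Lstar : nat := gdist_set Iplus Iminus.

End Simple.

Record ndd_igs := NDDIGS {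
  ndd_base :> simple_igs;
  ndd_nondegenerate : non_degenerate ndd_base;
  ndd_doubling : doubling ndd_base
}.

Definition idx0 (S : igs) : idx S := enum_val (Ordinal (idx_nonempty S)).

Lemma edge_nonempty (S : ndd_igs) : (0 < #|edge (gen S)|)%N.
Proof.
have I0 : phip (idx0 S) \in Iplus S :|: Iminus S.
  by rewrite inE (imset_f (@phip S)).
have : (0 < deg (phip (idx0 S)))%N by rewrite ndd_doubling.
by move=> /card_gt0P[e _]; apply/card_gt0P; exists e.
Qed.

Definition edge0 (S : ndd_igs) : edge (gen S) :=
  enum_val (Ordinal (edge_nonempty S)).

Section Optimal.
Context (R : realType) (S : simple_igs).
Implicit Types (U : vertex (gen S) -> R)
  (J : vertex (gen S) -> vertex (gen S) -> R) (p : R).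

Definition admissible U :=
  (forall v, v \in Iplus S -> U v = 1) /\ (forall v, v \in Iminus S -> U v = 0).

Definition optimal_potential p U :=
  admissible U /\ forall U', admissible U' -> energy p U <= energy p U'.

Definition conj_exp p : R := p / (p - 1).

Definition optimal_flow p J :=
  unit_flow (Iplus S) (Iminus S) J /\
  forall J', unit_flow (Iplus S) (Iminus S) J' ->
    flow_energy (conj_exp p) J <= flow_energy (conj_exp p) J'.

(* For 1 < p the minimizers exist and are unique, so [Uopt] and [Jopt] are
   the optimal potential and the optimal flow. *)
Definition Uopt p : vertex (gen S) -> R := xget (fun=> 0) [set U | optimal_potential p U].
Definition Jopt p : vertex (gen S) -> vertex (gen S) -> R :=
  xget (fun _ _ => 0) [set J | optimal_flow p J].

Definition Mconst p : R := energy p (Uopt p).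

Definition conductively_uniform := forall (p : R) (a : idx S), 1 < p ->
  Jopt p (phip a) (nbr (phip a)) = - Jopt p (phim a) (nbr (phim a)).

Definition Jdens p (a : idx S) : R := Jopt p (phip a) (nbr (phip a)).

End Optimal.
Arguments Uopt {R S}.
Arguments Jopt {R S}.
Arguments Mconst {R} S.
Arguments Jdens {R S}.

(* In the graphs G_n the named ends e^+ and e^- are [end1 e] and [end2 e]. *)
Section Replace.
Context (S : simple_igs) (G : mgraph).

Definition phi_at (v : vertex G) (e : edge G) : idx S -> vertex (gen S) :=
  if v == end1 e then phip else phim.

Definition glue : rel (vertex (gen S) * edge G) := fun x y =>
  [exists v, [exists a, [&& v \in ends x.2, v \in ends y.2,
    x.1 == phi_at v x.2 a & y.1 == phi_at v y.2 a]]].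

Lemma glue_sym : symmetric glue.
Proof.
move=> x y; apply/idP/idP => /existsP[v /existsP[a /and4P[? ? ? ?]]];
  by apply/existsP; exists v; apply/existsP; exists a; apply/and4P.
Qed.

Lemma glue_connect_sym : symmetric (connect glue).
Proof. by apply: sym_connect_sym; exact: glue_sym. Qed.

Canonical glue_equiv := EquivRel (connect glue)
  (@connect0 _ glue) glue_connect_sym (@connect_trans _ glue).

Definition rvertex := {eq_quot glue_equiv}.
HB.instance Definition _ := Choice.on rvertex.
HB.instance Definition _ := Quotient.on rvertex.
HB.instance Definition _ := [Countable of rvertex by <:%/].
HB.instance Definition _ := fintype.isFinite.Build rvertex
  (@pcan_enumP _ _ _ _ (can_pcan (@reprK _ rvertex))).

Definition cls (z : vertex (gen S)) (e : edge G) : rvertex := \pi_rvertex (z, e).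

Definition replace : mgraph :=
  @MGraph rvertex (edge G * edge (gen S))%type
    (fun ef => cls (eplus ef.2) ef.1) (fun ef => cls (eminus ef.2) ef.1).

End Replace.

Definition graph0 : mgraph := @MGraph bool unit (fun=> true) (fun=> false).

(* An edge of [rgraph S n] is a word of length n in the edges of the generator,
   read from left to right: e.f is the pair (e, f). *)
Fixpoint rgraph (S : simple_igs) (n : nat) : mgraph :=
  if n is n'.+1 then replace S (rgraph S n') else graph0.

Section ReplacementGraphs.
Context (S : ndd_igs).

Local Notation V n := (vertex (rgraph S n)).
Local Notation E n := (edge (rgraph S n)).
Local Notation E1 := (edge (gen S)).

Fixpoint ecat n (e : E n) m : E m -> E (m + n) :=
  if m is m'.+1 return E m -> E (m + n)
  then fun f => (ecat e f.1, f.2) else fun=> e.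

Definition sigma n (e : E n) m : V m -> V (m + n) :=
  if m is m'.+1 return V m -> V (m + n)
  then fun x => cls (repr x).1 (ecat e (repr x).2)
  else fun b : bool => if b then end1 e else end2 e.

(* e.G_(n-j) = sigma_{e,n-j}(V_(n-j)), transported to a subset of V_n *)
Definition cell n (j : 'I_n.+1) (e : E j) : {set V n} :=
  ecast k {set V k} (subnK (leq_ord j)) [set sigma e x | x : V (n - j)].

Fixpoint pref (s : nat -> E1) n : E n :=
  if n is n'.+1 return E n then (pref s n', s n') else tt.

(* v has an incident edge, so the default is not used; v.a and J_{p,v} do not
   depend on its choice *)
Definition incident_edge n (v : V n) : E n :=
  odflt (pref (fun=> edge0 S) n) [pick e : E n | v \in ends e].

Definition vdot n (v : V n) (a : idx S) : V n.+1 :=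
  cls (phi_at v (incident_edge v) a) (incident_edge v).

(* v.(a_1 ... a_m), where a_i is [a i.-1] *)
Fixpoint vword n (v : V n) (a : nat -> idx S) m : V (m + n) :=
  if m is m'.+1 return V (m + n) then vdot (vword v a m') (a m') else v.

End ReplacementGraphs.
Arguments ecat {S n} e {m} _.
Arguments sigma {S n} e {m} _.
Arguments cell {S n j} e.
Arguments pref {S} s n.
Arguments vword {S n} v a m.

Definition seqspace (A : finType) (a0 : A) : Type := nat -> A.

HB.instance Definition _ (A : finType) (a0 : A) := gen_eqMixin (seqspace a0).
HB.instance Definition _ (A : finType) (a0 : A) := gen_choiceMixin (seqspace a0).
HB.instance Definition _ (A : finType) (a0 : A) :=
  isPointed.Build (seqspace a0) (fun=> a0).

Definition cylinder (A : finType) (a0 : A) (u : seq A) : set (seqspace a0) :=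
  [set s | mkseq s (size u) = u].

Arguments cylinder {A} a0 u.

Definition mseqspace (A : finType) (a0 : A) :=
  g_sigma_algebraType (range (cylinder a0)).

Section Bernoulli.
Context (R : realType) (A : finType) (a0 : A).

Definition is_bernoulli (w : A -> R)
    (P : {measure set (mseqspace a0) -> \bar R}) :=
  forall u : seq A, P (cylinder a0 u) = (\prod_(a <- u) w a)%:E.

(* For a probability density w there is exactly one such measure, the infinite
   product measure with one-dimensional marginals w. *)
Definition bernoulli (w : A -> R) : {measure set (mseqspace a0) -> \bar R} :=
  if pselect (exists P, is_bernoulli w P) is left ex then projT1 (cid ex)
  else mzero.

End Bernoulli.
Arguments bernoulli {R A} a0 w.

Section Metric.
Context (R : realType) (S : ndd_igs).

Local Notation V n := (vertex (rgraph S n)).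
Local Notation E n := (edge (rgraph S n)).

Definition dn_admissible n (v w : V n) (W : {set {j : 'I_n.+1 & E j}}) :=
  let U := (\bigcup_(e in W) cell (tagged e))%SET in
  [/\ connected_in U, v \in U & w \in U].

Definition dn n (v w : V n) : R :=
  if v == w then 0
  else inf [set \sum_(e in W) (Lstar S)%:R ^- (tag e) | W in dn_admissible v w].

Definition min_dn n (e f : E n) : R :=
  Num.min (Num.min (dn (end1 e) (end1 f)) (dn (end1 e) (end2 f)))
          (Num.min (dn (end2 e) (end1 f)) (dn (end2 e) (end2 f))).

End Metric.

Section LimitSpace.
Context (S : ndd_igs).

(* Sigma, a point (e_i)_i being identified with its sequence of letters *)
Definition Sigma := seqspace (edge0 S).

Definition sim (s t : Sigma) :=
  forall i, exists2 v, v \in ends (pref s i) & v \in ends (pref t i).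

(* Sigma / ~ as the set of classes of the equivalence relation ~; R is a phantom
   parameter on which the R-valued metric below depends *)
Definition limit_space (R : realType) : Type :=
  {A : set Sigma | exists s, A = [set t | sim s t]}.

End LimitSpace.

HB.instance Definition _ S R := gen_eqMixin (limit_space S R).
HB.instance Definition _ S R := gen_choiceMixin (limit_space S R).

Section Topology.
Context (R : realType) (S : ndd_igs).
Local Notation X := (limit_space S R).

Definition chi (s : Sigma S) : X :=
  exist _ [set t | sim s t] (ex_intro _ s erefl).

Definition seq_of (x : X) : Sigma S := projT1 (cid (proj2_sig x)).

HB.instance Definition _ := isPointed.Build X (chi (fun=> edge0 S)).

(* The limit does not depend on the representatives; the topology of X is the
   one of the metric dX, its open sets being [dX_open]. *)
Definition dX (x y : X) : R :=
  limn (fun n => min_dn R (pref (seq_of x) n) (pref (seq_of y) n)).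

Definition dX_open (U : set X) :=
  forall x, U x -> exists2 r : R, 0 < r & forall y, dX x y < r -> U y.

Lemma dX_openT : dX_open setT.
Proof. by move=> x _; exists 1. Qed.

Lemma dX_openI : setI_closed dX_open.
Proof.
move=> U W oU oW x [/oU[r r0 rU] /oW[r' r'0 rW]].
exists (Num.min r r'); first by rewrite lt_min r0.
by move=> y; rewrite lt_min => /andP[/rU ? /rW].
Qed.

Lemma dX_open_bigU (I : Type) (U : I -> set X) :
  (forall i, dX_open (U i)) -> dX_open (\bigcup_i U i).
Proof.
move=> oU x [i _ /oU[r r0 rU]]; exists r => // y /rU ?.
by exists i.
Qed.

HB.instance Definition _ :=
  isOpenTopological.Build X dX_openT dX_openI dX_open_bigU.

Definition borelX := g_sigma_algebraType (@open X).

Definition unif_density (_ : edge (gen S)) : R := #|edge (gen S)|%:R^-1.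

(* [chi] is Borel, so this push-forward and the one in [Jmeas] are measures;
   [integral] and almost-everywhere statements accept any set function. *)
Definition muX : set borelX -> \bar R :=
  @pushforward _ _ (mseqspace (edge0 S)) borelX R
    (bernoulli (edge0 S) unif_density) chi.

Definition memLp (p : R) (f : X -> R) :=
  measurable_fun [set: borelX] (f : borelX -> R) /\
  (\int[muX]_x (`|f x| `^ p)%:E < +oo)%E.

End Topology.
Arguments chi R {S} s.
Arguments borelX R S : clear implicits.
Arguments muX R S : clear implicits.

Section Energy.
Context (R : realType) (S : ndd_igs).
Local Notation X := (limit_space S R).
Local Notation V n := (vertex (rgraph S n)).
Local Notation E n := (edge (rgraph S n)).
Local Notation IN := (mseqspace (idx0 S)).

(* the sequence T_{v,e}(a): its n-th prefix is e and, for all m, its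
   (m+n)-th prefix (an edge of the form e.f) contains v.(a_1 ... a_m) *)
Definition Tseq n (v : V n) (e : E n) (a : IN) : Sigma S :=
  xget point [set s : Sigma S | pref s n = e /\
    forall m, vword v a m \in ends (pref s (m + n))].

Definition Fib n (v : V n) : set (borelX R S) :=
  range (fun a => chi R (Tseq v (incident_edge v) a)).

Definition Jmeas (p : R) n (v : V n) : set (borelX R S) -> \bar R :=
  @pushforward _ _ IN (borelX R S) R (bernoulli (idx0 S) (Jdens p))
    (fun a => chi R (Tseq v (incident_edge v) a)).

Definition Vavg (p : R) (f : X -> R) n (v : V n) : R :=
  fine (\int[Jmeas p v]_(x in Fib v) (f x)%:E).

Definition EpC (p : R) (f : X -> R) : \bar R :=
  limn (fun n => (Mconst S p ^- n * energy p (@Vavg p f n))%:E).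

Definition Cp (p : R) : set (X -> R) :=
  [set f | continuous f /\ (EpC p f < +oo)%E].

Definition approx_seq (p : R) (f : X -> R) (u : nat -> X -> R) :=
  [/\ forall i, Cp p (u i),
      forall eps : R, 0 < eps -> exists N, forall i j, (N <= i)%N -> (N <= j)%N ->
        (EpC p (u i \- u j)%R < eps%:E)%E &
      (fun i => (\int[muX R S]_x (`|u i x - f x|%R `^ p)%:E)%E) @ \oo --> 0%E].

(* By closability the limit does not depend on the approximating sequence, so
   any one of them may be chosen. *)
Definition sobolev_energy (p : R) (f : X -> R) : \bar R :=
  if pselect (exists u, approx_seq p f u) is left ex
  then limn (fun i => EpC p (projT1 (cid ex) i)) else +oo%E.

Definition sobolev (p : R) : set (X -> R) :=
  [set f | memLp p f /\ (sobolev_energy p f < +oo)%E].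

Definition const_ae : set (X -> R) :=
  [set f | memLp 1 f /\ exists c : R, \forall x \ae muX R S, f x = c].

End Energy.
Arguments EpC R S p f : clear implicits.
Arguments sobolev_energy R S p f : clear implicits.
Arguments sobolev R S p : clear implicits.
Arguments const_ae R S : clear implicits.

(* Main.v *)
(** Write J for the common optimal flow, M for M_p and, for an edge e of G_n, let J(e) and
    grad_p(e) be the products over the letters of e of |J| and |grad U_p|.  Green's formula on
    the generator expresses a difference of fiber averages across an edge as a J-weighted sum
    of differences across its children, so the sums S_n of J(e) |grad V_n[f](e)| over E_n are
    nondecreasing in n.  The weights nu_p(e) = J(e) grad_p(e) form a product probability
    density on E_n, and M^n J(e) = grad_p(e)^(p-1), whence truncation at height T gives
      J(e) d <= T nu_p(e) + T^(1-p) M^(-n) d^p.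
    Using on each edge the exponent with the smaller weight, S_n is at most
    T * sum min(nu_p1, nu_p2) plus T^(1-p) times bounded energies.  By (B) the two densities on
    E_1 differ, so the affinity of their n-fold products decays geometrically; letting n and
    then T tend to infinity, S_n = 0 and all discrete gradients vanish.

    A function of both spaces has a different approximating sequence for each exponent.  A
    Poincaré inequality, based on the contraction factors M / |E_1| < 1 for cells and
    max_a M J(a) < 1 for fibers, shows that averages over fibers are close to flow means of
    averages over cells; the latter are continuous in L^1, so the fiber averages of the two
    sequences have the same limits.  The same inequality turns vanishing energy into constancy
    almost everywhere. *)

Require Import Defs.
From mathcomp Require Import all_boot all_order all_algebra.
From mathcomp Require Import all_classical all_reals all_analysis.
From mathcomp Require Import generic_quotient measurable_realfun zify ring lra.
Import Defs.

Set Implicit Arguments.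
Unset Strict Implicit.
Unset Printing Implicit Defensive.

Import Order.TTheory GRing.Theory Num.Theory numFieldNormedType.Exports.

Local Open Scope classical_set_scope.
Local Open Scope ring_scope.

(** * Real inequalities *)

(** A function known only almost everywhere has no averages over fibers. Gradients are therefore
    taken along approximating sequences, and they are shown to tend to 0 at each fixed edge.

    Both contraction factors come from a strong maximum principle for the optimal potential. No edge
    joins two boundary points, so every edge has |grad U_p| below 1 and M < |E_1|; and M J(a) is the
    (p-1)-th power of 1 - U_p at the interior neighbour of phi_+(a).

    In the Poincaré inequality the differences at depth j are truncated at a height proportional to
    tau^j, where tau^p = M / |E_1|. With this choice the height term and the energy term decay at
    the same rate.

    The metric enters through two comparisons with words: equal prefixes give a small distance
    ([dX_le]), prefixes without a common vertex a positive one ([dX_ge]). The second needs the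
    sequence defining the distance to converge, which is obtained from an almost monotonicity of
    chain distances.

    Integrals are computed on sequence spaces, where compactness gives uniform continuity and
    Riemann sums over cylinders replace Fubini arguments. *)

Section PowerInequalities.
Context (R : realType).
Implicit Types p x y : R.

(** Above the height, [x] is [x ^ p] times [x ^ (1 - p)], and the last factor is at most its value
    at [T]. The inequality serves the flow sums, the Poincaré sums and the bound of L^1 by L^p. *)
Lemma ler_truncate p x (T : R) : 1 < p -> 0 <= x -> 0 < T ->
  x <= T + T `^ (1 - p) * x `^ p.
Proof.
move=> p1 x0 T0; have [xT|Tx] := leP x T.
  by rewrite (le_trans xT)// lerDl mulr_ge0 ?powR_ge0.
have xp : 0 < x by exact: lt_trans Tx.
apply: (@le_trans _ _ (T `^ (1 - p) * x `^ p)); last by rewrite lerDr ltW.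
rewrite -(@mulr_powRB1 _ x p)//; last by lra.
rewrite mulrCA ler_peMr//.
have -> : 1 - p = - (p - 1) by ring.
rewrite powRN mulrC ler_pdivlMr ?powR_gt0// mul1r.
by rewrite ge0_ler_powR ?nnegrE ?(ltW Tx)//; lra.
Qed.

(** Young's inequality for [x] and [y ^ (p - 1)], whose conjugate power is [y ^ p]. *)
Lemma powR_tangent p x y : 1 < p -> 0 <= x -> 0 <= y ->
  y `^ p + p * y `^ (p - 1) * (x - y) <= x `^ p.
Proof.
move=> p1 x0 y0; have p0 : 0 < p by lra.
have pn0 : p != 0 by rewrite gt_eqF.
have pn1 : p - 1 != 0 by rewrite gt_eqF// subr_gt0.
have := @conjugate_powR R x (y `^ (p - 1)) p (p / (p - 1)) x0 (powR_ge0 _ _) p0.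
rewrite -powRrM (_ : (p - 1) * (p / (p - 1)) = p); last by field.
rewrite (_ : p^-1 + (p / (p - 1))^-1 = 1); last by field; rewrite pn0 pn1.
move=> /(_ (divr_gt0 p0 _) erefl); rewrite subr_gt0 => /(_ p1) H.
have yp : y `^ p = y * y `^ (p - 1) by rewrite mulr_powRB1.
have : p * (x * y `^ (p - 1)) <= x `^ p + (p - 1) * y `^ p.
  rewrite -(ler_pM2l p0) in H; apply: (le_trans H).
  by rewrite le_eqVlt; apply/orP; left; apply/eqP; field; rewrite pn0 pn1.
by rewrite yp; lra.
Qed.

Lemma powR_tangent_strict p x y : 1 < p -> 0 <= x -> 0 <= y -> x != y ->
  y `^ p + p * y `^ (p - 1) * (x - y) < x `^ p.
Proof.
(* Two tangent steps through the midpoint: the slope at [m] differs strictly from the slope at [y],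
   which gives a strict gain on the half from [m] to [x]. *)
move=> p1 x0 y0 xy; pose m := (x + y) / 2.
have m0 : 0 <= m by rewrite /m; lra.
have H1 := powR_tangent p1 x0 m0.
have H2 := powR_tangent p1 m0 y0.
suff H : 0 < p * (m `^ (p - 1) - y `^ (p - 1)) * (x - m).
  have : p * y `^ (p - 1) * (x - y) = p * y `^ (p - 1) * (m - y) + p * y `^ (p - 1) * (x - m).
    by ring.
  by lra.
have [yx|xy'] := ltP y x.
- have : y < m by rewrite /m; lra.
  have mx : m < x by rewrite /m; lra.
  move=> ym; have q0 : 0 < p - 1 by lra.
  have := gt0_ltr_powR q0 (y0 : y \in Num.nneg) (m0 : m \in Num.nneg) ym.
  by move=> h; rewrite mulr_gt0 ?subr_gt0// mulr_gt0 ?subr_gt0//; lra.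
- have xy2 : x < y by rewrite lt_neqAle xy.
  have : m < y by rewrite /m; lra.
  have mx : x < m by rewrite /m; lra.
  move=> ym; have q0 : 0 < p - 1 by lra.
  have h := gt0_ltr_powR q0 (m0 : m \in Num.nneg) (y0 : y \in Num.nneg) ym.
  by rewrite nmulr_rgt0 ?subr_lt0// pmulr_rlt0 ?subr_lt0//; lra.
Qed.

(** Signed power. With exponent [p - 1] it is the derivative of [|x|^p / p], the nonlinearity of the
    p-Laplacian. *)
Definition spow p x : R := Num.sg x * `|x| `^ p.

Lemma spowN p x : spow p (- x) = - spow p x.
Proof. by rewrite /spow sgrN normrN mulNr. Qed.

Lemma spow0 p : spow p 0 = 0.
Proof. by rewrite /spow sgr0 mul0r. Qed.

Lemma norm_spow p x : x != 0 -> `|spow p x| = `|x| `^ p.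
Proof.
by move=> x0; rewrite normrM normr_sg x0 mul1r ger0_norm// powR_ge0.
Qed.

Lemma spow_gt0 p x : 0 < x -> 0 < spow p x.
Proof. by move=> x0; rewrite /spow gtr0_sg// mul1r powR_gt0// normr_gt0 gt_eqF. Qed.

Lemma mul_spow p x : 0 < p -> spow (p - 1) x * x = `|x| `^ p.
Proof.
by move=> p0; rewrite /spow mulrAC -normrEsg mulr_powRB1.
Qed.

Lemma norm_powR_tangent_strict p x y : 1 < p -> y != 0 -> x != y ->
  `|y| `^ p + p * spow (p - 1) y * (x - y) < `|x| `^ p.
Proof.
move=> p1; wlog y0 : x y / 0 < y => [hw|].
  move=> yn0; have [y0|y0] := leP y 0.
  - move: (y0); rewrite le_eqVlt (negbTE yn0) /= => {}y0 xy; have := hw (- x) (- y); rewrite oppr_gt0 !normrN spowN => /(_ y0).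
    rewrite oppr_eq0 eqr_opp => /(_ (negbT (lt_eqF y0)) xy).
    by rewrite (_ : p * - _ * _ = p * spow (p - 1) y * (x - y)) //; ring.
  - by move=> xy; exact: hw.
move=> yn0 xy; rewrite /spow gtr0_sg// mul1r (gtr0_norm y0).
have [x0|x0] := leP 0 x.
  by rewrite ger0_norm//; apply: powR_tangent_strict => //; exact: ltW.
apply: lt_le_trans (powR_ge0 _ _).
have yp : y `^ p = y * y `^ (p - 1) by rewrite mulr_powRB1 ?ltW//; lra.
have q0 : 0 < y `^ (p - 1) by rewrite powR_gt0.
rewrite yp (_ : _ + _ = y `^ (p - 1) * (y + p * (x - y))); last by ring.
rewrite pmulr_rlt0//.
have : p * (x - y) < x - y by rewrite -subr_lt0 -{2}[x - y]mul1r -mulrBl nmulr_llt0; lra.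
lra.
Qed.

Lemma norm_powR_tangent p x y : 1 < p ->
  `|y| `^ p + p * spow (p - 1) y * (x - y) <= `|x| `^ p.
Proof.
move=> p1; have [->|y0] := eqVneq y 0.
  by rewrite spow0 mulr0 mul0r addr0 normr0 powR0 ?powR_ge0//; lra.
have [->|xy] := eqVneq x y; first by rewrite subrr mulr0 addr0.
exact/ltW/norm_powR_tangent_strict.
Qed.

(** Jensen's inequality, by averaging the tangent inequality at the barycentre [m]. *)
Lemma powR_jensen (I : finType) (w x : I -> R) p : 1 < p ->
  (forall i, 0 <= w i) -> (forall i, 0 <= x i) -> \sum_i w i = 1 ->
  (\sum_i w i * x i) `^ p <= \sum_i w i * x i `^ p.
Proof.
move=> p1 w0 x0 w1; set m := \sum_i w i * x i.
have m0 : 0 <= m by apply: sumr_ge0 => i _; rewrite mulr_ge0.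
apply: (@le_trans _ _ (\sum_i w i * (m `^ p + p * m `^ (p - 1) * (x i - m)))).
  rewrite (eq_bigr (fun i => w i * (m `^ p - p * m `^ (p - 1) * m) + p * m `^ (p - 1) * (w i * x i))); last by move=> i _; ring.
  rewrite big_split/= -mulr_suml w1 mul1r -mulr_sumr -/m subrK//.
by apply: ler_sum => i _; rewrite ler_wpM2l// powR_tangent.
Qed.

Lemma powRD_le p x y : 1 < p ->
  `|x + y| `^ p <= 2 `^ p * (`|x| `^ p + `|y| `^ p).
Proof.
move=> p1; have p0 : 0 <= p by lra.
wlog xy : x y / `|x| <= `|y| => [hw|].
  by have [/hw//|/ltW/hw] := leP `|x| `|y|; rewrite addrC [X in _ * X]addrC.
apply: (@le_trans _ _ ((2 * `|y|) `^ p)).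
  rewrite ge0_ler_powR ?nnegrE// ?mulr_ge0//.
  by rewrite (le_trans (ler_normD _ _))//; lra.
by rewrite powRM// ler_wpM2l ?powR_ge0// lerDr powR_ge0.
Qed.

(** Differentiability of powers on the positive half-line, carried to negative points by oddness.
    The point 0 is left out: the lemma is applied to gradients that do not vanish. *)
Lemma spow_continuous p x : x != 0 -> {for x, continuous (@spow p)}.
Proof.
have pos (z : R) : 0 < z -> spow p y @[y --> z] --> spow p z.
  move=> z0; rewrite /spow gtr0_sg// mul1r gtr0_norm//.
  apply: (@cvg_trans _ ((fun y => y `^ p) @ z)).
    apply: near_eq_cvg; near=> y.
    have y0 : 0 < y by near: y; exact: lt_nbhsr z0.
    by rewrite gtr0_sg// mul1r gtr0_norm.
  have dz : derivable (fun y : R => y `^ p) z 1.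
    by apply: derivable_powR; rewrite in_itv/= z0.
  have /differentiable_continuous := proj1 (derivable1_diffP _ _) dz.
  exact.
move=> x0; have [xp|xn] := ltP 0 x; first exact: pos.
have {}xn : 0 < - x by rewrite oppr_gt0 lt_neqAle x0.
have -> : spow p = (fun y => - spow p (- y)).
  by apply/funext => y; rewrite spowN opprK.
by apply: cvgN; apply: (cvg_comp _ _ (cvgN cvg_id)); exact: pos.
Unshelve. all: by end_near. Qed.

End PowerInequalities.

(** * The generator and its optimal flow *)

Section GraphBasics.
Context (G : mgraph).
Implicit Types (v w : vertex G) (e : edge G).

Lemma mem_end1 e : end1 e \in ends e. Proof. by rewrite !inE eqxx. Qed.
Lemma mem_end2 e : end2 e \in ends e. Proof. by rewrite !inE eqxx orbT. Qed.

Lemma adj_end e : adj (end1 e) (end2 e).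
Proof. by apply/existsP; exists e; rewrite mem_end1 /other eqxx eqxx. Qed.

Lemma adjP v w : loopless G ->
  reflect (exists e, (v = end1 e /\ w = end2 e) \/ (v = end2 e /\ w = end1 e))
    (adj v w).
Proof.
move=> ll; apply: (iffP existsP) => -[e].
  rewrite !inE => /andP[/orP[]/eqP-> /eqP->]; exists e; rewrite /other.
  - by left; rewrite eqxx.
  - by right; rewrite (negbTE (ll e)).
case=> -[-> ->]; exists e; rewrite ?mem_end1 ?mem_end2 /other ?eqxx//.
by rewrite (negbTE (ll e)) eqxx.
Qed.

Lemma adj_sym v w : loopless G -> adj v w = adj w v.
Proof.
by move=> ll; apply/(adjP _ _ ll)/(adjP _ _ ll) => -[e [] [-> ->]]; exists e; [right|left|right|left].
Qed.

Lemma adj_ends e v w : loopless G -> v \in ends e -> w \in ends e -> v != w -> adj v w.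
Proof.
move=> ll; rewrite !inE => /orP[]/eqP-> /orP[]/eqP->; rewrite ?eqxx// => _.
  exact: adj_end.
by rewrite adj_sym// adj_end.
Qed.

Lemma sum_ends (R : nmodType) e (F : vertex G -> R) : loopless G ->
  \sum_(v | v \in ends e) F v = F (end1 e) + F (end2 e).
Proof.
move=> ll; rewrite -big_uniq/=; last by rewrite inE andbT ll.
by rewrite !big_cons big_nil addr0.
Qed.

(** Exchange of summation: each edge contributes at its two ends, with opposite signs of the
    flow. *)
Lemma green (R : realType) (J : vertex G -> vertex G -> R) (Y : vertex G -> R) :
  loopless G -> (forall v w, J v w = - J w v) ->
  \sum_v Y v * divergence J v =
  \sum_e J (end1 e) (end2 e) * (Y (end1 e) - Y (end2 e)).
Proof.
move=> ll Ja; rewrite /divergence.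
under eq_bigr do rewrite mulr_sumr.
rewrite (exchange_big_dep predT)//=; apply: eq_bigr => e _.
rewrite sum_ends// /other eqxx (negbTE (ll e)) (Ja (end2 e)); ring.
Qed.

End GraphBasics.

Section Generator.
Context (S : ndd_igs).
Local Notation V := (vertex (gen S)).
Local Notation E := (edge (gen S)).
Implicit Types (a b : idx S) (e : E) (v w : V).

Lemma phip_phim a b : phip a != phim b.
Proof.
have D c d := @phi_disj S (edge0 S) c d.
have [[H1 H2]|[H1 H2]] := simpleP (edge0 S); first by have := D a b; rewrite H1 H2.
by have := D b a; rewrite H1 H2 eq_sym.
Qed.

Lemma phip_inj : injective (@phip S).
Proof.
move=> a b; have [[H1 H2]|[H1 H2]] := simpleP (edge0 S).
  by rewrite -!H1 => /(phi_inj (mem_end1 (edge0 S))).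
by rewrite -!H2 => /(phi_inj (mem_end2 (edge0 S))).
Qed.

Lemma phim_inj : injective (@phim S).
Proof.
move=> a b; have [[H1 H2]|[H1 H2]] := simpleP (edge0 S).
  by rewrite -!H2 => /(phi_inj (mem_end2 (edge0 S))).
by rewrite -!H1 => /(phi_inj (mem_end1 (edge0 S))).
Qed.

Lemma adj_phip a b : adj (phip a : V) (phip b) = false.
Proof.
apply/negbTE; have [[H1 H2]|[H1 H2]] := simpleP (edge0 S).
  by rewrite -!H1; apply: (phi_indep (mem_end1 (edge0 S))); rewrite imset_f.
by rewrite -!H2; apply: (phi_indep (mem_end2 (edge0 S))); rewrite imset_f.
Qed.

Lemma adj_phim a b : adj (phim a : V) (phim b) = false.
Proof.
apply/negbTE; have [[H1 H2]|[H1 H2]] := simpleP (edge0 S).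
  by rewrite -!H2; apply: (phi_indep (mem_end2 (edge0 S))); rewrite imset_f.
by rewrite -!H1; apply: (phi_indep (mem_end1 (edge0 S))); rewrite imset_f.
Qed.

Lemma adj_phip_phim a b : adj (phip a : V) (phim b) = false.
Proof. by apply/negbTE/(ndd_nondegenerate (n := S)); rewrite imset_f. Qed.

Lemma gen_ll : loopless (gen S). Proof. exact: gen_loopless. Qed.

Lemma eplus_eminus e :
  (eplus e = end1 e /\ eminus e = end2 e) \/ (eplus e = end2 e /\ eminus e = end1 e).
Proof.
rewrite /eminus /other /eplus; case: ifP => _; rewrite ?eqxx; first by left.
by rewrite (negbTE (gen_ll e)); right.
Qed.

Lemma eplus_neq e : eplus e != eminus e.
Proof.
by have [[-> ->]|[-> ->]] := eplus_eminus e; rewrite ?gen_ll// eq_sym gen_ll.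
Qed.

Lemma mem_eplus e v : (v \in ends e) = (v == eplus e) || (v == eminus e).
Proof. by rewrite !inE; have [[-> ->]|[-> ->]] := eplus_eminus e; rewrite // orbC. Qed.

Lemma exists_edge v : exists e, v \in ends e.
Proof.
have [w vw] : exists w, v != w.
  have := phip_phim (idx0 S) (idx0 S); have [->|] := eqVneq v (phip (idx0 S)).
    by exists (phim (idx0 S)).
  by exists (phip (idx0 S)).
have [//|//|s []] := @gen_connected S v w.
case: s => [_ /= vw'|x s /= /andP[/existsP[e /andP[ve _]]]].
  by rewrite vw' eqxx in vw.
by exists e.
Qed.

Definition edge_at v : E := odflt (edge0 S) [pick e | v \in ends e].

Lemma edge_atP v : v \in ends (edge_at v).
Proof.
rewrite /edge_at; case: pickP => [//|H].
by have [e ve] := exists_edge v; rewrite H in ve.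
Qed.

Definition boundary v := v \in Iplus S :|: Iminus S.

Lemma boundary_phip a : boundary (phip a).
Proof. by rewrite /boundary inE imset_f. Qed.

Lemma boundary_phim a : boundary (phim a).
Proof. by rewrite /boundary inE orbC imset_f. Qed.

Lemma boundaryP v : boundary v -> (exists a, v = phip a) \/ (exists a, v = phim a).
Proof.
by rewrite /boundary inE => /orP[]/imsetP[a _ ->]; [left|right]; exists a.
Qed.

Lemma edge_at_uniq v e : boundary v -> v \in ends e -> e = edge_at v.
Proof.
move=> bv ve; have /mem_card1[x Ex] := ndd_doubling (n := S) bv.
have H e' : v \in ends e' -> e' = x.
  by move=> h; apply/eqP; rewrite -[_ == _]/(e' \in pred1 x) -Ex; apply/mem_set.
by rewrite (H _ ve) (H _ (edge_atP v)).
Qed.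

Lemma nbrE v : boundary v -> nbr v = other (edge_at v) v.
Proof.
move=> bv; rewrite /nbr; case: pickP => [w /existsP[e /andP[ve /eqP ->]]|H] /=.
  by rewrite (edge_at_uniq bv ve).
have := H (other (edge_at v) v); suff -> : adj v (other (edge_at v) v) by [].
by apply/existsP; exists (edge_at v); rewrite edge_atP eqxx.
Qed.

Lemma adj_nbr v : boundary v -> adj v (nbr v).
Proof.
by move=> bv; rewrite nbrE//; apply/existsP; exists (edge_at v); rewrite edge_atP eqxx.
Qed.

(** Independence of [I_+] and of [I_-] together with non-degeneracy. Both the strict bounds on the
    optimal potential and the transitivity of [sim] rest on it. *)
Lemma boundary_adj v w : boundary v -> adj v w -> ~~ boundary w.
Proof.
move=> bv vw; apply/negP => /boundaryP bw; move: vw.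
have := boundaryP bv; move: bw => [[b ->]|[b ->]] [[a ->]|[a ->]].
- by rewrite adj_phip.
- by rewrite adj_sym ?adj_phip_phim//; exact: gen_ll.
- by rewrite adj_phip_phim.
- by rewrite adj_phim.
Qed.

Lemma divergence_boundary (R : realType) (J : V -> V -> R) v : boundary v ->
  divergence J v = J v (nbr v).
Proof.
move=> bv; rewrite /divergence nbrE// (big_pred1 (edge_at v))// => e.
by apply/idP/eqP => [/(edge_at_uniq bv)//|->]; rewrite edge_atP.
Qed.

Lemma sum_boundary (R : nmodType) (F : V -> R) : (forall v, ~~ boundary v -> F v = 0) ->
  \sum_v F v = \sum_a F (phip a) + \sum_a F (phim a).
Proof.
move=> F0; rewrite (bigID (fun v => v \in Iplus S))/=; congr +%R.
  by rewrite /Iplus big_imset//= => a b _ _; exact: phip_inj.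
rewrite (bigID (fun v => v \in Iminus S))/= [X in _ + X]big1 ?addr0.
  rewrite -[RHS](big_imset F)/=; last by move=> a b _ _; exact: phim_inj.
  apply: eq_bigl => v; rewrite andb_idl// => /imsetP[a _ ->].
  by apply/imsetP => -[b _ /eqP]; rewrite eq_sym (negbTE (phip_phim _ _)).
by move=> v /andP[v1 v2]; apply: F0; rewrite /boundary inE negb_or v1.
Qed.

End Generator.

(** * Duality between the optimal potential and the optimal flow *)

Section OptimalFlow.
Context (R : realType) (S : ndd_igs) (p : R).
Hypothesis p1 : 1 < p.
Local Notation V := (vertex (gen S)).
Local Notation E := (edge (gen S)).
Local Notation U := (@Uopt R S p).
Local Notation J := (@Jopt R S p).
Local Notation M := (Mconst S p).
Hypothesis Unz : forall e : E, absgrad U e != 0.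
Implicit Types (a b : idx S) (e : E) (v w : V).

Let p_gt0 : 0 < p. Proof. by have := p1; lra. Qed.
Let pm1_gt0 : 0 < p - 1. Proof. by rewrite subr_gt0. Qed.

Lemma Uopt_optimal : optimal_potential p U.
Proof.
(* Without a minimizer [Uopt] would be the default value, the zero function. Its gradients vanish,
   which [Unz] excludes; so [Unz] already yields existence. *)
rewrite /Uopt; case: xgetP => [//|H]; exfalso.
have := Unz (edge0 S); rewrite /Uopt; case: xgetP => [u _ Hu|_].
  by move: (H u).
by rewrite /absgrad subrr normr0 eqxx.
Qed.

Lemma Uphip a : U (phip a) = 1.
Proof. by have [[+ _] _] := Uopt_optimal; apply; rewrite imset_f. Qed.

Lemma Uphim a : U (phim a) = 0.
Proof. by have [[_ +] _] := Uopt_optimal; apply; rewrite imset_f. Qed.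

Local Notation g e := (U (end1 e) - U (end2 e)).

Lemma g_neq0 e : g e != 0.
Proof. by have := Unz e; rewrite /absgrad normr_eq0 -opprB oppr_eq0. Qed.

Lemma g_absgrad e : `|g e| = absgrad U e.
Proof. exact: distrC. Qed.

(** First variation without differentiating the energy: minimality of [U] and the tangent at the
    perturbed potential give [0 <= h t] for [t > 0], and [h] is continuous at 0 because no gradient
    of [U] vanishes. *)
Lemma spow_grad_ge0 (eta : V -> R) : (forall v, boundary v -> eta v = 0) ->
  0 <= \sum_e spow (p - 1) (g e) * (eta (end1 e) - eta (end2 e)).
Proof.
move=> eta0; set d := fun e => eta (end1 e) - eta (end2 e).
pose h t := \sum_e spow (p - 1) (g e + t * d e) * d e.
have hge t : 0 < t -> 0 <= h t.
  move=> t0.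
  have adm : admissible (fun v => U v + t * eta v).
    split=> v /imsetP[a _ ->].
      by rewrite Uphip eta0 ?mulr0 ?addr0//; exact: boundary_phip.
    by rewrite Uphim eta0 ?mulr0 ?addr0//; exact: boundary_phim.
  have := (proj2 Uopt_optimal) _ adm; rewrite /energy.
  have -> : \sum_e absgrad (fun v => U v + t * eta v) e `^ p = \sum_e `|g e + t * d e| `^ p.
    by apply: eq_bigr => e _; rewrite /absgrad distrC; congr (`|_| `^ _); rewrite /d; ring.
  move=> H1.
  have : \sum_e (`|g e + t * d e| `^ p + p * spow (p - 1) (g e + t * d e) * (g e - (g e + t * d e))) <= \sum_e absgrad U e `^ p.
    by apply: ler_sum => e _; rewrite -g_absgrad norm_powR_tangent.
  rewrite big_split/=.
  have -> : \sum_e p * spow (p - 1) (g e + t * d e) * (g e - (g e + t * d e)) = - (p * t) * h t.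
    by rewrite mulr_sumr; apply: eq_bigr => e _; ring.
  move=> H2; have : 0 <= p * t * h t by lra.
  by rewrite pmulr_rge0// mulr_gt0.
have ch : h t @[t --> 0^'+] --> h 0.
  apply: cvg_at_right_filter; apply: cvg_big => [|e _]; first exact: add_continuous.
  apply: cvgM; last exact: cvg_cst.
  apply: (cvg_comp (fun t => g e + t * d e) (spow (p - 1)) (G := nbhs (g e + 0 * d e))).
    by apply: cvgD; [exact: cvg_cst|apply: cvgM; [exact: cvg_id|exact: cvg_cst]].
  by apply: spow_continuous; rewrite mul0r addr0 g_neq0.
have -> : \sum_e spow (p - 1) (g e) * d e = h 0.
  by apply: eq_bigr => e _; rewrite mul0r addr0.
apply: (cvgr_to_ge ch); near=> t; apply: hge.
by near: t; exact: nbhs_right_gt.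
Unshelve. all: by end_near. Qed.

Lemma euler_lagrange (eta : V -> R) : (forall v, boundary v -> eta v = 0) ->
  \sum_e spow (p - 1) (g e) * (eta (end1 e) - eta (end2 e)) = 0.
Proof.
move=> eta0; apply/eqP; rewrite eq_le spow_grad_ge0// andbT.
have := @spow_grad_ge0 (fun v => - eta v); rewrite -oppr_ge0 -sumrN.
set s1 := (X in (_ -> is_true (0 <= X)) -> _); set s2 := (X in _ -> is_true (0 <= X)).
have -> : s1 = s2 by apply: eq_bigr => e _; ring.
by apply=> v /eta0 ->; rewrite oppr0.
Qed.

(** The p-Laplacian flux of [U], scaled by [M^-1] to total strength 1; it is the candidate for the
    optimal flow. *)
Definition Jpot v w : R := if adj v w then M^-1 * spow (p - 1) (U v - U w) else 0.

Lemma Mconst_gt0 : 0 < M.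
Proof.
rewrite /Mconst /energy (bigD1 (edge0 S))//= ltr_pwDl//.
  by rewrite powR_gt0// lt_neqAle eq_sym Unz normr_ge0.
by apply: sumr_ge0 => e _; exact: powR_ge0.
Qed.

Lemma Jpot_anti v w : Jpot v w = - Jpot w v.
Proof.
rewrite /Jpot adj_sym; last exact: gen_ll.
by case: ifP; rewrite ?oppr0// -mulrN -spowN opprB.
Qed.

Lemma Jpot_edge e : Jpot (end1 e) (end2 e) = M^-1 * spow (p - 1) (g e).
Proof. by rewrite /Jpot adj_end. Qed.

Lemma green_Jpot (Y : V -> R) : \sum_v Y v * divergence Jpot v =
  M^-1 * \sum_e spow (p - 1) (g e) * (Y (end1 e) - Y (end2 e)).
Proof.
rewrite green//; [|exact: gen_ll|exact: Jpot_anti].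
by rewrite mulr_sumr; apply: eq_bigr => e _; rewrite Jpot_edge -mulrA.
Qed.

Lemma divergence_Jpot v : ~~ boundary v -> divergence Jpot v = 0.
Proof.
(* The indicator of the interior vertex [v] is a valid test function in [euler_lagrange], and
   Green's formula with it isolates the divergence at [v]. *)
move=> bv; have := green_Jpot (fun w => (w == v)%:R).
rewrite (@euler_lagrange (fun w => (w == v)%:R)) ?mulr0; last first.
  by move=> w bw; case: eqVneq => // wv; rewrite -wv bw in bv.
rewrite (bigD1 v)//= eqxx mul1r big1 ?addr0// => w /negbTE ->.
by rewrite mul0r.
Qed.

Lemma sum_U_divergence (J' : V -> V -> R) : (forall v, ~~ boundary v -> divergence J' v = 0) ->
  \sum_v U v * divergence J' v = \sum_(v in Iplus S) divergence J' v.
Proof.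
move=> dJ; rewrite sum_boundary; last by move=> v /dJ ->; rewrite mulr0.
rewrite [X in _ + X]big1 ?addr0; last by move=> a _; rewrite Uphim mul0r.
rewrite /Iplus big_imset/=; last by move=> a b _ _; exact: phip_inj.
by apply: eq_bigr => a _; rewrite Uphip mul1r.
Qed.

Lemma unit_flow_Jpot : unit_flow (Iplus S) (Iminus S) Jpot.
Proof.
split=> [|v w /negbTE nvw|v|]; first exact: Jpot_anti.
- by rewrite /Jpot nvw.
- exact: divergence_Jpot.
- rewrite -sum_U_divergence; last exact: divergence_Jpot.
  rewrite green_Jpot (eq_bigr (fun e => absgrad U e `^ p)).
    by rewrite -/(energy p U) -/M mulVf// gt_eqF// Mconst_gt0.
  by move=> e _; rewrite mul_spow ?g_absgrad.
Qed.

(** Green's formula with the boundary values 1 and 0 of [U]. Consequently differences of unit flows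
    are orthogonal to the gradient of [U]. *)
Lemma unit_flow_pairing (J' : V -> V -> R) : unit_flow (Iplus S) (Iminus S) J' ->
  \sum_e J' (end1 e) (end2 e) * g e = 1.
Proof.
move=> [Ja _ Jd J1]; rewrite -green//; last exact: gen_ll.
by rewrite sum_U_divergence.
Qed.

Let q := conj_exp p.

Lemma conj_exp_gt1 : 1 < q.
Proof. by rewrite /q /conj_exp ltr_pdivlMr ?pm1_gt0// mul1r ltrBlDr ltrDl. Qed.

(** As [(p - 1) * (q - 1) = 1], the dual power undoes the power in [Jpot]. The derivative of the
    flow energy at [Jpot] is thus a multiple of the gradient of [U] and pairs to 0 with differences
    of unit flows. *)
Lemma spow_Jpot e : spow (q - 1) (Jpot (end1 e) (end2 e)) = M^-1 `^ (q - 1) * g e.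
Proof.
rewrite Jpot_edge /spow sgrM gtr0_sg ?invr_gt0 ?Mconst_gt0// mul1r.
rewrite sgrM sgr_id (gtr0_sg (_ : 0 < `|g e| `^ (p - 1))); last by rewrite powR_gt0// normr_gt0 g_neq0.
rewrite mulr1 normrM normrM normr_sg g_neq0 mul1r (gtr0_norm (_ : 0 < M^-1)) ?invr_gt0 ?Mconst_gt0//.
rewrite powRM ?invr_ge0 ?(ltW Mconst_gt0)// ger0_norm ?powR_ge0// -powRrM.
rewrite (_ : (p - 1) * (q - 1) = 1); last by rewrite /q /conj_exp; field; rewrite gt_eqF.
by rewrite powRr1// mulrCA mulr_sg_norm.
Qed.

Lemma flow_energy_Jpot (J' : V -> V -> R) : unit_flow (Iplus S) (Iminus S) J' ->
  (exists e, J' (end1 e) (end2 e) != Jpot (end1 e) (end2 e)) ->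
  flow_energy q Jpot < flow_energy q J'.
Proof.
move=> uJ [e0 He0]; have q1 := conj_exp_gt1.
have -> : flow_energy q Jpot = \sum_e (`|Jpot (end1 e) (end2 e)| `^ q +
    q * spow (q - 1) (Jpot (end1 e) (end2 e)) * (J' (end1 e) (end2 e) - Jpot (end1 e) (end2 e))).
  rewrite big_split/= -/(flow_energy q Jpot).
  rewrite (eq_bigr (fun e => q * M^-1 `^ (q - 1) * (J' (end1 e) (end2 e) * g e) -
     q * M^-1 `^ (q - 1) * (Jpot (end1 e) (end2 e) * g e))); last first.
    by move=> e _; rewrite spow_Jpot; ring.
  rewrite sumrB -!mulr_sumr !unit_flow_pairing//; last exact: unit_flow_Jpot.
  by rewrite subrr addr0.
rewrite /flow_energy (bigD1 e0)//= [X in _ < X](bigD1 e0)//=.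
apply: ltr_leD.
  apply: norm_powR_tangent_strict => //.
  rewrite Jpot_edge mulf_neq0 ?invr_eq0 ?(gt_eqF Mconst_gt0)//.
  by rewrite -normr_gt0 norm_spow ?g_neq0// powR_gt0// normr_gt0 g_neq0.
by apply: ler_sum => e _; exact: norm_powR_tangent.
Qed.

Lemma unit_flow_ext (J' : V -> V -> R) : unit_flow (Iplus S) (Iminus S) J' ->
  (forall e, J' (end1 e) (end2 e) = Jpot (end1 e) (end2 e)) -> J' = Jpot.
Proof.
move=> [Ja J0 _ _] H; apply/funext => v; apply/funext => w.
have [/(adjP _ _ (@gen_ll S))[e [] [-> ->]]|vw] := boolP (adj v w); first exact: H.
  by rewrite Ja Jpot_anti H.
by rewrite J0// /Jpot (negbTE vw).
Qed.

(** [Jpot] is a minimizer, so [Jopt] is not its default value; strict minimality then identifies the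
    two. *)
Lemma JoptE : J = Jpot.
Proof.
have oJ : optimal_flow p Jpot.
  split; first exact: unit_flow_Jpot.
  move=> J' uJ; have [H|/existsNP[e /eqP He]] := pselect (forall e, J' (end1 e) (end2 e) = Jpot (end1 e) (end2 e)).
    by rewrite (unit_flow_ext uJ H).
  by apply/ltW/flow_energy_Jpot => //; exists e.
have [uJ minJ] : optimal_flow p J by rewrite /Jopt; apply: xgetPex; exists Jpot.
apply: unit_flow_ext => // e; apply/eqP/negPn/negP => He.
have := minJ _ unit_flow_Jpot; rewrite leNgt => /negP; apply.
by apply: flow_energy_Jpot => //; exists e.
Qed.

Lemma unit_flow_Jopt : unit_flow (Iplus S) (Iminus S) J.
Proof. by rewrite JoptE; exact: unit_flow_Jpot. Qed.

Lemma Jopt_adj v w : adj v w -> J v w = M^-1 * spow (p - 1) (U v - U w).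
Proof. by move=> vw; rewrite JoptE /Jpot vw. Qed.

(** Strong maximum principle, with [s] equal to 1 at a maximum and to -1 at a minimum. For nonzero
    [s] all flow values leaving [v], multiplied by [s], would be positive, while the divergence at
    [v] is 0. *)
Lemma interior_extremum v (s : R) : ~~ boundary v ->
  (forall w, 0 <= s * (U v - U w)) -> s == 0.
Proof.
move=> bv H; apply/negPn/negP => s0.
have : divergence Jpot v = 0 by exact: divergence_Jpot.
move/eqP; rewrite -(mulrI_eq0 _ (mulfI s0)) /divergence mulr_sumr.
have [e0 ve0] := exists_edge v; rewrite (bigD1 e0)//= gt_eqF//.
have K e : v \in ends e -> 0 < s * Jpot v (other e v).
  move=> ve; rewrite /Jpot ifT; last by apply/existsP; exists e; rewrite ve eqxx.
  rewrite mulrCA pmulr_rgt0 ?invr_gt0 ?Mconst_gt0//.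
  have d0 : U v - U (other e v) != 0.
    move: ve; rewrite /other !inE => /orP[]/eqP ->; rewrite ?eqxx ?g_neq0//.
    by rewrite (negbTE (@gen_ll S e)) -opprB oppr_eq0 g_neq0.
  have : 0 < s * (U v - U (other e v)) by rewrite lt_neqAle eq_sym mulf_neq0//= H.
  rewrite -[X in s * X]mulr_sg_norm mulrA pmulr_lgt0 ?normr_gt0// => h.
  by rewrite /spow mulrA pmulr_rgt0// powR_gt0// normr_gt0.
rewrite ltr_pwDl ?K//; apply: sumr_ge0 => e /andP[ve _]; exact/ltW/K.
Qed.

Lemma Uopt_ge0_le1 v : 0 <= U v <= 1.
Proof.
have bd w : boundary w -> 0 <= U w <= 1.
  by move=> /boundaryP[[a ->]|[a ->]]; rewrite ?Uphip ?Uphim lexx ler01.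
apply/andP; split.
- have [w _ mw] := @arg_minP _ _ _ v predT U isT.
  apply: le_trans (mw v isT); have [/bd/andP[]//|bw] := boolP (boundary w).
  have := @interior_extremum w (-1) bw; rewrite oppr_eq0 oner_eq0 => H.
  by suff: false by []; apply: H => x; rewrite mulN1r opprB subr_ge0 mw.
- have [w _ mw] := @arg_maxP _ _ _ v predT U isT.
  apply: le_trans (mw v isT) _; have [/bd/andP[]//|bw] := boolP (boundary w).
  have := @interior_extremum w 1 bw; rewrite oner_eq0 => H.
  by suff: false by []; apply: H => x; rewrite mul1r subr_ge0; exact: mw.
Qed.

Lemma Uopt_interior v : ~~ boundary v -> 0 < U v < 1.
Proof.
move=> bv; have /andP[U0 U1] := Uopt_ge0_le1 v.
rewrite !lt_neqAle U0 U1 !andbT; apply/andP; split; apply/eqP => H.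
- have := @interior_extremum v (-1) bv; rewrite oppr_eq0 oner_eq0 => K.
  suff: false by []; apply: K => x; rewrite -H sub0r mulN1r opprK.
  by have /andP[] := Uopt_ge0_le1 x.
- have := @interior_extremum v 1 bv; rewrite oner_eq0 => K.
  suff: false by []; apply: K => x; rewrite H mul1r subr_ge0.
  by have /andP[] := Uopt_ge0_le1 x.
Qed.

(** By [boundary_adj] at least one end is interior, with value strictly between 0 and 1, and the
    other end lies in [[0, 1]]. *)
Lemma absgrad_lt1 e : absgrad U e < 1.
Proof.
have := adj_end e; have := g_neq0 e; rewrite /absgrad -normrN opprB.
have [/Uopt_interior/andP[]|/negPn/boundaryP b1] := boolP (~~ boundary (end1 e)).
  by have /andP[] := Uopt_ge0_le1 (end2 e); move=> ? ? ? ? _ _; rewrite ltr_norml; lra.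
have [/Uopt_interior/andP[]|/negPn/boundaryP b2] := boolP (~~ boundary (end2 e)).
  by have /andP[] := Uopt_ge0_le1 (end1 e); move=> ? ? ? ? _ _; rewrite ltr_norml; lra.
move: b1 b2 => [[a ->]|[a ->]] [[b ->]|[b ->]].
- by rewrite adj_phip.
- by rewrite adj_phip_phim.
- by rewrite adj_sym ?adj_phip_phim//; exact: gen_ll.
- by rewrite adj_phim.
Qed.

Lemma absgrad_gt0 e : 0 < absgrad U e.
Proof. by rewrite lt_neqAle eq_sym Unz normr_ge0. Qed.

Lemma Mconst_lt : M < #|E|%:R.
Proof.
rewrite -sum1_card natr_sum; apply: ltr_sum => [|e _].
  by apply/hasP; exists (edge0 S); rewrite ?mem_index_enum.
apply: le_lt_trans (absgrad_lt1 e); apply: ge1r_powR; last exact: ltW.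
by rewrite absgrad_gt0 ltW ?absgrad_lt1.
Qed.

Lemma Jdens_eq a : @Jdens R S p a = M^-1 * spow (p - 1) (1 - U (nbr (phip a))).
Proof. by rewrite /Jdens Jopt_adj ?Uphip// adj_nbr// boundary_phip. Qed.

Lemma Unbr_phip a : 0 < U (nbr (phip a)) < 1.
Proof.
by apply: Uopt_interior; apply: boundary_adj (adj_nbr _); exact: boundary_phip.
Qed.

Lemma Jdens_gt0 a : 0 < @Jdens R S p a.
Proof.
rewrite Jdens_eq mulr_gt0 ?invr_gt0 ?Mconst_gt0// spow_gt0// subr_gt0.
by have /andP[] := Unbr_phip a.
Qed.

(** [M] cancels the normalisation of the flow and leaves the [(p - 1)]-th power of [1 - U] at the
    interior neighbour of [phip a]. *)
Lemma Mconst_Jdens_lt1 a : M * @Jdens R S p a < 1.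
Proof.
rewrite Jdens_eq mulVKf ?gt_eqF ?Mconst_gt0//.
have /andP[U0 U1] := Unbr_phip a.
rewrite /spow gtr0_sg ?subr_gt0// mul1r gtr0_norm ?subr_gt0//.
rewrite -[X in _ < X](_ : 1 `^ (p - 1) = 1); last by rewrite powR1.
by rewrite gt0_ltr_powR ?nnegrE//; lra.
Qed.

Lemma sum_Jdens : \sum_a @Jdens R S p a = 1.
Proof.
have [_ _ _ <-] := unit_flow_Jopt.
rewrite /Iplus big_imset/=; last by move=> a b _ _; exact: phip_inj.
by apply: eq_bigr => a _; rewrite divergence_boundary//; exact: boundary_phip.
Qed.

Definition jflow e : R := J (eplus e) (eminus e).

(** Conductive uniformity makes the flow into [phim a] equal to the flow out of [phip a], so the
    boundary terms of Green's formula pair up index by index. *)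
Lemma jflow_green (Y : V -> R) : conductively_uniform R S ->
  \sum_e jflow e * (Y (eplus e) - Y (eminus e)) =
  \sum_a @Jdens R S p a * (Y (phip a) - Y (phim a)).
Proof.
move=> CU; have [Ja _ dJ _] := unit_flow_Jopt.
transitivity (\sum_e J (end1 e) (end2 e) * (Y (end1 e) - Y (end2 e))).
  apply: eq_bigr => e _; rewrite /jflow.
  by have [[-> ->]|[-> ->]] := eplus_eminus e => //; rewrite Ja; ring.
rewrite -green//; last exact: gen_ll.
rewrite sum_boundary; last by move=> v bv; rewrite dJ ?mulr0.
rewrite -big_split/=; apply: eq_bigr => a _.
rewrite !divergence_boundary ?boundary_phip ?boundary_phim//.
by rewrite /Jdens CU//; ring.
Qed.

Lemma norm_jflow e : M * `|jflow e| = absgrad U e `^ (p - 1).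
Proof.
have -> : `|jflow e| = `|J (end1 e) (end2 e)|.
  rewrite /jflow; have [Ja _ _ _] := unit_flow_Jopt.
  by have [[-> ->]|[-> ->]] := eplus_eminus e; rewrite // Ja normrN.
rewrite Jopt_adj ?adj_end// normrM norm_spow ?g_neq0// g_absgrad.
by rewrite gtr0_norm ?invr_gt0 ?Mconst_gt0// mulVKf// gt_eqF// Mconst_gt0.
Qed.

Lemma sum_jflow_absgrad : \sum_e `|jflow e| * absgrad U e = 1.
Proof.
have M0 := Mconst_gt0; apply: (mulfI (lt0r_neq0 M0)); rewrite mulr1 mulr_sumr.
apply: eq_bigr => e _; rewrite mulrA norm_jflow mulrC mulr_powRB1 ?normr_ge0//.
Qed.

End OptimalFlow.

(** * Replacement graphs and words *)

Local Close Scope ring_scope.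
Local Open Scope quotient_scope.

Section Gluing.
Context (S : ndd_igs) (G : mgraph).
Hypothesis ll : loopless G.
Local Notation V1 := (vertex (gen S)).
Implicit Types (e : edge G) (v : vertex G) (a : idx S) (z : V1).

Lemma cls_repr (x : rvertex S G) : cls (repr x).1 (repr x).2 = x.
Proof. by rewrite /cls -surjective_pairing reprK. Qed.

Lemma cls_phi_at v e e' a : v \in ends e -> v \in ends e' ->
  cls (phi_at v e a) e = cls (phi_at v e' a) e' :> rvertex S G.
Proof.
move=> ve ve'; apply/eqquotP/connect1/existsP; exists v; apply/existsP; exists a.
by rewrite /= ve ve' !eqxx.
Qed.

(** Induction along a chain of elementary gluings that starts at the representative. The lemma
    evaluates [gcode], [sigma] and [interp] on classes. *)
Lemma repr_cls_invariant (T : Type) (F : V1 * edge G -> T) :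
  (forall v e e' a, v \in ends e -> v \in ends e' ->
     F (phi_at v e a, e) = F (phi_at v e' a, e')) ->
  forall z e, F (repr (cls z e)) = F (z, e).
Proof.
move=> HF z e; have : cls (repr (cls z e)).1 (repr (cls z e)).2 = cls z e by exact: cls_repr.
rewrite /cls -surjective_pairing => /eqquotP/connectP[s].
elim: s (repr _) => [x _ /= ->//|y s IH x /= /andP[xy ys] sl].
rewrite -(IH y)//; case/existsP: xy => v /existsP[a].
case: x y {IH ys sl} => [x1 x2] [y1 y2] /= /and4P[vx vy /eqP-> /eqP->].
exact: HF.
Qed.

(** A complete invariant of the gluing: a boundary point is recorded by the vertex and the index
    through which it is glued, an interior point by itself. It shows that the transitive closure
    identifies nothing beyond a single gluing step. *)
Definition gcode (x : V1 * edge G) : (vertex G * idx S) + (V1 * edge G) :=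
  if [pick a | x.1 == phip a] is Some a then inl (end1 x.2, a)
  else if [pick a | x.1 == phim a] is Some a then inl (end2 x.2, a) else inr x.

Lemma gcode_phi_at v e a : v \in ends e -> gcode (phi_at v e a, e) = inl (v, a).
Proof.
rewrite !inE /gcode /phi_at /= => /orP[]/eqP->; rewrite ?eqxx.
  case: pickP => [b /eqP/phip_inj ->//|/(_ a)]; by rewrite eqxx.
rewrite eq_sym (negbTE (ll e)); case: pickP => [b|_].
  by rewrite eq_sym (negbTE (phip_phim _ _)).
by case: pickP => [b /eqP/phim_inj ->//|/(_ a)]; rewrite eqxx.
Qed.

Lemma gcode_repr z e : gcode (repr (cls z e)) = gcode (z, e).
Proof.
by apply: repr_cls_invariant => v e1 e2 a v1 v2; rewrite !gcode_phi_at.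
Qed.

Lemma gcode_inl z e v a : gcode (z, e) = inl (v, a) -> v \in ends e /\ z = phi_at v e a.
Proof.
rewrite /gcode/=; case: pickP => [b /eqP ->|_].
  by case=> <- <-; rewrite mem_end1 /phi_at eqxx.
case: pickP => [b /eqP ->|//] [<- <-]; rewrite mem_end2 /phi_at.
by rewrite eq_sym (negbTE (ll e)).
Qed.

Lemma gcode_inr z e x : gcode (z, e) = inr x -> x = (z, e).
Proof. by rewrite /gcode; case: pickP => // _; case: pickP => // _ []. Qed.

Lemma cls_inv z e z' e' : cls z e = cls z' e' ->
  (z = z' /\ e = e') \/
  exists v a, [/\ v \in ends e, v \in ends e', z = phi_at v e a & z' = phi_at v e' a].
Proof.
move=> H; have : gcode (z, e) = gcode (z', e') by rewrite -!gcode_repr H.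
case E: (gcode (z, e)) => [[v a]|x] /esym E'.
  have [ve zE] := gcode_inl E; have [ve' zE'] := gcode_inl E'.
  by right; exists v, a.
by have := gcode_inr E'; rewrite (gcode_inr E) => -[-> ->]; left.
Qed.

Lemma cls_inj z z' e : cls z e = cls z' e -> z = z'.
Proof. by move=> /cls_inv[[]//|[v [a [_ _ -> ->]]]]. Qed.

Lemma replace_loopless : loopless (replace S G).
Proof. by move=> [e f]; apply/eqP => /cls_inj/eqP; apply/negP/eplus_neq. Qed.

Lemma mem_cls z e (f : edge (gen S)) :
  (cls z e \in ends ((e, f) : edge (replace S G))) = (z \in ends f).
Proof.
rewrite [RHS]mem_eplus [LHS]inE [X in _ || X]inE; congr orb.
  by apply/eqP/eqP => [/cls_inj|->].
by apply/eqP/eqP => [/cls_inj|->].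
Qed.

Lemma ends_cls x e (f : edge (gen S)) : x \in ends ((e, f) : edge (replace S G)) ->
  exists2 z, z \in ends f & x = cls z e.
Proof.
rewrite !inE => /orP[]/eqP->; [exists (eplus f)|exists (eminus f)] => //=;
  by rewrite mem_eplus eqxx ?orbT.
Qed.

Lemma boundary_phi_at v e a : boundary (phi_at v e a : V1).
Proof. by rewrite /phi_at; case: ifP => _; [exact: boundary_phip|exact: boundary_phim]. Qed.

End Gluing.

(** * Words, fibers and the equivalence of sequences *)

Section Words.
Context (S : ndd_igs).
Local Notation V n := (vertex (rgraph S n)).
Local Notation E n := (edge (rgraph S n)).
Local Notation E1 := (edge (gen S)).

Lemma rgraph_loopless n : loopless (rgraph S n).
Proof. by elim: n => [//|n IH]; exact: replace_loopless. Qed.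

Lemma rgraph_exists_edge n (v : V n) : exists e : E n, v \in ends e.
Proof.
case: n v => [|n] v.
  by exists tt; case: v; [exact: mem_end1|exact: mem_end2].
exists ((repr v).2, edge_at (repr v).1).
by rewrite -{1}(cls_repr v) mem_cls ?edge_atP//; exact: rgraph_loopless.
Qed.

Lemma incident_edgeP n (v : V n) : v \in ends (incident_edge v).
Proof.
rewrite /incident_edge; case: pickP => [//|H].
by have [e ve] := rgraph_exists_edge v; rewrite H in ve.
Qed.

Lemma vdotE n (v : V n) (e : E n) a : v \in ends e -> vdot v a = cls (phi_at v e a) e.
Proof. by move=> ve; apply: cls_phi_at => //; exact: incident_edgeP. Qed.

Lemma vdot_end1 n (e : E n) a : vdot (end1 e) a = cls (phip a) e.
Proof. by rewrite (vdotE _ (mem_end1 e)) /phi_at eqxx. Qed.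

Lemma vdot_end2 n (e : E n) a : vdot (end2 e) a = cls (phim a) e.
Proof.
by rewrite (vdotE _ (mem_end2 e)) /phi_at eq_sym (negbTE (rgraph_loopless e)).
Qed.

Lemma cls_vdot_inv n (v : V n) (e : E n) z a : cls z e = vdot v a ->
  v \in ends e /\ z = phi_at v e a.
Proof.
move=> H; apply: gcode_inl; first exact: rgraph_loopless.
have L := @rgraph_loopless n.
by rewrite -(gcode_repr L) H (gcode_repr L) gcode_phi_at//; exact: incident_edgeP.
Qed.

Definition step_edge n (v : V n) (e : E n) (a : idx S) : E1 := edge_at (phi_at v e a).

Lemma vdot_step n (v : V n) (e : E n) a : v \in ends e ->
  vdot v a \in ends ((e, step_edge v e a) : E n.+1).
Proof. by move=> ve; rewrite (vdotE _ ve) mem_cls ?edge_atP//; exact: rgraph_loopless. Qed.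

Lemma step_edge_uniq n (v : V n) (e : E n) a f :
  vdot v a \in ends ((e, f) : E n.+1) -> v \in ends e /\ f = step_edge v e a.
Proof.
move=> /ends_cls[z zf /esym/cls_vdot_inv[ve zE]]; split=> //.
by apply: edge_at_uniq; rewrite ?boundary_phi_at// -zE.
Qed.

(** An edge serving two indices would join two distinct boundary points. Injectivity lets the
    energies of the children along a fiber be counted within the sum over all children. *)
Lemma step_edge_inj n (v : V n) (e : E n) : injective (step_edge v e).
Proof.
move=> a b ab; have va := boundary_phi_at v e a; have vb := boundary_phi_at v e b.
suff : phi_at v e a = phi_at v e b.
  by rewrite /phi_at; case: ifP => _; [exact: phip_inj|exact: phim_inj].
apply/eqP/negPn/negP => nab.
have : adj (phi_at v e a) (phi_at v e b : vertex (gen S)).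
  apply: (@adj_ends _ (step_edge v e a)) => //; first exact: gen_ll.
    exact: edge_atP.
  by rewrite ab edge_atP.
by move/(boundary_adj va); rewrite vb.
Qed.

Definition touch n (e e' : E n) := exists2 v, v \in ends e & v \in ends e'.

Lemma touch_refl n (e : E n) : touch e e.
Proof. by exists (end1 e); exact: mem_end1. Qed.

Lemma touch_sym n (e e' : E n) : touch e e' -> touch e' e.
Proof. by case=> v; exists v. Qed.

(** Words with different parents meet only along the gluing, by [cls_inv]; this is why touching
    passes to prefixes. *)
Lemma common_vertex n (e e' : E n) (f f' : E1) (x : V n.+1) :
  x \in ends ((e, f) : E n.+1) -> x \in ends ((e', f') : E n.+1) -> e != e' ->
  exists v a, [/\ v \in ends e, v \in ends e' & x = vdot v a].
Proof.
move=> /ends_cls[z zf ->] /ends_cls[z' zf'] /(cls_inv (@rgraph_loopless n)).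
case=> [[_ ->]|[v [a [ve ve' -> _]]] _]; first by rewrite eqxx.
by exists v, a; rewrite (vdotE _ ve).
Qed.

Lemma touch_pred n (e e' : E n.+1) : touch e e' -> touch e.1 e'.1.
Proof.
case: e e' => [e f] [e' f'] [x xe xe'] /=.
have [->|ee'] := eqVneq e e'; first exact: touch_refl.
by have [v [a [ve ve' _]]] := common_vertex xe xe' ee'; exists v.
Qed.

Lemma touch_pref_le (s t : nat -> E1) k n : (k <= n)%N ->
  touch (pref s n) (pref t n) -> touch (pref s k) (pref t k).
Proof.
elim: n => [|n IH]; first by rewrite leqn0 => /eqP->.
by rewrite leq_eqVlt => /predU1P[->//|kn /touch_pred]; exact: IH.
Qed.

Lemma pref_eqP (s t : nat -> E1) n :
  (forall i, (i < n)%N -> s i = t i) <-> pref s n = pref t n.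
Proof.
elim: n => [|n IH] //=; split=> [H|[/IH H1 H2] i].
  by rewrite H// (proj1 IH)// => i ni; apply: H; exact: ltnW.
by rewrite ltnS leq_eqVlt => /predU1P[->//|/H1].
Qed.

Fixpoint letters n : E n -> seq E1 :=
  if n is n'.+1 return E n -> seq E1 then fun e => rcons (letters e.1) e.2 else fun=> [::].

Lemma size_letters n (e : E n) : size (letters e) = n.
Proof. by elim: n e => [//|n IH] e; rewrite size_rcons IH. Qed.

Definition scat n (e : E n) (t : nat -> E1) : nat -> E1 :=
  fun k => if (k < n)%N then nth (edge0 S) (letters e) k else t (k - n)%N.

Lemma pref_nth n (e : E n) s : (forall k, (k < n)%N -> s k = nth (edge0 S) (letters e) k) ->
  pref s n = e.
Proof.
elim: n e => [[]//|n IH] [e f] H /=; rewrite H//= nth_rcons size_letters ltnn eqxx.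
by rewrite (IH e)// => k kn; rewrite H 1?ltnW//= nth_rcons size_letters kn.
Qed.

Lemma pref_scat n (e : E n) t : pref (scat e t) n = e.
Proof. by apply: pref_nth => k kn; rewrite /scat kn. Qed.

Lemma scat_nth n (e : E n) t m : scat e t (m + n)%N = t m.
Proof. by rewrite /scat ltnNge leq_addl/= addnK. Qed.

Lemma pref_scat_S n (e : E n) t m :
  pref (scat e t) (m.+1 + n) = (pref (scat e t) (m + n), t m) :> E (m + n).+1.
Proof. by rewrite -[RHS]/(_, _) -(scat_nth e t m). Qed.

Lemma scat_pref n (s : nat -> E1) : scat (pref s n) (fun k => s (k + n)%N) = s.
Proof.
apply/funext => k; rewrite /scat; case: ltnP => kn; last by rewrite subnK.
have /pref_eqP := pref_scat (pref s n) s => /(_ k kn); rewrite /scat kn => <-//.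
Qed.

Lemma scat_rcons n (e : E n) f t :
  scat ((e, f) : E n.+1) t = scat e (fun k => if k is k'.+1 then t k' else f).
Proof.
apply/funext => k; rewrite /scat /=; case: (ltngtP k n) => kn.
- by rewrite ltnW// nth_rcons size_letters kn.
- by rewrite ltnNge kn/=; case: k kn => // k kn; rewrite subSS subSn.
- by rewrite kn ltnSn nth_rcons size_letters ltnn eqxx subnn.
Qed.

Lemma scat0 (e : E 0) t : scat e t = t.
Proof. by apply/funext => k; rewrite /scat subn0. Qed.

(** The condition in [Tseq] without the choice of an initial edge; by [sim_fiber] all such sequences
    represent one point of the limit space. *)
Definition on_fiber n (v : V n) (a : nat -> idx S) (s : nat -> E1) :=
  forall m, vword v a m \in ends (pref s (m + n)).

Fixpoint fiber_edge n (v : V n) (e : E n) (a : nat -> idx S) m : E (m + n) :=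
  if m is m'.+1 return E (m + n)
  then (fiber_edge v e a m', step_edge (vword v a m') (fiber_edge v e a m') (a m'))
  else e.

Lemma exists_on_fiber n (v : V n) (e : E n) a : v \in ends e ->
  exists s, pref s n = e /\ on_fiber v a s.
Proof.
move=> ve; pose t m := step_edge (vword v a m) (fiber_edge v e a m) (a m).
have H m : pref (scat e t) (m + n) = fiber_edge v e a m.
  elim: m => [|m IH]; first exact: pref_scat.
  by rewrite pref_scat_S IH.
exists (scat e t); split; first exact: pref_scat.
move=> m; rewrite H; elim: m => [//|m IH]; exact: vdot_step.
Qed.

Lemma on_fiber_step n (v : V n) a s m : on_fiber v a s ->
  s (m + n)%N = step_edge (vword v a m) (pref s (m + n)) (a m).
Proof. by move=> H; have [_ <-] := step_edge_uniq (H m.+1). Qed.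

Lemma vword_ext n (v : V n) (a b : nat -> idx S) m :
  (forall i, (i < m)%N -> a i = b i) -> vword v a m = vword v b m.
Proof.
by elim: m => [//|m IH] H /=; rewrite H// IH// => i im; apply: H; exact: ltnW.
Qed.

Lemma on_fiber_ext n (v : V n) (a b : nat -> idx S) s t m :
  on_fiber v a s -> on_fiber v b t -> pref s n = pref t n ->
  (forall i, (i < m)%N -> a i = b i) -> pref s (m + n) = pref t (m + n).
Proof.
move=> Hs Ht st; elim: m => [//|m IH] H.
have IHm : pref s (m + n) = pref t (m + n) by apply: IH => i im; apply: H; exact: ltnW.
rewrite /= IHm (on_fiber_step m Hs) (on_fiber_step m Ht) IHm H//.
by rewrite (@vword_ext _ v a b)// => i im; apply: H; exact: ltnW.
Qed.

Lemma TseqP n (v : V n) (e : E n) a : v \in ends e ->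
  pref (Tseq v e a) n = e /\ on_fiber v a (Tseq v e a).
Proof.
move=> ve; rewrite /Tseq; case: xgetP => [s _ //|H]; exfalso.
by have [s Hs] := exists_on_fiber a ve; exact: (H s).
Qed.

Lemma Tseq_ext n (v : V n) (e : E n) (a b : nat -> idx S) m : v \in ends e ->
  (forall i, (i < m)%N -> a i = b i) ->
  pref (Tseq v e a) (m + n) = pref (Tseq v e b) (m + n).
Proof.
move=> ve ab; have [Ea Ha] := TseqP a ve; have [Eb Hb] := TseqP b ve.
by apply: (on_fiber_ext Ha Hb) => //; rewrite Ea Eb.
Qed.

(** The two sides live over [m.+1 + n] and [m + n.+1], which are not convertible; packing the level
    with the vertex avoids a cast. *)
Lemma vword_shift n (v : V n) (a : nat -> idx S) m :
  existT (fun k => V k) _ (vword v a m.+1) =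
  existT (fun k => V k) _ (vword (vdot v (a 0%N)) (fun i => a i.+1) m).
Proof.
elim: m => [//|m IH].
exact: (congr1 (fun u : {k & V k} => existT (fun k => V k) _ (vdot (projT2 u) (a m.+1))) IH).
Qed.

Lemma on_fiber_shift n (v : V n) a s : on_fiber v a s ->
  on_fiber (vdot v (a 0%N)) (fun i => a i.+1) s.
Proof.
move=> H m; have := H m.+1; have := vword_shift v a m.
by move/(congr1 (fun u : {k & V k} => projT2 u \in ends (pref s (projT1 u)))) => /= ->.
Qed.

Lemma sim_refl (s : Sigma S) : sim s s.
Proof. by move=> i; exact: touch_refl. Qed.

Lemma sim_sym (s t : Sigma S) : sim s t -> sim t s.
Proof. by move=> st i; exact/touch_sym/st. Qed.

(* Two distinct vertices at which an edge touches the neighbours of its parent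
   would be two adjacent points of I_+ and I_-. *)
Lemma sim_trans (t s r : Sigma S) : sim s t -> sim t r -> sim s r.
Proof.
move=> st tr i; have [sti|nst] := eqVneq (pref s i) (pref t i).
  by have := tr i; rewrite -sti.
have [tri|ntr] := eqVneq (pref t i) (pref r i).
  by have := st i; rewrite tri.
have [x xs xt] := st i.+1; have [y yt yr] := tr i.+1.
have [xy|xy] := eqVneq x y.
  by apply: (@touch_pref_le s r i i.+1) => //; exists x => //; rewrite xy.
have [v [a [vs vt xE]]] := common_vertex xs xt nst.
have [w [b [wt wr yE]]] := common_vertex yt yr ntr.
have [z zf xz] := ends_cls xt; have [z' zf' yz'] := ends_cls yt.
have [_ zE] : v \in ends (pref t i) /\ z = phi_at v (pref t i) a.
  by apply: cls_vdot_inv; rewrite -xz.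
have [_ zE'] : w \in ends (pref t i) /\ z' = phi_at w (pref t i) b.
  by apply: cls_vdot_inv; rewrite -yz'.
have : adj z z'.
  apply: adj_ends zf zf' _; first exact: gen_ll.
  by apply: contra_neq xy; rewrite xz yz' => ->.
move/(boundary_adj (_ : boundary z)); rewrite zE zE' !boundary_phi_at.
by move=> /(_ isT).
Qed.

(** At level [i + n] both prefixes contain the vertex [vword v a i], and touching descends to level
    [i]. *)
Lemma sim_fiber n (v : V n) (a : nat -> idx S) (s t : Sigma S) :
  on_fiber v a s -> on_fiber v a t -> sim s t.
Proof.
move=> Hs Ht i; apply: (@touch_pref_le s t i (i + n)); first exact: leq_addr.
by exists (vword v a i); [exact: Hs|exact: Ht].
Qed.

End Words.

Section LimitPoints.
Context (R : realType) (S : ndd_igs).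
Local Notation V n := (vertex (rgraph S n)).
Local Notation E n := (edge (rgraph S n)).

Lemma chi_eqP (s t : Sigma S) : chi R s = chi R t <-> sim s t.
Proof.
split=> [/(congr1 sval)/= st|st].
  by have : [set t | sim s t] t by rewrite st /=; exact: sim_refl.
apply: eq_exist; apply/seteqP; split=> r /= H; apply: sim_trans H => //.
exact: sim_sym.
Qed.

Lemma chi_seq_of (x : limit_space S R) : chi R (seq_of x) = x.
Proof.
by case: x => A HA; apply: eq_exist; rewrite /seq_of; case: (cid _) => s /= ->.
Qed.

Lemma sim_seq_of (s : Sigma S) : sim (seq_of (chi R s)) s.
Proof. by apply/chi_eqP; exact: chi_seq_of. Qed.

Lemma chi_Tseq_fiber n (v : V n) (e : E n) a (s : Sigma S) : v \in ends e ->
  on_fiber v a s -> chi R (Tseq v e a) = chi R s.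
Proof. by move=> ve Hs; apply/chi_eqP; apply: sim_fiber Hs; have [] := TseqP a ve. Qed.

Lemma chi_Tseq_shift n (v : V n) (e : E n) (e' : E n.+1) (a : nat -> idx S) :
  v \in ends e -> vdot v (a 0%N) \in ends e' ->
  chi R (Tseq v e a) = chi R (Tseq (vdot v (a 0%N)) e' (fun i => a i.+1)).
Proof.
move=> ve ve'; symmetry; apply: chi_Tseq_fiber => //.
by apply: on_fiber_shift; have [] := TseqP a ve.
Qed.

End LimitPoints.

Local Close Scope quotient_scope.
Local Open Scope ring_scope.

(** * The metric of the limit space *)

Section Cells.
Context (S : ndd_igs).
Local Notation V n := (vertex (rgraph S n)).
Local Notation E n := (edge (rgraph S n)).

(** The image of [sigma] described through words, so that no level has to be transported as in
    [cell]; [cellP] identifies the two. *)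
Definition Cell n j (e : E j) : set (V n) :=
  [set v | exists s, pref s j = e /\ v \in ends (pref s n)].

Lemma mem_Cell n j (s : nat -> edge (gen S)) v : v \in ends (pref s n) -> Cell (pref s j) v.
Proof. by exists s. Qed.

Lemma ecat_pref n (e : E n) t m : ecat e (pref t m) = pref (scat e t) (m + n).
Proof. by elim: m => [|m IH]; rewrite ?pref_scat// pref_scat_S /= IH. Qed.

Lemma exists_pref n (e : E n) : exists s, pref s n = e.
Proof. by exists (scat e (fun=> edge0 S)); exact: pref_scat. Qed.

Lemma sigma_end n (e : E n) m (f : E m) :
  end1 (ecat e f) = sigma e (end1 f) /\ end2 (ecat e f) = sigma e (end2 f).
Proof.
elim: m f => [[]//|m IH] [f h] /=.
suff H z : cls (repr (cls z f)).1 (ecat e (repr (cls z f)).2) = cls z (ecat e f) :> V (m.+1 + n).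
  by rewrite !H.
pose F (x : vertex (gen S) * E m) := cls x.1 (ecat e x.2) : V (m.+1 + n).
rewrite -[LHS]/(F (repr (cls z f))) repr_cls_invariant// => v f1 f2 a vf1 vf2.
have K f0 : v \in ends f0 -> F (phi_at v f0 a, f0) = vdot (sigma e v) a.
  have [E1 E2] := IH f0; rewrite /F !inE /= => /orP[]/eqP ->.
    by rewrite -E1 vdot_end1 /phi_at eqxx.
  by rewrite -E2 vdot_end2 /phi_at eq_sym (negbTE (rgraph_loopless f0)).
by rewrite !K.
Qed.

Lemma sigma_image n (e : E n) m (v : V (m + n)) :
  v \in [set sigma e x | x : V m]%SET <-> Cell e v.
Proof.
split=> [/imsetP[x _ ->]|[s [se]]].
  have [f xf] := rgraph_exists_edge x.
  have [t tf] := exists_pref f; exists (scat e t); rewrite pref_scat; split=> //.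
  rewrite -ecat_pref tf; have [E1 E2] := sigma_end e f.
  by move: xf; rewrite !inE E1 E2 => /orP[]/eqP->; rewrite eqxx ?orbT.
rewrite -(scat_pref n s) se -ecat_pref.
have [E1 E2] := sigma_end e (pref (fun k => s (k + n)%N) m).
by rewrite !inE E1 E2 => /orP[]/eqP->; apply: imset_f.
Qed.

Lemma cellP n (j : 'I_n.+1) (e : E j) (v : V n) : v \in cell e <-> Cell e v.
Proof.
have gen m i k (H : (m + i)%N = k) (e' : E i) (w : V k) :
    w \in ecast k {set V k} H [set sigma e' x | x : V m]%SET <-> Cell e' w.
  by case: k / H w => w; exact: sigma_image.
exact: gen.
Qed.

(** Only the target is tested, in agreement with [connected_in], whose path condition leaves out the
    starting point. *)
Definition inside n (A : set (V n)) : rel (V n) := fun x y => `[< A y >] && adj x y.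

Lemma connected_inP n (A : {set V n}) :
  connected_in A <-> forall v w, v \in A -> w \in A -> connect (inside [set` A]) v w.
Proof.
have pathE v (s : seq (V n)) : path (inside [set` A]) v s = path (@adj _) v s && all (fun x => x \in A) s.
  elim: s v => [//|y s IH] v /=; rewrite IH /inside asboolb.
  by rewrite -!andbA andbCA; congr andb; rewrite andbCA.
split=> H v w vA wA.
  have [s [s1 s2 s3]] := H v w vA wA.
  by apply/connectP; exists s => //; rewrite pathE s1.
have /connectP[s] := H v w vA wA; rewrite pathE => /andP[s1 s2 ->].
by exists s.
Qed.

Lemma inside_sub n (A B : set (V n)) x y : A `<=` B ->
  connect (inside A) x y -> connect (inside B) x y.
Proof.
move=> AB; apply: connect_sub => a b /andP[/asboolP/AB Ab ab].
by apply: connect1; rewrite /inside ab andbT; apply/asboolP.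
Qed.

Lemma Cell_step n j (e : E j) (f : edge (gen S)) : Cell (n := n) ((e, f) : E j.+1) `<=` Cell e.
Proof. by move=> v [t [[<- _] vt]]; exists t. Qed.

Lemma fiber_Cell n (v : V n) (e : E n) a m : v \in ends e -> Cell e (vword v a m).
Proof. by move=> ve; have [s [se H]] := exists_on_fiber a ve; exists s; split=> //; exact: H. Qed.

Lemma CellE n (e : E n) v : Cell e v <-> v \in ends e.
Proof.
split=> [[s [<-//]]|ve]; have [s se] := exists_pref e.
by exists s; rewrite se.
Qed.

Lemma Cell_connected m n j (e : E j) v w : n = (m + j)%N ->
  Cell (n := n) e v -> Cell e w -> connect (inside (Cell (n := n) e)) v w.
Proof.
elim: m j e n v w => [|m IH] j e n v w nE.
  subst n; rewrite add0n in v w * => /CellE ve we; have [->//|vw] := eqVneq v w.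
  apply: connect1; rewrite /inside; apply/andP; split; first exact/asboolP.
  by apply: (adj_ends _ ve) vw; [exact: rgraph_loopless|exact/CellE].
rewrite addSnnS in nE; subst n => -[s [sj vs]] [t [tj wt]].
pose a0 := fun _ : nat => idx0 S.
pose P (z : vertex (gen S)) := vword (cls z e : V j.+1) a0 m.
have PC f z : z \in ends f -> Cell ((e, f) : E j.+1) (P z).
  by move=> zf; apply: fiber_Cell; rewrite mem_cls//; exact: rgraph_loopless.
have IH' (f : edge (gen S)) (x y : V (m + j.+1)) : Cell ((e, f) : E j.+1) x -> Cell ((e, f) : E j.+1) y ->
    connect (inside (Cell e)) x y.
  by move=> Hx Hy; apply: (inside_sub (@Cell_step _ _ e f)); exact: IH.
have PP z z' : connect (inside (Cell e)) (P z) (P z').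
  have [//|//|u [+ <- _]] := @gen_connected S z z'.
  elim: u z => [z _ /=|y u IHu z /= /andP[zy yu]]; first exact: connect0.
  apply: connect_trans (IHu _ yu).
  have /(adjP _ _ (@gen_ll S))[f zyf] := zy; apply: (IH' f); apply: PC.
    by case: zyf => -[-> _]; rewrite ?mem_end1 ?mem_end2.
  by case: zyf => -[_ ->]; rewrite ?mem_end1 ?mem_end2.
apply: (@connect_trans _ _ (P (end1 (s j)))).
  apply: (IH' (s j)); last by apply: PC; exact: mem_end1.
  by exists s; rewrite /= sj.
apply: (connect_trans (PP _ (end1 (t j)))).
apply: (IH' (t j)); first by apply: PC; exact: mem_end1.
by exists t; rewrite /= tj.
Qed.

Definition tag_edge n j (jn : (j <= n)%N) (e : E j) : {j : 'I_n.+1 & E j} :=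
  existT (fun j : 'I_n.+1 => E j) (Ordinal (jn : (j < n.+1)%N)) e.

Definition Cover n (W : {set {j : 'I_n.+1 & E j}}) : set (V n) :=
  [set v | exists2 e, e \in W & Cell (tagged e) v].

Lemma Cover_connected n (W : {set {j : 'I_n.+1 & E j}}) v w :
  dn_admissible v w W <->
  [/\ forall x y, Cover W x -> Cover W y -> connect (inside (Cover W)) x y,
      Cover W v & Cover W w].
Proof.
have UE x : x \in (\bigcup_(e in W) cell (tagged e))%SET <-> Cover W x.
  split=> [/bigcupP[e eW /cellP xe]|[e eW /cellP xe]]; first by exists e.
  by apply/bigcupP; exists e.
have UE' : [set` (\bigcup_(e in W) cell (tagged e))%SET] = Cover W.
  by apply/seteqP; split=> x /= /UE.
rewrite /dn_admissible; split=> -[].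
  move=> /connected_inP H /UE v1 /UE w1; split=> // x y /UE xW /UE yW.
  by rewrite -UE'; exact: H.
move=> H /UE v1 /UE w1; split=> //; apply/connected_inP => x y /UE xW /UE yW.
by rewrite UE'; exact: H.
Qed.

End Cells.

(** * Graph distance in the generator *)

Section DistanceToIminus.
Context (S : ndd_igs).
Local Notation V1 := (vertex (gen S)).
Implicit Types (v w z : V1).

Lemma bigminn_le (I : finType) (A : {set I}) (F : I -> nat) x i :
  i \in A -> (\big[minn/x]_(j in A) F j <= F i)%N.
Proof. move=> iA; have : i \in index_enum I by exact: mem_index_enum.
elim: (index_enum I) => [//|y s IH]; rewrite inE big_cons => /predU1P[<-|/IH is_].
  by rewrite iA geq_minl.
by case: ifP => // _; apply: leq_trans is_; exact: geq_minr. Qed.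

Lemma bigminn_ge (I : finType) (A : {set I}) (F : I -> nat) x c :
  (c <= x)%N -> (forall i, i \in A -> (c <= F i)%N) -> (c <= \big[minn/x]_(j in A) F j)%N.
Proof.
move=> cx cF; elim/big_ind: _ => // a b ca cb; by rewrite leq_min ca.
Qed.

Definition at_dist v w := fun k => [exists s : k.-tuple V1, path (@adj _) v s && (last v s == w)].

Lemma gdist_le v w k : (k < #|V1|)%N -> at_dist v w k -> (gdist v w <= k)%N.
Proof.
move=> kN H; rewrite leqNgt; apply/negP => kf.
by have := before_find 0%N kf; rewrite nth_iota// add0n; move: H; rewrite /at_dist => ->.
Qed.

Lemma gdist_at v w : (gdist v w < #|V1|)%N -> at_dist v w (gdist v w).
Proof.
move=> H; have hs : has (at_dist v w) (iota 0 #|V1|).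
  by rewrite has_find size_iota.
by have := nth_find 0%N hs; rewrite nth_iota.
Qed.

Lemma gdist_max v w : (gdist v w <= #|V1|)%N.
Proof. by rewrite -[leqRHS](size_iota 0) find_size. Qed.

Lemma gdist_refl v : gdist v v = 0%N.
Proof.
apply/eqP; rewrite -leqn0; apply: gdist_le; first exact: gen_nonempty.
by apply/existsP; exists [tuple]; rewrite /= eqxx.
Qed.

(** If the right-hand side reaches the cap [#|V1|], the bound holds because [gdist] never exceeds
    the cap; otherwise a path from [z'] is prolonged by the edge from [z]. *)
Lemma gdist_adj z z' w : adj z z' -> (gdist z w <= (gdist z' w).+1)%N.
Proof.
move=> zz'; have := gdist_max z w; have := gdist_max z' w.
rewrite leq_eqVlt => /predU1P[->|kN]; first exact: leqW.
move=> _; have [kN'|] := ltnP (gdist z' w).+1 #|V1|; last first.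
  by apply: leq_trans; exact: gdist_max.
apply: gdist_le => //; have /existsP[s /andP[s1 s2]] := gdist_at kN.
by apply/existsP; exists [tuple of z' :: s]; rewrite /= zz' s1.
Qed.

Definition dminus z : nat := \big[minn/#|V1|]_(w in Iminus S) gdist z w.

Lemma dminus_phim a : dminus (phim a) = 0%N.
Proof.
apply/eqP; rewrite -leqn0 -[X in (_ <= X)%N](gdist_refl (phim a)).
by apply: bigminn_le; rewrite imset_f.
Qed.

Lemma dminus_phip a : (Lstar S <= dminus (phip a))%N.
Proof. by apply: (@bigminn_le _ (Iplus S) dminus _ (phip a)); rewrite imset_f. Qed.

Lemma dminus_adj z z' : adj z z' -> (dminus z <= (dminus z').+1)%N.
Proof.
move=> zz'; suff : ((dminus z).-1 <= dminus z')%N by case: (dminus z).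
apply: bigminn_ge => [|w wI].
  apply: (leq_trans (leq_pred _)).
  have : (dminus z <= gdist z (phim (idx0 S)))%N by apply: bigminn_le; rewrite imset_f.
  by move/leq_trans; apply; exact: gdist_max.
have : (dminus z <= (gdist z' w).+1)%N.
  by apply: leq_trans (gdist_adj w zz'); exact: bigminn_le.
by case: (dminus z).
Qed.

Lemma Lstar_ge2 : (2 <= Lstar S)%N.
Proof.
have V2 : (2 <= #|V1|)%N.
  have := max_card [set phip (idx0 S); phim (idx0 S)]%SET.
  by rewrite cards2 phip_phim.
apply: bigminn_ge => // _ /imsetP[a _ ->]; apply: bigminn_ge => // _ /imsetP[b _ ->].
rewrite leqNgt; apply/negP => H.
have := gdist_at (leq_trans H V2); case: (gdist _ _) H => [|[|//]] _ /existsP[s /andP[]].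
  by rewrite (tuple0 s)/= (negbTE (phip_phim _ _)).
case: s => -[//|x [|//]] ? /=; rewrite andbT => xa /eqP xb.
by move: xa; rewrite xb adj_phip_phim.
Qed.

End DistanceToIminus.

Section Scales.
Context (R : realType) (S : ndd_igs).

Definition lam j : R := (Lstar S)%:R ^- j.

Lemma Lstar_gt0 : 0 < (Lstar S)%:R :> R.
Proof. by rewrite ltr0n; apply: leq_trans (Lstar_ge2 S). Qed.

Lemma lam_gt0 j : 0 < lam j.
Proof. by rewrite /lam invr_gt0 exprn_gt0// Lstar_gt0. Qed.

Lemma lamS j : lam j.+1 = (Lstar S)%:R^-1 * lam j.
Proof. by rewrite /lam exprS invfM. Qed.

Lemma lamD i j : lam (i + j) = lam i * lam j.
Proof. by rewrite /lam exprD invfM. Qed.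

Lemma lam_half j : lam j.+1 <= lam j / 2.
Proof.
rewrite lamS mulrC ler_wpM2l ?(ltW (lam_gt0 _))// lef_pV2 ?posrE ?Lstar_gt0//.
by rewrite ler_nat Lstar_ge2.
Qed.

Lemma lam_le i j : (i <= j)%N -> lam j <= lam i.
Proof.
move=> /subnK <-; elim: (j - i)%N => [//|k IH]; apply: le_trans IH.
by rewrite addSn; apply: le_trans (lam_half _) _; have := lam_gt0 (k + i); lra.
Qed.

Lemma lam0 : lam 0 = 1. Proof. by rewrite /lam expr0 invr1. Qed.

Lemma lam_le1 j : lam j <= 1.
Proof. by rewrite -lam0 lam_le. Qed.

Lemma lam_cvg0 (eps : R) : 0 < eps -> exists n, forall m, (n <= m)%N -> lam m < eps.
Proof.
move=> e0; have H : `|(Lstar S)%:R^-1| < 1 :> R.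
  rewrite ger0_norm ?invr_ge0 ?ler0n// invf_lt1 ?Lstar_gt0// ltr1n.
  exact: Lstar_ge2.
have /cvgrPdist_lt/(_ _ e0)[N _ HN] := cvg_expr H.
exists N => m Nm; have := HN _ Nm; rewrite /= sub0r normrN exprVn -/(lam m).
by rewrite ger0_norm // ltW// lam_gt0.
Qed.

(** A cut-off with slope at most [1 / Lstar] along edges. Points of [I_+] may be farther than
    [Lstar] from [I_-]; the truncation gives all of them the value 1. *)
Definition profile (z : vertex (gen S)) : R :=
  (minn (dminus z) (Lstar S))%:R / (Lstar S)%:R.

Lemma profile_phip a : profile (phip a) = 1.
Proof.
by rewrite /profile (minn_idPr (dminus_phip a)) divff// gt_eqF// Lstar_gt0.
Qed.

Lemma profile_phim a : profile (phim a) = 0.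
Proof. by rewrite /profile dminus_phim min0n mul0r. Qed.

Lemma profile_ge0_le1 z : 0 <= profile z <= 1.
Proof.
rewrite divr_ge0 ?ler0n//= ler_pdivrMr ?Lstar_gt0// mul1r ler_nat; exact: geq_minr.
Qed.

Lemma profile_adj z z' : adj z z' -> `|profile z - profile z'| <= (Lstar S)%:R^-1.
Proof.
move=> zz'; rewrite /profile -mulrBl normrM [X in _ * X]ger0_norm ?invr_ge0 ?ler0n//.
rewrite ler_piMl ?invr_ge0 ?ler0n//.
have h1 := dminus_adj zz'; have h2 : (dminus z' <= (dminus z).+1)%N.
  by apply: dminus_adj; rewrite adj_sym//; exact: gen_ll.
set a := minn _ _; set b := minn _ _.
have ab : a%:R <= b%:R + 1 :> R by rewrite natr1 ler_nat /a /b; lia.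
have ba : b%:R <= a%:R + 1 :> R by rewrite natr1 ler_nat /a /b; lia.
by rewrite ler_norml; apply/andP; split; lra.
Qed.

End Scales.

(** * Interpolated potentials and lower bounds for the cost of chains *)

Section Interpolation.
Context (R : realType) (S : ndd_igs).
Local Notation V n := (vertex (rgraph S n)).
Local Notation E n := (edge (rgraph S n)).
Local Notation lam := (lam R S).
Local Notation profile := (profile R (S := S)).

(** Extension to the next level, affine in [profile] inside each cell. The boundary values 1 and 0
    of [profile] make it independent of the representative and preserve values along fibers. *)
Definition interp n (s : V n -> R) (x : V n.+1) : R :=
  s (end2 (repr x).2) + profile (repr x).1 * (s (end1 (repr x).2) - s (end2 (repr x).2)).

Lemma interpE n (s : V n -> R) z (e : E n) :
  interp s (cls z e) = s (end2 e) + profile z * (s (end1 e) - s (end2 e)).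
Proof.
pose F (x : vertex (gen S) * E n) := s (end2 x.2) + profile x.1 * (s (end1 x.2) - s (end2 x.2)).
rewrite -[LHS]/(F (repr (cls z e))) repr_cls_invariant// => v e1 e2 a ve1 ve2.
have K f0 : v \in ends f0 -> F (phi_at v f0 a, f0) = s v.
  rewrite /F !inE /= /phi_at => /orP[]/eqP ->; first by rewrite eqxx profile_phip; ring.
  by rewrite eq_sym (negbTE (rgraph_loopless f0)) profile_phim; ring.
by rewrite !K.
Qed.

Fixpoint interpn m n (s : V n -> R) : V (m + n) -> R :=
  if m is m'.+1 return V (m + n) -> R then interp (@interpn m' n s) else s.
Arguments interpn m {n} s _.

Lemma interp_between n (s : V n -> R) lo hi z (e : E n) :
  (forall v, v \in ends e -> lo <= s v <= hi) -> lo <= interp s (cls z e) <= hi.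
Proof.
move=> H; rewrite interpE; have /andP[p0 p1] := profile_ge0_le1 R z.
have /andP[a0 a1] := H _ (mem_end1 e); have /andP[b0 b1] := H _ (mem_end2 e).
have -> : s (end2 e) + profile z * (s (end1 e) - s (end2 e)) =
  (1 - profile z) * s (end2 e) + profile z * s (end1 e) by ring.
by apply/andP; split; nra.
Qed.

Lemma interpn_between n (s : V n -> R) lo hi j (e : E j) m x : (j <= n)%N ->
  (forall v, Cell e v -> lo <= s v <= hi) -> Cell e x -> lo <= interpn m s x <= hi.
Proof.
move=> jn H; elim: m x => [|m IH] x; first exact: H.
move=> [t [te /ends_cls[z _ ->]]] /=; apply: interp_between => v vt.
by apply: IH; exists t.
Qed.

Lemma interp_grad n (s : V n -> R) (e : E n) f x y :
  x \in ends ((e, f) : E n.+1) -> y \in ends ((e, f) : E n.+1) ->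
  `|interp s x - interp s y| <= (Lstar S)%:R^-1 * `|s (end1 e) - s (end2 e)|.
Proof.
move=> /ends_cls[z zf ->] /ends_cls[z' zf' ->]; rewrite !interpE.
rewrite (_ : _ - _ = (profile z - profile z') * (s (end1 e) - s (end2 e))); last by ring.
rewrite normrM ler_wpM2r//; have [->|zz'] := eqVneq z z'.
  by rewrite subrr normr0 invr_ge0 ler0n.
by apply: profile_adj; apply: adj_ends zf zf' zz'; exact: gen_ll.
Qed.

Definition osc_le n (s : V n -> R) (B : nat -> R) :=
  forall j (e : E j) x y, (j <= n)%N -> Cell e x -> Cell e y -> `|s x - s y| <= B j.

(** The new cells gain the factor [1 / Lstar] from the slope of [profile]; on older cells
    interpolation forms convex combinations and cannot enlarge the oscillation. *)
Lemma interp_osc n (s : V n -> R) B : osc_le s B ->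
  (Lstar S)%:R^-1 * B n <= B n.+1 -> osc_le (interp s) B.
Proof.
move=> H BS j e x y; rewrite leq_eqVlt => /predU1P[jE|jn].
  subst j; case: e => e f /CellE xe /CellE ye.
  apply: le_trans (interp_grad s xe ye) _; apply: le_trans BS.
  rewrite ler_wpM2l ?invr_ge0 ?ler0n//; apply: H => //; apply/CellE.
    exact: mem_end1.
  exact: mem_end2.
move=> [t [te /ends_cls[z _ ->]]] [u [ue /ends_cls[z' _ ->]]].
have tC v : v \in ends (pref t n) -> Cell e v by move=> vt; exists t.
have uC v : v \in ends (pref u n) -> Cell e v by move=> vt; exists u.
(* Convexity is used in both points: the value at [y] lies between the extremes [lo] and [hi] of its
   edge, the value at [x] within [B j] of both extremes. *)
pose lo := Num.min (s (end1 (pref u n))) (s (end2 (pref u n))).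
pose hi := Num.max (s (end1 (pref u n))) (s (end2 (pref u n))).
have /andP[ulo uhi] : lo <= interp s (cls z' (pref u n)) <= hi.
  apply: interp_between => v; rewrite !inE => /orP[]/eqP ->; rewrite /lo /hi.
    by rewrite ge_min lexx le_max lexx.
  by rewrite ge_min lexx orbT le_max lexx orbT.
have /andP[tlo thi] : hi - B j <= interp s (cls z (pref t n)) <= lo + B j.
  apply: interp_between => v /tC vC; rewrite lerBlDr.
  have H1 := H j e v _ jn vC (uC _ (mem_end1 _)); have H2 := H j e v _ jn vC (uC _ (mem_end2 _)).
  move: H1 H2; rewrite !ler_norml => /andP[a1 a2] /andP[b1 b2].
  apply/andP; split; first by rewrite /hi ge_max; apply/andP; split; lra.
  by rewrite -lerBlDr /lo le_min; apply/andP; split; lra.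
by rewrite ler_norml; apply/andP; split; lra.
Qed.

Lemma interpn_osc n (s : V n -> R) B m : osc_le s B ->
  (forall k, (n <= k)%N -> (Lstar S)%:R^-1 * B k <= B k.+1) -> osc_le (interpn m s) B.
Proof.
move=> H HB; elim: m => [//|m IH]; apply: interp_osc => //; apply: HB; exact: leq_addl.
Qed.

(* Consecutive cells of an admissible family may be separated by an uncovered edge
   of G_n, so each cell also has to pay for half of that gap. *)
Definition chain_potential n (s : V n -> R) :=
  forall j (e : E j) x y, (j <= n)%N -> Cell e x -> Cell e y ->
    `|s x - s y| + lam n / 2 <= lam j.

Local Notation cost W := (\sum_(c in W) lam (tag c)).

(** The walk is cut at its last visit to [C]. *)
Lemma chain_split n (C : set (V n)) (s : seq (V n)) x : path (@adj _) x s ->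
  (forall y, y \in x :: s -> ~ C y) \/
  exists x', C x' /\ (x' = last x s \/ exists y s', [/\ adj x' y, path (@adj _) y s',
     last y s' = last x s, {subset y :: s' <= s} & forall u, u \in y :: s' -> ~ C u]).
Proof.
elim: s x => [|y s IH] x /=.
  move=> _; have [Cx|nCx] := pselect (C x); last by left=> y; rewrite inE => /eqP->.
  by right; exists x; split=> //; left.
move=> /andP[xy ys]; have [H|[x' [Cx' H]]] := IH _ ys.
  have [Cx|nCx] := pselect (C x); last first.
    by left=> u; rewrite inE => /predU1P[->//|]; exact: H.
  by right; exists x; split=> //; right; exists y, s; split.
right; exists x'; split=> //; case: H => [->|[u [s' [h1 h2 h3 h4 h5]]]]; first by left.
by right; exists u, s'; split=> // v /h4; rewrite inE orbC => ->.
Qed.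

(** Induction on the number of cells: after its last visit to the cell of [v], the walk is covered
    by [W] without that cell. The halves reserved in [chain_potential] pay for the edges between
    consecutive cells, and one of them is left over. *)
Lemma chain_path n (t : V n -> R) (W : {set {j : 'I_n.+1 & E j}}) v s :
  chain_potential t -> path (@adj _) v s -> (forall x, x \in v :: s -> Cover W x) ->
  `|t v - t (last v s)| <= cost W - lam n / 2.
Proof.
move=> Ht; elim: {W}#|W| {-2}W (leqnn #|W|) v s => [|k IH] W.
  rewrite leqn0 cards_eq0 => /eqP-> v s _ /(_ v).
  by rewrite inE eqxx => /(_ isT)[c]; rewrite inE.
move=> Wk v s vs HW; have [c cW vc] := HW v (mem_head _ _).
have jn : (tag c <= n)%N by rewrite -ltnS.
have [H|[x' [Cx' H]]] := chain_split (Cell (tagged c)) vs.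
  by exfalso; apply: (H v) => //; rewrite inE eqxx.
have cost_c : cost W = lam (tag c) + cost (W :\ c)%SET by rewrite (big_setD1 c).
have H1 := Ht _ _ _ _ jn vc Cx'.
have cD : 0 <= cost (W :\ c)%SET by apply: sumr_ge0 => i _; exact/ltW/lam_gt0.
case: H => [<-|[y [s' [x'y ys' <- sub out]]]]; first by rewrite cost_c; lra.
have H2 : `|t y - t (last y s')| <= cost (W :\ c)%SET - lam n / 2.
  apply: IH => //; first by rewrite (cardsD1 c) cW in Wk.
  move=> u us; have [d dW ud] : Cover W u by apply: HW; rewrite inE sub ?orbT.
  exists d => //; rewrite in_setD1 dW andbT; apply/eqP => dc; subst d.
  exact: (out _ us).
have H3 : `|t x' - t y| <= lam n / 2.
  have /(adjP _ _ (@rgraph_loopless S n))[e xye] := x'y.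
  have [Kx Ky] : Cell e x' /\ Cell e y.
    by case: xye => -[-> ->]; split; apply/CellE; rewrite ?mem_end1 ?mem_end2.
  have := Ht _ _ _ _ (leqnn n) Kx Ky; lra.
have -> : t v - t (last y s') = (t v - t x') + (t x' - t y) + (t y - t (last y s')) by ring.
apply: le_trans (ler_normD _ _) _; apply: le_trans (lerD (ler_normD _ _) (lexx _)) _.
by rewrite cost_c; lra.
Qed.

Lemma chain_cost n (t : V n -> R) v w (W : {set {j : 'I_n.+1 & E j}}) : chain_potential t ->
  dn_admissible v w W -> `|t v - t w| <= cost W.
Proof.
move=> Ht [HU vU wU]; have [s [s1 s2 s3]] := HU v w vU wU.
have UE x : x \in (\bigcup_(e in W) cell (tagged e))%SET -> Cover W x.
  by move=> /bigcupP[e eW /cellP xe]; exists e.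
have := @chain_path n t W v s Ht s1; rewrite s2 => H.
apply: le_trans (H _) _; last by have := lam_gt0 R S n; lra.
move=> x; rewrite inE => /predU1P[->|xs]; first exact: UE.
by apply: UE; exact: (allP s3).
Qed.

Lemma admissible_root n (v w : V n) :
  dn_admissible v w [set tag_edge (leq0n n) (tt : E 0)]%SET.
Proof.
have CT x : Cell (tt : E 0) x.
  have [e xe] := rgraph_exists_edge x; have [s se] := exists_pref e.
  by exists s; rewrite se; split=> //; case: (pref s 0).
have CW x : Cover [set tag_edge (leq0n n) (tt : E 0)]%SET x.
  by exists (tag_edge (leq0n n) (tt : E 0)); rewrite ?inE//; exact: CT.
apply/Cover_connected; split=> // x y _ _.
apply: (@inside_sub _ _ (Cell (tt : E 0))) => [u _|]; first exact: CW.
by apply: (@Cell_connected _ n); rewrite ?addn0.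
Qed.

Definition costs n (v w : V n) := [set cost W | W in @dn_admissible S n v w].
(** The infimum in [dn] without the exceptional value 0 on the diagonal, so that a cover can be
    extended without distinguishing cases. *)
Definition Dn n (v w : V n) : R := inf (costs v w).

Lemma costs_lb n (v w : V n) : lbound (costs v w) 0.
Proof. by move=> _ [W _ <-]; apply: sumr_ge0 => i _; exact/ltW/lam_gt0. Qed.

Lemma costs_nonempty n (v w : V n) : costs v w !=set0.
Proof. by exists (cost [set tag_edge (leq0n n) (tt : E 0)]%SET); exists [set tag_edge (leq0n n) (tt : E 0)]%SET => //; exact: admissible_root. Qed.

Lemma Dn_le n (v w : V n) W : dn_admissible v w W -> Dn v w <= cost W.
Proof. by move=> vwW; apply: ge_inf; [exists 0; exact: costs_lb|exists W]. Qed.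

Lemma Dn_ge n (v w : V n) c : (forall W, dn_admissible v w W -> c <= cost W) -> c <= Dn v w.
Proof.
move=> H; apply: lb_le_inf; first exact: costs_nonempty.
by move=> _ [W vwW <-]; exact: H.
Qed.

Lemma dn_Dn n (v w : V n) : 0 <= dn R v w <= Dn v w.
Proof.
have D0 : 0 <= Dn v w by apply: lb_le_inf; [exact: costs_nonempty|exact: costs_lb].
by rewrite /dn; case: ifP => _; rewrite ?lexx//= -/(Dn v w) ?lexx ?andbT.
Qed.

Lemma dn_chain n (t : V n -> R) v w : chain_potential t -> `|t v - t w| <= dn R v w.
Proof.
move=> Ht; rewrite /dn; case: eqVneq => [->|_]; first by rewrite subrr normr0.
by apply: Dn_ge => W; exact: chain_cost.
Qed.

End Interpolation.
Arguments interpn {R S} m {n} s _.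

Lemma arg_min_near (R : realType) (T : finType) (P : rel T) (F : T -> R) : reflexive P ->
  exists m : T -> T, forall x, P x (m x) /\ forall y, P x y -> F (m x) <= F y.
Proof.
move=> Pr; exists (fun x => [arg min_(y < x | P x y) F y]%O) => x.
by case: arg_minP => [|y xy H]; first exact: Pr.
Qed.

(** The limit is the supremum of [a k - C * lam k]: letting [i] grow in the hypothesis keeps the
    late terms near or above each such value, while [C * lam k] tends to 0. *)
Lemma cvgn_almost_nondecreasing (R : realType) (a lam : nat -> R) (C : R) :
  (forall k, 0 <= a k <= 1) -> 0 <= C -> (forall k, 0 <= lam k <= 1) ->
  (forall eps, 0 < eps -> exists N, forall k, (N <= k)%N -> lam k < eps) ->
  (forall i k, (1 - lam i) * (a k - C * lam k) <= a (i + k)%N) -> cvgn a.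
Proof.
move=> a01 C0 l01 l0 H.
pose b k := a k - C * lam k; pose A := range b.
have bub : ubound A 1.
  move=> _ [k _ <-]; have /andP[_ a1] := a01 k; have /andP[lk _] := l01 k.
  by rewrite /b lerBlDr (le_trans a1)// lerDl mulr_ge0.
have supA : has_sup A by split; [exists (b 0%N); exists 0%N|exists 1].
set l := sup A; have l1 : l <= 1 by apply: ge_sup => //; exact: supA.1.
apply/cvg_ex; exists l; apply/cvgrPdist_le => eps e0.
have e4 : 0 < eps / 4 by lra.
have [_ [k _ <-] bk] := sup_adherent e4 supA.
have CC : 0 < eps / 4 / (C + 1) by apply: divr_gt0; lra.
have [N1 HN1] := l0 _ e4; have [N2 HN2] := l0 _ CC.
exists (maxn (N1 + k) N2) => // n; rewrite /= geq_max => /andP[n1 n2].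
have nE : n = (n - k + k)%N by rewrite subnK// (leq_trans _ n1)// leq_addl.
rewrite ler_distlC; apply/andP; split.
  have i1 : (N1 <= n - k)%N by rewrite -(leq_add2r k) -nE.
  have := H (n - k)%N k; rewrite -nE -/(b k); have := HN1 _ i1.
  have /andP[] := l01 (n - k)%N; move: (lam _) => x x0 x1 xe.
  rewrite -/l in bk; have [bk0|bk0] := leP 0 (b k); last by have /andP[] := a01 n; lra.
  have b1 : b k <= 1 by apply: bub; exists k.
  have : (1 - x) * b k = b k - x * b k by ring.
  have : x * b k <= x by rewrite ler_piMr.
  lra.
have bn : b n <= l by apply: sup_upper_bound => //; exists n.
have : C * lam n <= eps / 4.
  have := HN2 _ n2; rewrite ltr_pdivlMr; last by lra.
  have /andP[ln _] := l01 n; nra.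
by move: bn; rewrite /b; lra.
Qed.

(** A divergent sequence has the default limit 0, whence [0 <= c]. Upper bounds on [dX] thus do not
    depend on convergence; lower bounds do. *)
Lemma limn_le_junk (R : realType) (a : nat -> R) (c : R) N : 0 <= c ->
  (forall k, (N <= k)%N -> a k <= c) -> limn a <= c.
Proof.
move=> c0 H; have [ca|/dvgP ->//] := pselect (cvgn a).
by apply: limr_le => //; exists N.
Qed.

(** * Convergence of the distances and comparison with words *)

Section Distance.
Context (R : realType) (S : ndd_igs).
Local Notation V n := (vertex (rgraph S n)).
Local Notation E n := (edge (rgraph S n)).
Local Notation lam := (lam R S).
Local Notation cost W := (\sum_(c in W) lam (tag c)).
Local Notation Dn := (Dn R (S := S)).

Lemma min_dn_le n (e f : E n) v w : v \in ends e -> w \in ends f -> min_dn R e f <= dn R v w.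
Proof.
rewrite !inE /min_dn => /orP[]/eqP-> /orP[]/eqP->;
  by rewrite !ge_min lexx ?orbT.
Qed.

Lemma min_dn_ge n (e f : E n) c :
  (forall v w, v \in ends e -> w \in ends f -> c <= dn R v w) -> c <= min_dn R e f.
Proof. by move=> H; rewrite /min_dn !le_min !H// ?mem_end1 ?mem_end2. Qed.

Lemma min_dn_ge0_le1 n (e f : E n) : 0 <= min_dn R e f <= 1.
Proof.
apply/andP; split.
  by apply: min_dn_ge => v w _ _; have /andP[] := dn_Dn R v w.
apply: le_trans (min_dn_le (mem_end1 e) (mem_end1 f)) _.
have /andP[_ h] := dn_Dn R (end1 e) (end1 f); apply: le_trans h _.
apply: le_trans (Dn_le _ (admissible_root _ _)) _.
by rewrite big_set1 /= lam0.
Qed.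

Lemma cost_setU1 n (c : {j : 'I_n.+1 & E j}) (W : {set {j : 'I_n.+1 & E j}}) :
  cost (c |: W)%SET <= lam (tag c) + cost W.
Proof.
have [cW|cW] := boolP (c \in W); last by rewrite big_setU1.
rewrite (_ : (c |: W)%SET = W); last by apply/finset.setUidPr; rewrite finset.sub1set.
by rewrite lerDr ltW// lam_gt0.
Qed.

Lemma Dn_extend n (v x y z : V n) j (e : E j) : (j <= n)%N -> Cell e y -> Cell e z ->
  x = y \/ adj x y -> Dn v z <= Dn v x + lam j.
Proof.
move=> jn ye ze xy; rewrite -lerBlDr; apply: Dn_ge => W vxW.
rewrite lerBlDr addrC; apply: le_trans (cost_setU1 (tag_edge jn e) W).
apply: Dn_le; have [HW vW xW] := proj1 (Cover_connected _ _ _) vxW.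
set W' := (_ |: W)%SET.
have subW : Cover W `<=` Cover W'.
  by move=> u [c cW uc]; exists c => //; rewrite in_setU1 cW orbT.
have subC : Cell e `<=` Cover W'.
  by move=> u ue; exists (tag_edge jn e); rewrite ?in_setU1 ?eqxx.
have xy' : connect (inside (Cover W')) x y.
  case: xy => [->//|xy]; apply: connect1; rewrite /inside xy andbT.
  exact/asboolP/subC.
have yx' : connect (inside (Cover W')) y x.
  case: xy => [->//|xy]; apply: connect1; rewrite /inside adj_sym ?xy ?andbT.
    exact/asboolP/subW.
  exact: rgraph_loopless.
have nE : n = (n - j + j)%N by rewrite subnK.
have cC u w : Cell e u -> Cell e w -> connect (inside (Cover W')) u w.
  by move=> ue we; apply: (inside_sub subC); exact: (Cell_connected nE).
have cW u w : Cover W u -> Cover W w -> connect (inside (Cover W')) u w.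
  by move=> uW wW; apply: (inside_sub subW); exact: HW.
have W'P u : Cover W' u -> Cover W u \/ Cell e u.
  move=> [c]; rewrite in_setU1 => /predU1P[->|cW' uc]; first by right.
  by left; exists c.
have toy u : Cover W' u -> connect (inside (Cover W')) u y.
  by move=> /W'P[uW|ue]; [exact: connect_trans (cW _ _ uW xW) xy'|exact: cC].
have ofy u : Cover W' u -> connect (inside (Cover W')) y u.
  by move=> /W'P[uW|ue]; [exact: connect_trans yx' (cW _ _ xW uW)|exact: cC].
apply/Cover_connected; split; [|exact: subW|exact: subC].
by move=> u w uW wW; exact: connect_trans (toy _ uW) (ofy _ wW).
Qed.

(** One cell for each representative and one for the word between them: a point of the limit space
    determines its words only up to touching. *)
Lemma min_dn_touch i n (e1 e2 e3 : E n) (s t : nat -> edge (gen S)) :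
  touch e1 e2 -> touch e2 e3 -> pref s n = e1 -> pref t n = e3 ->
  min_dn R (pref s (i + n)) (pref t (i + n)) <= 3 * lam n.
Proof.
move=> [v v1 v2] [w w2 w3] s1 t3.
apply: le_trans (min_dn_le (mem_end1 _) (mem_end1 _)) _.
have /andP[_ h] := dn_Dn R (end1 (pref s (i + n))) (end1 (pref t (i + n))).
apply: le_trans h _.
have nn : (n <= i + n)%N by exact: leq_addl.
pose a0 := fun _ : nat => idx0 S.
have C1 : Cell e1 (end1 (pref s (i + n))) by exists s; rewrite mem_end1.
have C3 : Cell e3 (end1 (pref t (i + n))) by exists t; rewrite mem_end1.
set x := end1 _ in C1 *; set y := end1 _ in C3 *.
have D1 : Dn x (vword v a0 i) <= lam n.
  apply: le_trans (Dn_le (W := [set tag_edge nn e1]%SET) _ _) _; last by rewrite big_set1.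
  apply/Cover_connected; have CE : Cover [set tag_edge nn e1]%SET = Cell e1.
    apply/seteqP; split=> u; first by move=> [c]; rewrite inE => /eqP->.
    by move=> ue; exists (tag_edge nn e1); rewrite ?inE.
  rewrite CE; split=> //; last exact: fiber_Cell.
  by move=> a b; exact: (@Cell_connected _ i).
have D2 : Dn x (vword w a0 i) <= Dn x (vword v a0 i) + lam n.
  by apply: (@Dn_extend _ _ _ (vword v a0 i) _ _ e2) => //; [exact: fiber_Cell|exact: fiber_Cell|left].
have D3 : Dn x y <= Dn x (vword w a0 i) + lam n.
  by apply: (@Dn_extend _ _ _ (vword w a0 i) _ _ e3) => //; [exact: fiber_Cell|left].
lra.
Qed.

Lemma interp_vdot n (s : V n -> R) v a : interp s (vdot v a) = s v.
Proof.
have := incident_edgeP v; rewrite (vdotE _ (incident_edgeP v)); move: (incident_edge v) => e.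
rewrite interpE !inE /phi_at => /orP[]/eqP->; first by rewrite eqxx profile_phip; ring.
by rewrite eq_sym (negbTE (rgraph_loopless e)) profile_phim; ring.
Qed.

Lemma interpn_vword n (s : V n -> R) v a m : interpn m s (vword v a m) = s v.
Proof. by elim: m => [//|m IH] /=; rewrite interp_vdot. Qed.

(** A lower bound at level [i + k] needs a chain potential there: [Dn v] at level [k] is smoothed,
    interpolated [i] times and multiplied by [1 - lam i]. The constant 5 / 2 collects [lam k / 2]
    for each of [v'] and [w'], [lam k] for [sg v] and [lam k / 2] for [sg w]. *)
Lemma min_dn_almost_nondecreasing (s t : nat -> edge (gen S)) i k :
  (1 - lam i) * (min_dn R (pref s k) (pref t k) - 5 / 2 * lam k) <=
  min_dn R (pref s (i + k)) (pref t (i + k)).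
Proof.
set v := end1 (pref s k); set w := end1 (pref t k).
pose nb := [rel x y : V k | (y == x) || adj x y].
have [mn Hmn] := @arg_min_near R _ nb (Dn v) (fun x => introT orP (or_introl (eqxx x))).
pose m x := Dn v (mn x).
have m_le x y : adj x y -> m x <= Dn v y.
  by move=> xy; apply: (Hmn x).2; rewrite /nb/= xy orbT.
have m_self x : m x <= Dn v x by apply: (Hmn x).2; rewrite /nb/= eqxx.
have D_le j (e : E j) y z : (j <= k)%N -> Cell e y -> Cell e z -> Dn v z <= m y + lam j.
  move=> jk ye ze; apply: (Dn_extend v jk ye ze).
  have := (Hmn y).1; rewrite /nb/= => /predU1P[->|yx]; first by left.
  by right; rewrite adj_sym//; exact: rgraph_loopless.
(* Averaging with the minimum over neighbours halves the bound for the oscillation on cells of level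
   [k]; this leaves room for the gap term at level [k] and at all finer levels. *)
pose sg x := (Dn v x + m x) / 2.
pose B j := if (j < k)%N then lam j else lam j / 2.
have sg_osc : osc_le sg B.
  move=> j e x y jk xe ye; rewrite /B; case: ifPn => [_|].
    have h1 := D_le _ _ _ _ jk xe ye; have h2 := D_le _ _ _ _ jk ye xe.
    have := m_self x; have := m_self y; rewrite /sg ler_norml; lra.
  rewrite -leqNgt => kj; have kE : j = k by apply/eqP; rewrite eqn_leq jk.
  subst j; have h1 := D_le _ _ _ _ jk xe ye; have h2 := D_le _ _ _ _ jk ye xe.
  have [->|xy] := eqVneq x y; first by rewrite subrr normr0 divr_ge0// ltW// lam_gt0.
  have xy' : adj x y.
    by move: xe ye => /CellE xe /CellE ye; apply: adj_ends xe ye xy; exact: rgraph_loopless.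
  have yx' : adj y x by rewrite adj_sym//; exact: rgraph_loopless.
  have := m_le _ _ xy'; have := m_le _ _ yx'; rewrite /sg ler_norml; lra.
have BS l : (k <= l)%N -> (Lstar S)%:R^-1 * B l <= B l.+1.
  by move=> kl; rewrite /B !ltnNge kl (leqW kl)/= lamS mulrA.
pose tau := interpn i sg; have tau_osc : osc_le tau B := interpn_osc sg_osc BS.
(* On coarse cells the factor [c] makes room for the gap [lam (i + k) / 2], since
   [lam (i + k) = lam i * lam k]. *)
pose c := 1 - lam i; have c0 : 0 <= c by rewrite subr_ge0 lam_le1.
have ch : chain_potential (fun x => c * tau x).
  move=> j e x y jn xe ye; rewrite -mulrBr normrM (ger0_norm c0).
  have h := tau_osc _ _ _ _ jn xe ye.
  apply: (@le_trans _ _ (c * B j + lam (i + k) / 2)).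
    by rewrite lerD2r ler_wpM2l.
  rewrite /B /c; case: ifP => jk.
    have : lam i * lam k <= lam i * lam j.
      by rewrite ler_wpM2l ?(ltW (lam_gt0 _ _ _))// lam_le// ltnW.
    have := lam_gt0 R S i; have := lam_gt0 R S k; rewrite lamD; nra.
  have := lam_le R S jn; have := lam_gt0 R S i; have := lam_gt0 R S j; nra.
apply: min_dn_ge => v' w' vs' wt'.
have h := dn_chain v' w' ch; rewrite -mulrBr normrM (ger0_norm c0) in h.
apply: le_trans h; rewrite ler_wpM2l//.
pose a0 := fun _ : nat => idx0 S.
have kk : (k <= i + k)%N by exact: leq_addl.
have Bk : B k = lam k / 2 by rewrite /B ltnn.
have hv : `|tau v' - sg v| <= lam k / 2.
  rewrite -Bk -(interpn_vword sg v a0 i); apply: (tau_osc k (pref s k)) => //.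
    exact: mem_Cell.
  by apply: fiber_Cell; exact: mem_end1.
have hw : `|tau w' - sg w| <= lam k / 2.
  rewrite -Bk -(interpn_vword sg w a0 i); apply: (tau_osc k (pref t k)) => //.
    exact: mem_Cell.
  by apply: fiber_Cell; exact: mem_end1.
have sv : sg v <= lam k.
  suff : Dn v v <= lam k by have := m_self v; rewrite /sg; lra.
  apply: le_trans (Dn_le (W := [set tag_edge (leqnn k) (pref s k)]%SET) _ _) _; last by rewrite big_set1.
  have CE : Cover [set tag_edge (leqnn k) (pref s k)]%SET = Cell (pref s k).
    apply/seteqP; split=> u; first by move=> [? ]; rewrite inE => /eqP->.
    by move=> ue; exists (tag_edge (leqnn k) (pref s k)); rewrite ?inE.
  have vC : Cell (pref s k) v by apply/CellE; exact: mem_end1.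
  by apply/Cover_connected; rewrite CE; split=> // x y; exact: (@Cell_connected _ 0).
have sw : min_dn R (pref s k) (pref t k) - lam k / 2 <= sg w.
  have wC : Cell (pref t k) w by apply/CellE; exact: mem_end1.
  have := D_le _ _ _ _ (leqnn k) wC wC.
  have := min_dn_le (mem_end1 (pref s k)) (mem_end1 (pref t k)).
  by have /andP[_] := dn_Dn R v w; rewrite /sg; lra.
by move: hv hw; rewrite !ler_norml => /andP[? ?] /andP[? ?]; rewrite ler_normr; apply/orP; right; lra.
Qed.

Lemma min_dn_cvg (s t : nat -> edge (gen S)) :
  cvgn (fun n => min_dn R (pref s n) (pref t n)).
Proof.
apply: (@cvgn_almost_nondecreasing _ _ lam (5 / 2)) => //.
- by move=> k; exact: min_dn_ge0_le1.
- by move=> k; rewrite lam_le1 ltW// lam_gt0.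
- by move=> eps /(lam_cvg0 S).
- by move=> i k; exact: min_dn_almost_nondecreasing.
Qed.

(** The potential is 0 on the ends of [pref s m] and [lam m / 2] elsewhere, interpolated from level
    [m]. Passing from [s] and [t] to the touching words [s'] and [t'] loses [lam (i + m) / 2]
    twice. *)
Lemma min_dn_separated m i (s t s' t' : nat -> edge (gen S)) :
  ~ touch (pref s m) (pref t m) -> touch (pref s' (i + m)) (pref s (i + m)) ->
  touch (pref t' (i + m)) (pref t (i + m)) ->
  lam m / 2 - lam (i + m) <= min_dn R (pref s' (i + m)) (pref t' (i + m)).
Proof.
move=> nst [x xs' xs] [y yt' yt].
pose sg (u : V m) := if u \in ends (pref s m) then 0 else lam m / 2 : R.
pose B j := if (j < m)%N then lam m / 2 else lam j / 2.
have l0 := lam_gt0 R S.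
have sg_osc : osc_le sg B.
  move=> j e u w jm _ _; apply: (@le_trans _ _ (lam m / 2)).
    by have := l0 m; rewrite /sg; case: ifP => _; case: ifP => _; rewrite ler_norml; lra.
  by rewrite /B; case: ifP => // _; rewrite ler_pM2r ?invr_gt0// lam_le.
have BS l : (m <= l)%N -> (Lstar S)%:R^-1 * B l <= B l.+1.
  by move=> kl; rewrite /B !ltnNge kl (leqW kl)/= lamS mulrA.
pose tau := interpn i sg; have tau_osc : osc_le tau B := interpn_osc sg_osc BS.
have mn : (m <= i + m)%N by exact: leq_addl.
have ch : chain_potential tau.
  move=> j e u w jn ue we; have h := tau_osc _ _ _ _ jn ue we.
  have := lam_le R S jn; have := lam_le R S mn; have := l0 j.
  move: h; rewrite /B; case: ifP => jm; last by lra.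
  by have := lam_le R S (ltnW jm); lra.
have tx : tau x = 0.
  have : 0 <= tau x <= 0.
    apply: (@interpn_between _ _ _ _ _ _ _ (pref s m)) => // [v /CellE vs|].
      by rewrite /sg vs lexx.
    exact: mem_Cell.
  by move=> /andP[? ?]; apply/eqP; rewrite eq_le; apply/andP.
have ty : tau y = lam m / 2.
  have : lam m / 2 <= tau y <= lam m / 2.
    apply: (@interpn_between _ _ _ _ _ _ _ (pref t m)) => // [v /CellE vt|]; last exact: mem_Cell.
    by rewrite /sg; case: ifP => [vs|_]; [case: nst; exists v|rewrite lexx].
  by move=> /andP[? ?]; apply/eqP; rewrite eq_le; apply/andP.
have Bn : B (i + m) = lam (i + m) / 2 by rewrite /B ltnNge mn.
apply: min_dn_ge => v w vs' wt'; apply: le_trans (dn_chain v w ch).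
have hv : `|tau v - tau x| <= lam (i + m) / 2.
  by rewrite -Bn; apply: (tau_osc _ (pref s' (i + m))) => //; exact/CellE.
have hw : `|tau w - tau y| <= lam (i + m) / 2.
  by rewrite -Bn; apply: (tau_osc _ (pref t' (i + m))) => //; exact/CellE.
move: hv hw; rewrite tx ty !ler_norml => /andP[? ?] /andP[? ?].
by rewrite ler_normr; apply/orP; right; lra.
Qed.

Lemma dX_le n (s t : Sigma S) : pref s n = pref t n -> dX (chi R s) (chi R t) <= 3 * lam n.
Proof.
move=> st; apply: (@limn_le_junk _ _ _ n).
  by rewrite mulr_ge0// ltW// lam_gt0.
move=> k /subnK <-; apply: (@min_dn_touch _ _ _ (pref s n)) => //.
  exact: sim_seq_of.
by rewrite st; apply: touch_sym; exact: sim_seq_of.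
Qed.

Lemma dX_ge m (s t : Sigma S) : ~ touch (pref s m) (pref t m) ->
  lam m / 4 <= dX (chi R s) (chi R t).
Proof.
move=> nst; apply: limr_ge; first exact: min_dn_cvg.
(* Two more levels make the loss [lam n] at most [lam m / 4], because [Lstar] is at least 2. *)
exists (2 + m)%N => // n /= mn.
have nE : n = (n - m + m)%N by rewrite subnK// (leq_trans _ mn)// leq_addl.
rewrite nE; apply: le_trans (min_dn_separated nst _ _); try exact: sim_seq_of.
rewrite -nE; have : lam n <= lam (2 + m) by exact: lam_le.
have := lam_half R S m.+1; have := lam_half R S m.
by rewrite !add2n; lra.
Qed.

End Distance.

(** * Bernoulli measures *)

Section Sequences.
Context (A : finType) (a0 : A).
Implicit Types (s t : nat -> A) (u : seq A).

Definition agree n s t := forall i, (i < n)%N -> s i = t i.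

Lemma agree_sym n s t : agree n s t -> agree n t s.
Proof. by move=> st i /st. Qed.

Lemma agree_trans n s t r : agree n s t -> agree n t r -> agree n s r.
Proof. by move=> st tr i ni; rewrite st ?tr. Qed.

Lemma agree_le m n s t : (m <= n)%N -> agree n s t -> agree m s t.
Proof. by move=> mn st i im; apply: st; exact: leq_trans mn. Qed.

Lemma agreeP n s t : mkseq s n = mkseq t n <-> agree n s t.
Proof.
split=> [H i ni|H]; first by rewrite -(nth_mkseq (s 0%N) s ni) H nth_mkseq.
by apply/eq_in_map => i; rewrite mem_iota => ni; exact: H.
Qed.

(** Compactness of the sequence space: if no level served all sequences, an infinite branch of bad
    words would contradict the validity at some level along that branch. It yields uniform
    continuity and a uniform separation from fibers. *)
Lemma koenig (Q : nat -> (nat -> A) -> Prop) :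
  (forall n s t, agree n s t -> Q n s -> Q n t) ->
  (forall n s, Q n s -> Q n.+1 s) ->
  (forall s, exists n, Q n s) -> exists n, forall s, Q n s.
Proof.
move=> Qa QS Qex; apply: contrapT => nex.
have QS' m n s : (m <= n)%N -> Q m s -> Q n s.
  by move=> /subnK <-; elim: (n - m)%N => [//|k IH] /IH/QS.
pose bad u := forall N, exists2 s, mkseq s (size u) = u & ~ Q N s.
have bad0 : bad [::].
  move=> N; apply: contrapT => H; apply: nex; exists N => s.
  by apply: contrapT => nQ; apply: H; exists s.
have badS u : bad u -> exists a, bad (rcons u a).
  move=> bu; apply: contrapT => /forallNP H.
  have {}H a : exists N, forall s, mkseq s (size (rcons u a)) = rcons u a -> Q N s.
    have /existsNP[N HN] := H a; exists N => s sa.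
    by apply: contrapT => nQ; apply: HN; exists s.
  have [F HF] := choice H.
  have [s su nQ] := bu (\max_a F a)%N; apply: nQ.
  apply: (QS' (F (s (size u)))); first exact: leq_bigmax.
  by apply: HF; rewrite size_rcons mkseqS su.
have : forall u, exists a, bad u -> bad (rcons u a).
  move=> u; have [bu|nbu] := pselect (bad u); last by exists a0.
  by have [a ba] := badS u bu; exists a.
move=> /choice[F HF]; pose pre := fix pre n := if n is n'.+1 then rcons (pre n') (F (pre n')) else [::].
have bpre n : bad (pre n) by elim: n => [//|n IH] /=; exact: HF.
have spre n : size (pre n) = n by elim: n => [//|n IH] /=; rewrite size_rcons IH.
pose s n := F (pre n).
have sE n : mkseq s n = pre n by elim: n => [//|n IH]; rewrite mkseqS IH.
have [n Qn] := Qex s; have [t tn nQ] := bpre n n; apply: nQ; apply: Qa Qn.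
by apply/agreeP; rewrite sE -tn spre.
Qed.

Definition scons (a : A) s : nat -> A := fun i => if i is j.+1 then s j else a.

Definition sapp u s : nat -> A := foldr scons s u.

Lemma agree_scons a n s t : agree n s t -> agree n.+1 (scons a s) (scons a t).
Proof. by move=> st [//|i]; exact: st. Qed.

Lemma agree_sapp n s t : agree n (sapp (mkseq s n) t) s.
Proof.
elim: n s => [//|n IH] s [//|i] ni; rewrite /mkseq /=.
have := IH (fun i => s i.+1) i ni; rewrite /mkseq => <-.
by congr (foldr scons t _ i); rewrite (iotaDl 1 0) -map_comp.
Qed.

Fixpoint words n : seq (seq A) :=
  if n is n'.+1 then [seq a :: u | a <- enum A, u <- words n'] else [:: [::]].

Lemma words_size n u : u \in words n -> size u = n.
Proof.
by elim: n u => [|n IH] u; [rewrite inE => /eqP->|move=> /allpairsP[[a v] [_ /IH /= <- ->]]].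
Qed.

Lemma sum_words_pick (R : pzSemiRingType) n s (F : seq A -> R) :
  \sum_(u <- words n) F u * (mkseq s n == u)%:R = F (mkseq s n).
Proof.
elim: n s F => [|n IH] s F; first by rewrite big_seq1 eqxx mulr1.
rewrite big_allpairs_dep/= big_enum/=.
have sE : mkseq s n.+1 = s 0%N :: mkseq (fun i => s i.+1) n.
  by rewrite /mkseq /= (iotaDl 1 0) -map_comp.
rewrite sE (bigD1 (s 0%N))//= [X in _ + X]big1 ?addr0 => [|a /negbTE sa].
  rewrite -(IH (fun i => s i.+1) (fun v => F (s 0%N :: v))).
  by apply: eq_bigr => u _; rewrite eqseq_cons eqxx.
by apply: big1 => u _; rewrite eqseq_cons eq_sym sa mulr0.
Qed.

End Sequences.

Section Cylinders.
Context (R : realType) (A : finType) (a0 : A).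
Local Notation Om := (mseqspace a0).

Lemma measurable_cylinder u : measurable (cylinder a0 u : set Om).
Proof. by apply: sub_sigma_algebra; exists u. Qed.

Lemma measurable_agree (B : set Om) :
  (forall s, B s -> exists n, forall t, agree n s t -> B t) -> measurable B.
Proof.
move=> H.
have -> : B = \bigcup_u (if `[< cylinder a0 u `<=` B >] then cylinder a0 u else set0 : set Om).
  apply/seteqP; split=> [s Bs|s [u _]]; last by case: asboolP => // uB; exact: uB.
  have [n Hn] := H s Bs; exists (mkseq s n) => //.
  case: asboolP => [_|[]]; first by rewrite /cylinder /= size_mkseq.
  move=> t; rewrite /cylinder /= size_mkseq => st; apply: Hn.
  exact/agree_sym/agreeP.
apply: countable_bigcupT_measurable => [|u]; first exact: countableP.
by case: asboolP => _; [exact: measurable_cylinder|exact: measurable0].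
Qed.

(** Continuity for the product topology, pointwise here and uniform in [ucont]; the two agree by
    compactness. *)
Definition lcont (g : (nat -> A) -> R) := forall s (e : R), 0 < e ->
  exists n, forall t, agree n s t -> `|g s - g t| <= e.

Definition ucont (g : (nat -> A) -> R) := forall e : R, 0 < e ->
  exists n, forall s t, agree n s t -> `|g s - g t| <= e.

Lemma lcont_ucont g : lcont g -> ucont g.
Proof.
move=> cg e e0.
pose Q n s := forall t t', agree n s t -> agree n s t' -> `|g t - g t'| <= e.
have [||s|n Hn] := @koenig A a0 Q.
- by move=> n s t st Qs r r' tr tr'; apply: Qs; exact: agree_trans st _.
- by move=> n s Qs r r' sr sr'; apply: Qs; apply: agree_le (leqnSn n) _.
- have e2 : 0 < e / 2 by rewrite divr_gt0.
  have [n Hn] := cg s _ e2; exists n => t t' st st'.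
  have -> : g t - g t' = (g s - g t') - (g s - g t) by ring.
  rewrite (le_trans (ler_normB _ _))//.
  by have := Hn _ st; have := Hn _ st'; lra.
- by exists n => s t st; apply: (Hn s).
Qed.

Lemma ucont_lcont g : ucont g -> lcont g.
Proof. by move=> ug s e /ug[n Hn]; exists n; exact: Hn. Qed.

Lemma measurable_ucont g : ucont g -> measurable_fun [set: Om] (g : Om -> R).
Proof.
move=> ug; apply: (measurability _ (measurable_realfun.RGenOInfty.measurableE R)) => _ [_ [x ->] <-].
rewrite setTI; apply: measurable_agree => s; rewrite /= in_itv/= andbT => xs.
have e0 : 0 < (g s - x) / 2 by rewrite divr_gt0// subr_gt0.
have [n Hn] := ucont_lcont ug s e0; exists n => t /Hn.
by rewrite /= in_itv/= andbT ler_norml => /andP[_]; lra.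
Qed.

Lemma ucont_bounded g : ucont g -> exists M, forall s, `|g s| <= M.
Proof.
move=> ug; pose Q n s := forall t, agree n s t -> `|g t| <= n%:R.
have [||s|n Hn] := @koenig A a0 Q.
- by move=> n s t st Qs r tr; apply: Qs; exact: agree_trans st _.
- move=> n s Qs r sr; rewrite (le_trans (Qs r _)) ?ler_nat//.
  exact: agree_le (leqnSn n) _.
- have [n Hn] := ucont_lcont ug s ltr01.
  have [m Hm] : exists m, `|g s| + 1 <= m%:R.
    by exists (Num.bound (`|g s| + 1)); rewrite ltW// archi_boundP// addr_ge0.
  exists (maxn n m) => t st; apply: (@le_trans _ _ m%:R); last by rewrite ler_nat leq_maxr.
  apply: le_trans Hm; have := Hn t (agree_le (leq_maxl _ _) st).
  by move=> h; have := lerB_dist (g t) (g s); rewrite distrC; lra.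
- by exists n%:R => s; exact: (Hn s).
Qed.

Lemma ucont_cst c : ucont (fun=> c).
Proof. by move=> e e0; exists 0%N => s t _; rewrite subrr normr0 ltW. Qed.

Lemma ucontD f g : ucont f -> ucont g -> ucont (fun s => f s + g s).
Proof.
move=> uf ug e e0; have e2 : 0 < e / 2 by rewrite divr_gt0.
have [n Hn] := uf _ e2; have [m Hm] := ug _ e2.
exists (maxn n m) => s t st.
have h1 := Hn s t (agree_le (leq_maxl _ _) st); have h2 := Hm s t (agree_le (leq_maxr _ _) st).
rewrite opprD addrACA (le_trans (ler_normD _ _))//; lra.
Qed.

Lemma ucont_lipschitz (phi : R -> R) g : (forall x y, `|phi x - phi y| <= `|x - y|) ->
  ucont g -> ucont (fun s => phi (g s)).
Proof.
move=> Hphi ug e /ug[n Hn]; exists n => s t st.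
exact: le_trans (Hphi _ _) (Hn s t st).
Qed.

Lemma ucontZ c g : ucont g -> ucont (fun s => c * g s).
Proof.
move=> ug e e0; have c1 : 0 < `|c| + 1 by rewrite ltr_wpDl.
have [n Hn] := ug _ (divr_gt0 e0 c1); exists n => s t st.
rewrite -mulrBr normrM; have := Hn s t st; rewrite ler_pdivlMr// => h.
apply: le_trans h; rewrite mulrC ler_wpM2l// lerDl//.
Qed.

Lemma ucontN g : ucont g -> ucont (fun s => - g s).
Proof. by apply: ucont_lipschitz => x y; rewrite -opprD normrN. Qed.

Lemma ucontB f g : ucont f -> ucont g -> ucont (fun s => f s - g s).
Proof. by move=> uf /ucontN; exact: ucontD. Qed.

Lemma ucont_norm g : ucont g -> ucont (fun s => `|g s|).
Proof. by apply: ucont_lipschitz => x y; exact: ler_dist_dist. Qed.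

Lemma ucont_scons g a : ucont g -> ucont (fun s => g (scons a s)).
Proof.
move=> ug e /ug[n Hn]; exists n => s t st; apply: Hn.
exact: agree_le (leqnSn n) (agree_scons a st).
Qed.

End Cylinders.

Section BernoulliIntegral.
Context (R : realType) (A : finType) (a0 : A) (w : A -> R).
Local Notation Om := (mseqspace a0).
Context (P : {measure set Om -> \bar R}).
Hypotheses (w0 : forall a, 0 <= w a) (w1 : \sum_a w a = 1) (hP : is_bernoulli w P).

Definition Ig (g : (nat -> A) -> R) : R := fine (\int[P]_s (g s)%:E).

Lemma bernoulli_setT : P setT = 1%E.
Proof.
have := hP [::]; rewrite big_nil => <-; congr (P _).
by apply/seteqP; split.
Qed.

Lemma ucont_integrable g : ucont g -> P.-integrable setT (EFin \o (g : Om -> R)).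
Proof.
move=> ug; apply: measurable_bounded_integrable => //.
- by rewrite [X in (X < _)%E]bernoulli_setT ltry.
- exact: measurable_ucont.
- have [M HM] := ucont_bounded a0 ug; exists M; split; first exact: num_real.
  by move=> x Mx s _ /=; apply: le_trans (HM s) _; exact: ltW.
Qed.

Lemma EFin_Ig g : ucont g -> (Ig g)%:E = (\int[P]_s (g s)%:E)%E.
Proof. by move=> ug; rewrite fineK//; apply: integrable_fin_num => //; exact: ucont_integrable. Qed.

Lemma IgD f g : ucont f -> ucont g -> Ig (fun s => f s + g s) = Ig f + Ig g.
Proof. by move=> uf ug; apply: (RintegralD (mu := P)) => //; exact: ucont_integrable. Qed.

Lemma IgB f g : ucont f -> ucont g -> Ig (fun s => f s - g s) = Ig f - Ig g.
Proof. by move=> uf ug; apply: (RintegralB (mu := P)) => //; exact: ucont_integrable. Qed.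

Lemma IgZ c g : ucont g -> Ig (fun s => c * g s) = c * Ig g.
Proof. by move=> ug; apply: (RintegralZl (mu := P)) => //; exact: ucont_integrable. Qed.

Lemma Ig_le f g : ucont f -> ucont g -> (forall s, f s <= g s) -> Ig f <= Ig g.
Proof. by move=> uf ug fg; apply: (le_Rintegral (mu := P)) => //; exact: ucont_integrable. Qed.

Lemma Ig_cst c : Ig (fun=> c) = c.
Proof.
rewrite /Ig -/(Rintegral P setT (fun=> c)) Rintegral_cst//.
by rewrite [X in fine X]bernoulli_setT mulr1.
Qed.

Lemma Ig_norm g : ucont g -> `|Ig g| <= Ig (fun s => `|g s|).
Proof.
move=> ug; have ung := ucont_norm ug; rewrite ler_norml; apply/andP; split.
  rewrite -mulN1r -IgZ//; apply: Ig_le => [||s]; rewrite ?mulN1r; [exact: ucontZ|exact: ug|].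
  exact: lerNnormlW.
by apply: Ig_le => // s; exact: ler_norm.
Qed.

Lemma Ig_close f g e : ucont f -> ucont g -> (forall s, `|f s - g s| <= e) -> `|Ig f - Ig g| <= e.
Proof.
move=> uf ug H; rewrite -IgB//; apply: le_trans (Ig_norm (ucontB uf ug)) _.
rewrite -(Ig_cst e); apply: Ig_le => //; last exact: ucont_cst.
exact/ucont_norm/ucontB.
Qed.

Definition step_fun n (g : (nat -> A) -> R) : (nat -> A) -> R :=
  fun s => g (sapp (mkseq s n) (fun=> a0)).

Lemma ucont_local n (g : (nat -> A) -> R) : (forall s t, agree n s t -> g s = g t) -> ucont g.
Proof. by move=> H e e0; exists n => s t /H->; rewrite subrr normr0 ltW. Qed.

Lemma ucont_indic (u : seq A) : ucont (fun s : nat -> A => (mkseq s (size u) == u)%:R : R).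
Proof. by apply: (@ucont_local (size u)) => s t /agreeP->. Qed.

Lemma Ig_indic u : Ig (fun s => (mkseq s (size u) == u)%:R) = \prod_(a <- u) w a.
Proof.
apply: EFin_inj; rewrite EFin_Ig; last exact: ucont_indic.
rewrite -(hP u) -[in RHS](setIT (cylinder a0 u)) -integral_indic//; last exact: measurable_cylinder.
apply: eq_integral => s _; congr EFin; rewrite indicE /cylinder; congr (nat_of_bool _)%:R.
by apply/eqP/idP => [H|]; [rewrite inE|rewrite inE].
Qed.

Lemma Ig_sum (T : Type) (r : seq T) (F : T -> (nat -> A) -> R) : (forall i, ucont (F i)) ->
  Ig (fun s => \sum_(i <- r) F i s) = \sum_(i <- r) Ig (F i) /\
  ucont (fun s => \sum_(i <- r) F i s).
Proof.
move=> uF; elim: r => [|i r [IH uIH]].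
  rewrite big_nil; have -> : (fun s => \sum_(i <- [::]) F i s) = fun=> 0.
    by apply/funext => s; rewrite big_nil.
  by rewrite Ig_cst; split=> //; exact: ucont_cst.
have -> : (fun s => \sum_(j <- i :: r) F j s) = (fun s => F i s + \sum_(j <- r) F j s).
  by apply/funext => s; rewrite big_cons.
by rewrite big_cons IgD// IH; split=> //; exact: ucontD.
Qed.

Definition riem n (g : (nat -> A) -> R) : R :=
  \sum_(u <- words A n) g (sapp u (fun=> a0)) * \prod_(a <- u) w a.

Lemma Ig_step n g : Ig (step_fun n g) = riem n g.
Proof.
have -> : step_fun n g = fun s => \sum_(u <- words A n) g (sapp u (fun=> a0)) * (mkseq s n == u)%:R.
  by apply/funext => s; rewrite sum_words_pick.
have uu u : ucont (fun s => g (sapp u (fun=> a0)) * (mkseq s n == u)%:R).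
  by apply: ucontZ; apply: (@ucont_local n) => s t /agreeP->.
rewrite (proj1 (Ig_sum _ uu)) /riem !big_seq; apply: eq_bigr => u /words_size <-.
by rewrite IgZ ?Ig_indic//; exact: ucont_indic.
Qed.

Lemma Ig_riem n g e : ucont g -> (forall s t, agree n s t -> `|g s - g t| <= e) ->
  `|Ig g - riem n g| <= e.
Proof.
move=> ug H; rewrite -Ig_step; apply: Ig_close => // [|s].
  by apply: (@ucont_local n) => s t /agreeP; rewrite /step_fun => ->.
by apply: H; apply: agree_sym; exact: agree_sapp.
Qed.

Lemma riemS n g : riem n.+1 g = \sum_a w a * riem n (fun s => g (scons a s)).
Proof.
rewrite /riem /= big_allpairs_dep/= big_enum/=; apply: eq_bigr => a _.
by rewrite mulr_sumr; apply: eq_bigr => u _; rewrite big_cons mulrCA.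
Qed.

(** Self-similarity of the Bernoulli measure. For Riemann sums, splitting off the first letter is
    the algebraic identity [riemS], and uniform continuity passes to the integral. *)
Lemma Ig_scons g : ucont g -> Ig g = \sum_a w a * Ig (fun s => g (scons a s)).
Proof.
move=> ug; apply/eqP; rewrite -subr_eq0 -normr_le0; apply/ler_addgt0Pr => e e0.
have e2 : 0 < e / 2 by rewrite divr_gt0.
have [n Hn] := ug _ e2; rewrite add0r.
have h1 : `|Ig g - riem n.+1 g| <= e / 2.
  by apply: Ig_riem => // s t /(agree_le (leqnSn n)); exact: Hn.
have h2 : `|riem n.+1 g - \sum_a w a * Ig (fun s => g (scons a s))| <= e / 2.
  rewrite riemS -sumrB (le_trans (ler_norm_sum _ _ _))//.
  apply: (@le_trans _ _ (\sum_a w a * (e / 2))); last by rewrite -mulr_suml w1 mul1r.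
  apply: ler_sum => a _; rewrite -mulrBr normrM ger0_norm// ler_wpM2l//.
  rewrite distrC; apply: Ig_riem; first exact: ucont_scons.
  by move=> s t /(agree_scons a)/(agree_le (leqnSn n)); exact: Hn.
have -> : Ig g - \sum_a w a * Ig (fun s => g (scons a s)) = (Ig g - riem n.+1 g) +
  (riem n.+1 g - \sum_a w a * Ig (fun s => g (scons a s))) by ring.
by rewrite (le_trans (ler_normD _ _))//; lra.
Qed.

End BernoulliIntegral.

(** * Construction of Bernoulli measures by coding the unit interval *)

Section BernoulliExistence.
Context (R : realType) (A : finType) (a0 : A) (w : A -> R).
Hypotheses (w0 : forall a, 0 <= w a) (w1 : \sum_a w a = 1).
Local Notation Om := (mseqspace a0).

Definition cum k : R := \sum_(0 <= i < k) w (nth a0 (enum A) i).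
Definition cumw a : R := cum (index a (enum A)).

Lemma cum_le k l : (k <= l)%N -> cum k <= cum l.
Proof.
move=> kl; rewrite /cum (big_cat_nat _ kl)//= lerDl.
by apply: sumr_ge0 => i _; exact: w0.
Qed.

Lemma cum_card : cum #|A| = 1.
Proof. by rewrite /cum cardE -(big_nth a0 predT w) big_enum/= w1. Qed.

Lemma cumwS a : cumw a + w a = cum (index a (enum A)).+1.
Proof. by rewrite /cum big_nat_recr//= nth_index// mem_enum. Qed.

Lemma cumw_ge0 a : 0 <= cumw a.
Proof. by apply: sumr_ge0 => i _; exact: w0. Qed.

Lemma cumwS_le1 a : cumw a + w a <= 1.
Proof. by rewrite cumwS -cum_card cum_le// cardE index_mem mem_enum. Qed.

(** The unit interval is cut into consecutive intervals of lengths [w a]; letters of weight 0 get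
    empty intervals and are never digits of points of [[0, 1[]. *)
Definition digit (x : R) : A := odflt a0 [pick a | cumw a <= x < cumw a + w a].

Lemma digit_uniq a x : cumw a <= x < cumw a + w a -> digit x = a.
Proof.
move=> ax; rewrite /digit; case: pickP => [b /= bx|/(_ a)]; last by rewrite ax.
move: ax bx; rewrite !cumwS /cumw => /andP[a1 a2] /andP[b1 b2].
have : index a (enum A) = index b (enum A).
  have [ab|ab|//] := ltngtP (index a (enum A)) (index b (enum A)).
    by exfalso; have := cum_le ab; lra.
  by exfalso; have := cum_le ab; lra.
by move/(congr1 (nth a0 (enum A))); rewrite !nth_index ?mem_enum.
Qed.

Lemma digitP (x : R) : 0 <= x < 1 -> cumw (digit x) <= x < cumw (digit x) + w (digit x).
Proof.
move=> /andP[x0 x1]; suff [a ax] : exists a, cumw a <= x < cumw a + w a.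
  by rewrite (digit_uniq ax).
have ex : exists k, x < cum k by exists #|A|; rewrite cum_card.
case: (ex_minnP ex) => -[|k] xk mk.
  by exfalso; move: xk; rewrite /cum big_geq//; lra.
have kx : cum k <= x by rewrite leNgt; apply/negP => /mk; rewrite ltnn.
have kA : (k < size (enum A))%N.
  by rewrite -cardE ltnNge; apply/negP => /cum_le; rewrite cum_card => h; lra.
exists (nth a0 (enum A) k).
by rewrite cumwS /cumw index_uniq ?enum_uniq// kx.
Qed.

Definition shift (x : R) : R := (x - cumw (digit x)) / w (digit x).

Definition code (x : R) : nat -> A := fun n => digit (iter n shift x).

Lemma codeS x n : code x n.+1 = code (shift x) n.
Proof. by rewrite /code iterSr. Qed.

Lemma digit_gt0 (x : R) : 0 <= x < 1 -> 0 < w (digit x).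
Proof. by move=> /digitP/andP[]; lra. Qed.

Lemma shift_itv (x : R) : 0 <= x < 1 -> 0 <= shift x < 1.
Proof.
move=> x01; have wx := digit_gt0 x01; have /andP[h1 h2] := digitP x01.
apply/andP; split; rewrite /shift; first by apply: divr_ge0; [rewrite subr_ge0|exact: ltW].
by rewrite ltr_pdivrMr// mul1r ltrBlDl.
Qed.

Fixpoint lo (u : seq A) : R := if u is a :: v then cumw a + w a * lo v else 0.
Definition wprod (u : seq A) : R := \prod_(a <- u) w a.

Lemma lo_bounds u : [/\ 0 <= lo u, 0 <= wprod u & lo u + wprod u <= 1].
Proof.
elim: u => [|a v [IH1 IH2 IH3]]; first by rewrite /wprod big_nil/= add0r; split.
rewrite /wprod big_cons -/(wprod v) /=; have := w0 a; have := cumwS_le1 a; have := cumw_ge0 a.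
move=> c0 c1 wa; split; [by rewrite addr_ge0// mulr_ge0|by rewrite mulr_ge0|].
rewrite -addrA -mulrDr; apply: le_trans c1; rewrite lerD2l ler_piMr//.
Qed.

(** [shift] maps the interval of the first digit affinely onto [[0, 1[], so fixing the first letters
    cuts out an interval whose length is the product of their weights. *)
Lemma code_itv u (x : R) : 0 <= x < 1 ->
  mkseq (code x) (size u) = u <-> lo u <= x < lo u + wprod u.
Proof.
elim: u x => [|a v IH] x x01 /=; first by rewrite /wprod big_nil add0r.
have -> : mkseq (code x) (size v).+1 = digit x :: mkseq (code (shift x)) (size v).
  rewrite /mkseq /= (iotaDl 1 0) -map_comp; congr cons.
  by apply: eq_map => i; rewrite /= codeS.
rewrite /wprod big_cons -/(wprod v).
have [l0 W0 l1] := lo_bounds v; have wa := w0 a.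
split=> [[dx /(IH _ (shift_itv x01))]|/andP[h1 h2]].
  have wx := digit_gt0 x01; rewrite /shift dx in wx *.
  by rewrite ler_pdivlMr// ltr_pdivrMr// => /andP[h1 h2]; apply/andP; split; lra.
have wlo : 0 <= w a * lo v by rewrite mulr_ge0.
have wlo1 : w a * lo v + w a * wprod v <= w a by rewrite -mulrDr ler_piMr.
have dx : digit x = a by apply: digit_uniq; apply/andP; split; lra.
rewrite dx; congr cons; apply/(IH _ (shift_itv x01)).
have wx := digit_gt0 x01; rewrite /shift dx in wx *.
by rewrite ler_pdivlMr// ltr_pdivrMr//; apply/andP; split; lra.
Qed.

Let D : set (measurableTypeR R) := `[0, 1[.
Let mD : measurable D. Proof. exact: measurable_itv. Qed.

Definition coding (x : measurableTypeR R) : Om :=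
  if (0 <= x < 1)%R then code x else fun=> a0.

Lemma coding_cylinder u : D `&` coding @^-1` cylinder a0 u = `[lo u, lo u + wprod u[%classic.
Proof.
have [l0 W0 l1] := lo_bounds u.
apply/seteqP; split=> x; rewrite /D /cylinder /coding /= !in_itv/=.
  by move=> [x01]; rewrite x01 => /(code_itv _ x01).
move=> h; have x01 : 0 <= x < 1 by move: h => /andP[h1 h2]; apply/andP; split; lra.
by rewrite x01; split=> //; apply/code_itv.
Qed.

Lemma measurable_coding : measurable_fun [set: measurableTypeR R] coding.
Proof.
apply: (@measurability _ _ _ _ setT coding (range (cylinder a0)) erefl) => _ [_ [u _ <-] <-]; rewrite setTI.
rewrite -(setIT (coding @^-1` _)) -(setUv D) setIUr setIC coding_cylinder.
apply: measurableU; first exact: measurable_itv.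
have [H|H] := pselect (cylinder a0 u (fun=> a0)).
  rewrite (_ : _ `&` _ = ~` D); first exact: measurableC.
  apply/seteqP; split=> [x []//|x xD]; split=> //.
  rewrite /coding /=; case: ifP => // x01; case: xD.
rewrite (_ : _ `&` _ = set0)//; apply/seteqP; split=> // x [].
rewrite /coding /=; case: ifP => x01 h xD; last exact: H.
by apply: xD; rewrite /D /= ?in_itv.
Qed.

Lemma exists_bernoulli : exists P : {measure set Om -> \bar R}, is_bernoulli w P.
Proof.
pose m : {measure set (measurableTypeR R) -> \bar R} := mrestr (@lebesgue_measure R) mD.
pose P : {measure set Om -> \bar R} :=
  measure_function_pushforward__canonical__measure_function_Measure m measurable_coding.
exists P => u; rewrite /P /= /pushforward /m /mrestr setIC coding_cylinder.
have [_ W0 _] := lo_bounds u; rewrite lebesgue_measure_itv /= lte_fin -/(wprod u).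
case: ltP => [_|]; first by rewrite -EFinB addrC addKr.
by rewrite gerDl => h; congr EFin; apply/eqP; rewrite eq_le W0 h.
Qed.

Lemma bernoulliP : is_bernoulli w (bernoulli a0 w).
Proof.
rewrite /bernoulli; case: pselect => [ex|[]]; last exact: exists_bernoulli.
by case: cid.
Qed.

End BernoulliExistence.

(** * Fiber averages and cell means *)

Section LimitSpaceTopology.
Context (R : realType) (S : ndd_igs).
Local Notation X := (limit_space S R).
Local Notation V n := (vertex (rgraph S n)).
Local Notation E n := (edge (rgraph S n)).

Lemma agree_pref n (s t : nat -> edge (gen S)) : agree n s t <-> pref s n = pref t n.
Proof. exact: pref_eqP. Qed.

Lemma chi_open (U : set X) (s : nat -> edge (gen S)) : open U -> U (chi R s) ->
  exists n, forall t, agree n s t -> U (chi R t).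
Proof.
move=> oU Us; have [r r0 rU] : exists2 r : R, 0 < r & forall y, dX (chi R s) y < r -> U y := oU _ Us.
have r3 : 0 < r / 3 by rewrite divr_gt0.
have [n Hn] := lam_cvg0 S r3; exists n => t /agree_pref st; apply: rU.
by apply: le_lt_trans (dX_le R st) _; have := Hn n (leqnn n); lra.
Qed.

Definition fiber_point n (v : V n) (a : nat -> idx S) : X := chi R (Tseq v (incident_edge v) a).

Lemma fiber_point_edge n (v : V n) (e : E n) a : v \in ends e ->
  fiber_point v a = chi R (Tseq v e a).
Proof.
by move=> ve; apply: chi_Tseq_fiber; [exact: incident_edgeP|have [] := TseqP a ve].
Qed.

Lemma fiber_point_shift n (v : V n) a b :
  fiber_point v (scons a b) = fiber_point (vdot v a) b.
Proof. by apply: (@chi_Tseq_shift R S n v _ _ (scons a b)); exact: incident_edgeP. Qed.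

Lemma agree_Tseq n (v : V n) (e : E n) a b m : v \in ends e -> agree m a b ->
  agree m (Tseq v e a) (Tseq v e b).
Proof.
move=> ve ab; apply: (@agree_le _ m (m + n)); first exact: leq_addr.
by apply/agree_pref; exact: Tseq_ext.
Qed.

Lemma measurable_chi :
  measurable_fun [set: mseqspace (edge0 S)] (chi R (S := S) : _ -> borelX R S).
Proof.
apply: (@measurability _ _ _ (borelX R S) setT _ (@open X) erefl) => _ [U oU <-].
rewrite setTI; apply: measurable_agree => s; exact: chi_open.
Qed.

Lemma measurable_fiber_point n (v : V n) :
  measurable_fun [set: mseqspace (idx0 S)] (fiber_point v : _ -> borelX R S).
Proof.
apply: (@measurability _ _ _ (borelX R S) setT _ (@open X) erefl) => _ [U oU <-].
rewrite setTI; apply: measurable_agree => a /(chi_open oU)[m Hm].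
by exists m => b ab; apply: Hm; apply: agree_Tseq ab; exact: incident_edgeP.
Qed.

(** The fiber is closed: a point [y] off it is separated from each fiber sequence at some level,
    compactness gives one level [m] for all of them, and [dX_ge] turns it into a ball of radius
    [lam m / 4]. *)
Lemma measurable_Fib n (v : V n) : measurable (Fib v : set (borelX R S)).
Proof.
rewrite -(setCK (Fib v)); apply: measurableC; apply: sub_sigma_algebra.
rewrite -[open _]/(@dX_open R S _) => y yF.
pose T a := Tseq v (incident_edge v) a.
pose Q m a := ~ touch (pref (seq_of y) m) (pref (T a) m).
have [||a|m Hm] := @koenig _ (idx0 S) Q.
- move=> m a b ab; rewrite /Q (_ : pref (T b) m = pref (T a) m)//.
  by apply/agree_pref/agree_sym/agree_Tseq; [exact: incident_edgeP|].
- by move=> m a; apply: contra_not; exact: touch_pref_le.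
- apply: contrapT => /forallNP H; apply: yF; exists a => //; rewrite -[RHS]chi_seq_of.
  by apply/chi_eqP/sim_sym => m; apply: contrapT; exact: (H m).
exists (lam R S m / 4); first by rewrite divr_gt0// lam_gt0.
move=> z yz [a _ az]; move: yz; rewrite -(chi_seq_of y) -az ltNge => /negP; apply.
by apply: dX_ge; exact: Hm.
Qed.

Section Continuous.
Context (f : X -> R).
Hypothesis cf : continuous f.

Lemma continuous_lcont (s : nat -> edge (gen S)) (e : R) : 0 < e ->
  exists n, forall t, agree n s t -> `|f (chi R s) - f (chi R t)| <= e.
Proof.
move=> e0; have := cf (x := chi R s); move=> /cvgrPdist_lt/(_ e e0).
rewrite nbhsE => -[U [oU Us] UH].
have [n Hn] := chi_open oU Us; exists n => t /Hn/UH; exact: ltW.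
Qed.

Lemma ucont_chi : ucont (fun s : nat -> edge (gen S) => f (chi R s)).
Proof. by apply: (lcont_ucont (edge0 S)) => s e; exact: continuous_lcont. Qed.

Lemma ucont_scat n (e : E n) : ucont (fun t => f (chi R (scat e t))).
Proof.
move=> d /ucont_chi[m Hm]; exists m => s t st; apply: Hm => i im.
rewrite /scat; case: ifP => // _; apply: st; apply: leq_ltn_trans im; exact: leq_subr.
Qed.

Lemma ucont_fiber_point n (v : V n) : ucont (fun a => f (fiber_point v a)).
Proof.
move=> d /ucont_chi[m Hm]; exists m => a b ab; apply: Hm.
by apply: agree_Tseq ab; exact: incident_edgeP.
Qed.

Lemma measurable_continuous : measurable_fun [set: borelX R S] (f : borelX R S -> R).
Proof.
apply: (measurability _ (measurable_realfun.RGenOInfty.measurableE R)) => _ [_ [x ->] <-].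
rewrite setTI; apply: sub_sigma_algebra.
move/continuousP: cf; apply; exact: interval_open.
Qed.

End Continuous.
End LimitSpaceTopology.

Section Averages.
Context (R : realType) (S : ndd_igs) (p : R).
Local Notation X := (limit_space S R).
Local Notation V n := (vertex (rgraph S n)).
Local Notation E n := (edge (rgraph S n)).
Local Notation w := (@Jdens R S p).
Hypotheses (w0 : forall a, 0 <= w a) (w1 : \sum_a w a = 1).
Local Notation P := (bernoulli (idx0 S) w).

(** Every index sequence lands in [Fib v], so the transported integral runs over the whole sequence
    space; measurability of the fiber enters in the change of variables. *)
Lemma VavgE (f : X -> R) n (v : V n) : continuous f ->
  Vavg p f v = Ig P (fun a => f (fiber_point R v a)).
Proof.
move=> cf; rewrite /Vavg /Ig; congr fine.
have preT : fiber_point R v @^-1` (Fib v : set (borelX R S)) = setT.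
  by apply/seteqP; split=> // a _; exists a.
rewrite (integral_pushforward (measurable_fiber_point v)).
- by rewrite preT.
- by apply/measurable_EFinP; exact: measurable_continuous.
- by rewrite preT; exact: (ucont_integrable (bernoulliP (idx0 S) w0 w1) (ucont_fiber_point cf v)).
- exact: measurable_Fib.
Qed.

(** The first letter of an index sequence selects the subfiber at [vdot v a]. The identity becomes
    the hypothesis [HY] of the energy estimates. *)
Lemma Vavg_vdot (f : X -> R) n (v : V n) : continuous f ->
  Vavg p f v = \sum_a w a * Vavg p f (vdot v a).
Proof.
move=> cf; rewrite VavgE// (Ig_scons w0 w1 (bernoulliP (idx0 S) w0 w1)); last exact: ucont_fiber_point.
apply: eq_bigr => a _.
have -> : Vavg p f (vdot v a) = Ig P (fun b => f (fiber_point R (vdot v a) b)) := VavgE (vdot v a) cf.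
have -> : (fun s => f (fiber_point R v (scons a s))) = fun b => f (fiber_point R (vdot v a) b).
  by apply/funext => s; rewrite fiber_point_shift.
by [].
Qed.

Lemma VavgB (f g : X -> R) n (v : V n) : continuous f -> continuous g ->
  Vavg p (f \- g) v = Vavg p f v - Vavg p g v.
Proof.
move=> cf cg; have cfg : continuous (f \- g) by move=> x; exact: (@continuousB _ _ _ f g x (cf x) (cg x)).
rewrite !VavgE// -(IgB (bernoulliP (idx0 S) w0 w1))//; exact: ucont_fiber_point.
Qed.

Lemma Vavg_cst (c : R) n (v : V n) : Vavg p (fun=> c) v = c.
Proof. by rewrite VavgE ?(Ig_cst (bernoulliP (idx0 S) w0 w1))//; exact: cst_continuous. Qed.

Lemma Vavg_approx (f : X -> R) eps : continuous f -> 0 < eps -> exists N, forall n, (N <= n)%N ->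
  forall (e : E n) v t, v \in ends e -> `|f (chi R (scat e t)) - Vavg p f v| <= eps.
Proof.
move=> cf /(ucont_chi cf)[N HN]; exists N => n Nn e v t ve.
rewrite VavgE// -(Ig_cst (bernoulliP (idx0 S) w0 w1) (f (chi R (scat e t)))).
apply: (Ig_close (bernoulliP (idx0 S) w0 w1)); [exact: ucont_cst|exact: ucont_fiber_point|move=> a].
rewrite (fiber_point_edge R a ve); apply: HN; apply: agree_le Nn _.
by apply/agree_pref; rewrite pref_scat; have [-> _] := TseqP a ve.
Qed.

End Averages.

Section Means.
Context (R : realType) (S : ndd_igs).
Local Notation X := (limit_space S R).
Local Notation E n := (edge (rgraph S n)).
Local Notation E1 := (edge (gen S)).
Local Notation N1 := (#|edge (gen S)|%:R : R).

Lemma N1_gt0 : 0 < N1.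
Proof. by rewrite ltr0n edge_nonempty. Qed.

Lemma unif_ge0 (f : E1) : 0 <= unif_density R (S := S) f.
Proof. by rewrite invr_ge0 ltW// N1_gt0. Qed.

Lemma sum_unif : \sum_f unif_density R (S := S) f = 1.
Proof. by rewrite sumr_const -[LHS]mulr_natr mulVf// gt_eqF// N1_gt0. Qed.

Local Notation P0 := (bernoulli (edge0 S) (@unif_density R S)).

Definition unif_bernoulli : is_bernoulli (@unif_density R S) P0 :=
  bernoulliP (edge0 S) unif_ge0 sum_unif.

Definition mean n (g : X -> R) (e : E n) : R := Ig P0 (fun t => g (chi R (scat e t))).

Lemma mean_child n (g : X -> R) (e : E n) : ucont (fun t => g (chi R (scat e t))) ->
  mean g e = N1^-1 * \sum_(f : E1) mean g ((e, f) : E n.+1).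
Proof.
move=> ug; rewrite /mean (Ig_scons unif_ge0 sum_unif unif_bernoulli ug) mulr_sumr.
apply: eq_bigr => f _; congr *%R; apply: (congr1 (Ig P0)).
by apply/funext => t; rewrite scat_rcons.
Qed.

Lemma integral_muX (g : borelX R S -> \bar R) : measurable_fun [set: borelX R S] g -> (forall x, 0 <= g x)%E ->
  (\int[muX R S]_x g x = \int[P0]_s g (chi R s))%E.
Proof.
move=> mg g0; rewrite (ge0_integral_pushforward (@measurable_chi R S))//.
Qed.

End Means.

(** * Discrete energies and Poincaré inequalities *)

Section TreeSums.
Context (R : realType) (S : ndd_igs).
Local Notation E n := (edge (rgraph S n)).
Local Notation E1 := (edge (gen S)).
Local Notation N1 := (#|edge (gen S)|%:R : R).
Implicit Types F G : forall n, E n -> R.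

(** Sum over the descendants [k] generations below [e]. Unfolding at the top avoids the
    identification of descendants with elements of [E (k + n)]. *)
Fixpoint ssum F k n (e : E n) : R :=
  if k is k'.+1 then \sum_(f : E1) ssum F k' ((e, f) : E n.+1) else F n e.

Lemma ssum_le F G k n (e : E n) : (forall n (e : E n), F n e <= G n e) -> ssum F k e <= ssum G k e.
Proof. by move=> FG; elim: k n e => [//|k IH] n e /=; apply: ler_sum => f _; exact: IH. Qed.

Lemma ssum_ge0 F k n (e : E n) : (forall n (e : E n), 0 <= F n e) -> 0 <= ssum F k e.
Proof. by move=> F0; elim: k n e => [//|k IH] n e /=; apply: sumr_ge0 => f _; exact: IH. Qed.

Lemma ssum_affine F a b k n (e : E n) :
  ssum (fun n e => a + b * F n e) k e = N1 ^+ k * a + b * ssum F k e.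
Proof.
elim: k n e => [|k IH] n e /=; first by rewrite expr0 mul1r.
under eq_bigr do rewrite IH.
by rewrite big_split/= sumr_const -mulr_sumr -[X in X + _]mulr_natl exprS -mulrA.
Qed.

Lemma sum_ssum F k n : \sum_(e : E n) ssum F k e = \sum_(e : E (k + n)) F _ e.
Proof.
pose tot m := \sum_(e : E m) F m e; rewrite -[RHS]/(tot (k + n)%N).
elim: k n => [//|k IH] n /=; rewrite addSnnS -IH.
by rewrite (pair_big predT predT)/=; apply: eq_bigr => -[].
Qed.

Lemma ssum_root F n : ssum F n (tt : E 0) = \sum_(e : E n) F n e.
Proof.
pose tot m := \sum_(e : E m) F m e.
have := sum_ssum F n 0; rewrite -[RHS]/(tot (n + 0)%N) addn0 -/(tot n) => <-.
by rewrite (big_pred1 (tt : E 0))// => -[].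
Qed.

End TreeSums.

Section OneExponent.
Context (R : realType) (S : ndd_igs) (p : R).
Hypothesis p1 : 1 < p.
Hypothesis CU : conductively_uniform R S.
Local Notation X := (limit_space S R).
Local Notation V1 := (vertex (gen S)).
Local Notation E1 := (edge (gen S)).
Local Notation V n := (vertex (rgraph S n)).
Local Notation E n := (edge (rgraph S n)).
Local Notation N1 := (#|edge (gen S)|%:R : R).
Local Notation U := (@Uopt R S p).
Local Notation M := (Mconst S p).
Local Notation u e := (absgrad U e).
Local Notation w := (@Jdens R S p).
Local Notation jf := (@jflow R S p).
Hypothesis Unz : forall e : E1, u e != 0.

Let p_gt0 : 0 < p. Proof. by have := p1; lra. Qed.
Let M_gt0 : 0 < M. Proof. exact: Mconst_gt0. Qed.
Let w_ge0 a : 0 <= w a. Proof. exact/ltW/Jdens_gt0. Qed.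
Let w_sum : \sum_a w a = 1. Proof. exact: sum_Jdens. Qed.
Let N_gt0 : 0 < N1. Proof. exact: N1_gt0. Qed.
Let u_gt0 e : 0 < u e. Proof. exact: absgrad_gt0. Qed.

Lemma norm_jflow_gt0 e : 0 < `|jf e|.
Proof. by rewrite -(pmulr_rgt0 _ M_gt0) norm_jflow// powR_gt0. Qed.

(** The ratio of truncation heights at successive depths; [tau_scale] is the balance between height
    and energy that determines it. *)
Definition tau : R := (M / N1) `^ p^-1.

Lemma tau_gt0 : 0 < tau. Proof. by rewrite powR_gt0// divr_gt0. Qed.

Lemma tau_lt1 : tau < 1.
Proof.
have h : M / N1 < 1 by rewrite ltr_pdivrMr// mul1r; exact: Mconst_lt.
rewrite /tau -[X in _ < X](_ : 1 `^ p^-1 = 1); last by rewrite powR1.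
by rewrite gt0_ltr_powR ?invr_gt0// ?nnegrE// ltW// divr_gt0.
Qed.

Lemma tau_pow : tau `^ p = M / N1.
Proof. by rewrite /tau -powRrM mulVf ?gt_eqF// powRr1// ltW// divr_gt0. Qed.

Lemma tau_scale j : (tau ^+ j) `^ (1 - p) * (M / N1) ^+ j = tau ^+ j.
Proof.
have t0 := tau_gt0; have tj : 0 < tau ^+ j by rewrite exprn_gt0.
rewrite -tau_pow -(powR_mulrn j (powR_ge0 tau p)) powRAC (powR_mulrn j (ltW t0)).
rewrite -powRD; last by rewrite subrK oner_eq0.
by rewrite subrK powRr1// ltW.
Qed.

Lemma geometric_le k : \sum_(j < k) tau ^+ j <= (1 - tau)^-1.
Proof.
have t1 : 0 < 1 - tau by rewrite subr_gt0 tau_lt1.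
rewrite -(ler_pM2l t1) divff ?gt_eqF//.
rewrite -[leLHS]opprK -mulNr opprB -subrX1 opprB.
by rewrite lerBlDr lerDl exprn_ge0// ltW// tau_gt0.
Qed.

Definition poincare_cst : R := #|V1|%:R * ((N1 + M) / (1 - tau)).

Lemma poincare_cst_ge0 : 0 <= poincare_cst.
Proof.
rewrite mulr_ge0 ?ler0n// divr_ge0 ?subr_ge0 ?(ltW tau_lt1)//.
by rewrite addr_ge0// ltW.
Qed.

Definition theta : R := \big[Num.max/0]_a (M * w a).

Lemma theta_ge a : M * w a <= theta. Proof. exact: le_bigmax. Qed.

Lemma theta_ge0 : 0 <= theta.
Proof. by apply: le_trans (theta_ge (idx0 S)); rewrite mulr_ge0// ltW. Qed.

Lemma theta_lt1 : theta < 1.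
Proof. by apply: bigmax_lt => // a _; exact: Mconst_Jdens_lt1. Qed.

(** The [m]-fold mean of [H], weighted by the flow, over the cells below [e] that the fiber of [v]
    passes through. It uses cell data only, hence is stable under L^1 convergence, and depends on
    [p] only through the flow. *)
Fixpoint flow_mean (H : forall n, E n -> R) m n (v : V n) (e : E n) : R :=
  if m is m'.+1 then
    \sum_a w a * flow_mean H m' (vdot v a) ((e, step_edge v e a) : E n.+1)
  else H n e.

Lemma flow_meanB (H H' : forall n, E n -> R) m n (v : V n) (e : E n) :
  flow_mean (fun n e => H n e - H' n e) m v e = flow_mean H m v e - flow_mean H' m v e.
Proof.
elim: m n v e => [//|m IH] n v e /=; rewrite -sumrB; apply: eq_bigr => a _.
by rewrite IH mulrBr.
Qed.

(** A cell of generation [k] has mean at most [N1 ^ k] times the mean over the whole space. So large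
    a factor does no harm, since [m] and [n] are fixed when the bound is applied. *)
Lemma flow_mean_le (H A : forall n, E n -> R) m n (v : V n) (e : E n) :
  (forall n (e : E n), `|H n e| <= A n e) ->
  (forall n (e : E n), A n e = N1^-1 * \sum_f A n.+1 ((e, f) : E n.+1)) ->
  `|flow_mean H m v e| <= N1 ^+ (m + n) * A 0%N (tt : E 0).
Proof.
move=> HA HS; have A0 k (e' : E k) : 0 <= A k e' by apply: le_trans (HA k e').
have Achild k (e' : E k) f : A k.+1 ((e', f) : E k.+1) <= N1 * A k e'.
  rewrite [A k e']HS mulVKf ?gt_eqF// (bigD1 f)//= lerDl.
  by apply: sumr_ge0 => i _; exact: A0.
have Aroot k (e' : E k) : A k e' <= N1 ^+ k * A 0%N (tt : E 0).
  elim: k e' => [[]|k IH [e' f]]; first by rewrite expr0 mul1r.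
  by rewrite exprS -mulrA (le_trans (Achild _ _ _))// ler_pM2l.
suff : `|flow_mean H m v e| <= N1 ^+ m * A n e.
  move/le_trans; apply; rewrite exprD -mulrA ler_wpM2l ?Aroot//.
elim: m n v e => [|m IH] n v e /=; first by rewrite expr0 mul1r.
rewrite (le_trans (ler_norm_sum _ _ _))//.
apply: (@le_trans _ _ (\sum_a w a * (N1 ^+ m.+1 * A n e))); last by rewrite -mulr_suml w_sum mul1r.
apply: ler_sum => a _; rewrite normrM ger0_norm// ler_wpM2l//.
apply: le_trans (IH _ _ _) _; rewrite exprSr -mulrA ler_wpM2l ?Achild//.
Qed.

Fixpoint wflow n : E n -> R :=
  if n is n'.+1 return E n -> R then fun e => wflow e.1 * `|jf e.2| else fun=> 1.

Fixpoint wgrad n : E n -> R :=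
  if n is n'.+1 return E n -> R then fun e => wgrad e.1 * u e.2 else fun=> 1.

Lemma wgrad_gt0 n (e : E n) : 0 < wgrad e.
Proof. by elim: n e => [//|n IH] e /=; rewrite mulr_gt0. Qed.

Lemma wflow_gt0 n (e : E n) : 0 < wflow e.
Proof. by elim: n e => [//|n IH] e /=; rewrite mulr_gt0// norm_jflow_gt0. Qed.

Lemma wflow_wgrad n (e : E n) : M ^+ n * wflow e = wgrad e `^ (p - 1).
Proof.
elim: n e => [|n IH] e /=; first by rewrite expr0 mul1r powR1.
rewrite powRM ?(ltW (wgrad_gt0 _)) ?(ltW (u_gt0 _))// -IH -norm_jflow// exprS; ring.
Qed.

(** [ler_truncate] for the ratio [d / wgrad e], multiplied by [wflow e * wgrad e]; [wflow_wgrad]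
    turns the remaining power of [wgrad e] into [M ^- n]. *)
Lemma wflow_truncate n (e : E n) (d T : R) : 0 <= d -> 0 < T ->
  wflow e * d <= T * (wflow e * wgrad e) + T `^ (1 - p) * (M ^- n * d `^ p).
Proof.
move=> d0 T0; have g0 := wgrad_gt0 e; have f0 := wflow_gt0 e.
have x0 : 0 <= d / wgrad e by rewrite divr_ge0// ltW.
have h := ler_truncate p1 x0 T0; rewrite -(ler_pM2l (mulr_gt0 f0 g0)) in h.
have dE : (wflow e * wgrad e) * (d / wgrad e) = wflow e * d.
  by field; rewrite gt_eqF.
have pE : wflow e * wgrad e * (d / wgrad e) `^ p = M ^- n * d `^ p.
  have -> : wflow e * wgrad e = M ^- n * wgrad e `^ p.
    rewrite -(mulr_powRB1 (ltW g0) p_gt0) -wflow_wgrad.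
    by field; rewrite expf_neq0// gt_eqF.
  by rewrite -mulrA -powRM ?(ltW g0)// mulrCA mulfV ?gt_eqF// mulr1.
rewrite dE in h; apply: le_trans h _.
by rewrite mulrDr [X in _ + X]mulrCA pE [X in X + _]mulrC.
Qed.

(** * Energy estimates for vertex functions that are averaged along fibers *)

Section VertexFunction.
Variable Y : forall n, V n -> R.
Hypothesis HY : forall n (v : V n), Y v = \sum_a w a * Y (vdot v a).

Definition Dif n (e : E n) : R := Y (end1 e) - Y (end2 e).

Lemma Dif_step n (e : E n) : Dif e = \sum_f jf f * Dif ((e, f) : E n.+1).
Proof.
rewrite /Dif /=; rewrite (jflow_green p1 Unz (fun z => @Y n.+1 (cls z e)) CU).
rewrite (HY (end1 e)) (HY (end2 e)) -sumrB; apply: eq_bigr => a _.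
by rewrite vdot_end1 vdot_end2 mulrBr.
Qed.

Lemma norm_Dif_step n (e : E n) : `|Dif e| <= \sum_f `|jf f| * `|Dif ((e, f) : E n.+1)|.
Proof.
rewrite Dif_step (le_trans (ler_norm_sum _ _ _))//.
by apply: ler_sum => f _; rewrite normrM.
Qed.

Definition Dpow n (e : E n) : R := `|Dif e| `^ p.

Lemma Dpow_ge0 n (e : E n) : 0 <= Dpow e. Proof. exact: powR_ge0. Qed.

(** Jensen's inequality for the probability weights [|jf f| * u f] at the ratios [d f / u f]; the
    relation between flow and gradient restores the powers of [d f]. Monotonicity of the energies
    follows from it. *)
Lemma Dpow_step n (e : E n) : M * Dpow e <= \sum_f Dpow ((e, f) : E n.+1).
Proof.
rewrite /Dpow; set d := fun f => `|Dif ((e, f) : E n.+1)|.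
have key f : M * ((`|jf f| * u f) * (d f / u f) `^ p) = d f `^ p.
  rewrite !mulrA norm_jflow// [X in X * _ = _]mulrC mulr_powRB1 ?normr_ge0//.
  rewrite -powRM ?normr_ge0 ?divr_ge0 ?normr_ge0//.
  by rewrite mulrC divfK// gt_eqF.
rewrite -(eq_bigr _ (fun f _ => key f)) -mulr_sumr ler_wpM2l ?(ltW M_gt0)//.
apply: le_trans (powR_jensen p1 _ _ _); last 3 first.
- by move=> f; rewrite mulr_ge0 ?(ltW (u_gt0 f)).
- by move=> f; rewrite divr_ge0 ?(ltW (u_gt0 f))// /d normr_ge0.
- exact: sum_jflow_absgrad.
rewrite ge0_ler_powR ?nnegrE ?(ltW p_gt0)//.
  by apply: sumr_ge0 => f _; rewrite mulr_ge0 ?divr_ge0 ?mulr_ge0 ?(ltW (u_gt0 f))// normr_ge0.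
apply: le_trans (norm_Dif_step e) _; apply: ler_sum => f _.
by rewrite -mulrA (mulrC (u f)) divfK// gt_eqF.
Qed.

Definition lE k n (e : E n) : R := M ^- k * ssum Dpow k e.

Lemma lE_ge0 k n (e : E n) : 0 <= lE k e.
Proof.
by rewrite mulr_ge0 ?invr_ge0 ?exprn_ge0 ?(ltW M_gt0)//; apply: ssum_ge0; exact: Dpow_ge0.
Qed.

Lemma lES k n (e : E n) : M * lE k.+1 e = \sum_f lE k ((e, f) : E n.+1).
Proof.
by rewrite /lE exprS invfM -!mulrA mulVKf ?gt_eqF//= mulr_sumr.
Qed.

Lemma lE_nd k n (e : E n) : lE k e <= lE k.+1 e.
Proof.
rewrite -(ler_pM2l M_gt0) lES; elim: k n e => [|k IH] n e.
  rewrite /lE expr0 invr1 mul1r (le_trans (Dpow_step e))//.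
  by apply: ler_sum => f _; rewrite mul1r.
by rewrite lES; apply: ler_sum => f _; rewrite -(ler_pM2l M_gt0) lES; exact: IH.
Qed.

Definition lE_bounded := exists K, forall k, lE k (tt : E 0) <= K.

Lemma lE_child k n (e : E n) f : lE k ((e, f) : E n.+1) <= M * lE k.+1 e.
Proof.
by rewrite lES (bigD1 f)//= lerDl sumr_ge0// => i _; exact: lE_ge0.
Qed.

Lemma lE_le k n (e : E n) K : (forall k, lE k (tt : E 0) <= K) -> lE k e <= M ^+ n * K.
Proof.
move=> HK; elim: n k e => [|n IH] k; first by case; rewrite expr0 mul1r.
case=> e f; rewrite exprS -mulrA (le_trans (lE_child _ _ _))//.
by rewrite ler_pM2l.
Qed.

Definition EE n (e : E n) : R := limn (fun k => lE k e).

Lemma lE_cvg n (e : E n) : lE_bounded -> cvgn (fun k => lE k e).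
Proof.
move=> [K HK]; apply: nondecreasing_is_cvgn.
  by apply/nondecreasing_seqP => k; exact: lE_nd.
by exists (M ^+ n * K) => _ [k _ <-]; exact: lE_le.
Qed.

Lemma lE_EE k n (e : E n) : lE_bounded -> lE k e <= EE e.
Proof.
move=> B; apply: (@nondecreasing_cvgn_le _ (fun k => lE k e)); last exact: lE_cvg.
by apply/nondecreasing_seqP => j; exact: lE_nd.
Qed.

Lemma EE_ge0 n (e : E n) : lE_bounded -> 0 <= EE e.
Proof. by move=> B; apply: le_trans (lE_EE 0 e B); exact: lE_ge0. Qed.

Lemma sum_EE n (e : E n) : lE_bounded -> \sum_f EE ((e, f) : E n.+1) <= M * EE e.
Proof.
move=> B.
have h : (fun k => \sum_f lE k ((e, f) : E n.+1)) @ \oo --> \sum_f EE ((e, f) : E n.+1).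
  apply: cvg_big => [|f _]; first exact: add_continuous.
  exact: lE_cvg.
apply: (cvgr_to_le h); near=> k.
by rewrite -lES ler_pM2l// lE_EE.
Unshelve. all: by end_near. Qed.

Lemma absDif_le n (e : E n) (T : R) : 0 < T -> `|Dif e| <= T + T `^ (1 - p) * Dpow e.
Proof. by move=> T0; apply: ler_truncate. Qed.

(** A walk in the generator without repeated vertices has at most [#|V1|] edges, and each
    contributes at most the whole sum. *)
Lemma cell_difference n (e : E n) z z' :
  `|@Y n.+1 (cls z e) - @Y n.+1 (cls z' e)| <= #|V1|%:R * \sum_f `|Dif ((e, f) : E n.+1)|.
Proof.
set sD := \sum_f _; have sD0 : 0 <= sD by apply: sumr_ge0.
have [//|//|s [zs <- _]] := @gen_connected S z z'.
have [s' zs' us' _] := shortenP zs.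
have : (size s' <= #|V1|)%N by rewrite -(card_uniqP (proj2 (andP us'))) max_card.
rewrite -(ler_nat R) => /(ler_wpM2r sD0); apply: le_trans.
elim: s' z zs' {us' zs} => [|y s' IH] z /=; first by rewrite subrr normr0 mul0r.
move=> /andP[zy ys']; rewrite -natr1 mulrDl mul1r [leRHS]addrC.
apply: le_trans (ler_distD (@Y n.+1 (cls y e)) _ _) (lerD _ (IH _ ys')).
have /(adjP _ _ (@gen_ll S))[f zyf] := zy.
rewrite /sD (bigD1 f)//= (_ : `|Y _ - _| = `|Dif ((e, f) : E n.+1)|) ?lerDl ?sumr_ge0//.
rewrite /Dif /=; have [[-> ->]|[-> ->]] := eplus_eminus f; case: zyf => -[-> ->] //; exact: distrC.
Qed.

Lemma vertex_difference n (e : E n) v z : v \in ends e ->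
  `|Y v - @Y n.+1 (cls z e)| <= #|V1|%:R * ssum (fun n e => `|@Dif n e|) 1 e.
Proof.
move=> ve; set C := _ * ssum _ _ _.
rewrite HY -[@Y n.+1 (cls z e)]mul1r -w_sum mulr_suml -sumrB.
rewrite (le_trans (ler_norm_sum _ _ _))//.
apply: (@le_trans _ _ (\sum_a w a * C)); last by rewrite -mulr_suml w_sum mul1r.
apply: ler_sum => a _; rewrite -mulrBr normrM ger0_norm// ler_wpM2l//.
by rewrite (vdotE _ ve); exact: cell_difference.
Qed.

Local Notation absD := (fun n (e : E n) => `|Dif e|).

Section MeanFunction.
(** [H] stands for the cell means of [phi] applied to the function. The map [phi] will be the
    identity for the comparison of averages and the distance to a constant for L^1 bounds. *)
Variables (H : forall n, E n -> R) (phi : R -> R).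
Hypothesis phi_lip : forall x y, `|phi x - phi y| <= `|x - y|.
Hypothesis Hstep : forall n (e : E n), H e = N1^-1 * \sum_f H ((e, f) : E n.+1).
Hypothesis Happ : forall eps, 0 < eps -> exists N, forall n, (N <= n)%N ->
  forall (e : E n) v, v \in ends e -> `|H e - phi (Y v)| <= eps.

(** Averaging over the children passes one level down at the price of one [vertex_difference]; at
    sufficiently deep levels the approximation hypothesis leaves [eps]. *)
Lemma mean_telescope (eps : R) : 0 < eps -> exists N, forall k n (e : E n) v,
  (N <= k + n)%N -> v \in ends e ->
  `|H e - phi (Y v)| <= #|V1|%:R * (\sum_(j < k) N1 ^- j * ssum absD j.+1 e) + eps.
Proof.
move=> /Happ[N HN]; exists N.
elim=> [|k IH] n e v.
  by rewrite add0n big_ord0 mulr0 add0r => Nn ve; exact: HN.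
rewrite addSnnS => Nk ve; set sA := \sum_(j < k.+1) _.
have Hh h : `|H ((e, h) : E n.+1) - phi (Y v)| <=
    #|V1|%:R * (\sum_(j < k) N1 ^- j * ssum absD j.+1 ((e, h) : E n.+1)) + eps +
    #|V1|%:R * ssum absD 1 e.
  apply: le_trans (ler_distD (phi (Y (end1 ((e, h) : E n.+1)))) _ _) (lerD (IH _ _ _ Nk (mem_end1 _)) _).
  apply: le_trans (phi_lip _ _) _; rewrite distrC.
  exact: vertex_difference.
have -> : H e - phi (Y v) = N1^-1 * \sum_h (H ((e, h) : E n.+1) - phi (Y v)).
  by rewrite sumrB sumr_const -[X in _ * (_ - X)]mulr_natl mulrBr mulKf ?gt_eqF// -Hstep.
rewrite normrM ger0_norm ?invr_ge0 ?(ltW N_gt0)//.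
rewrite ler_pdivrMl//; apply: le_trans (ler_norm_sum _ _ _) _.
apply: le_trans (ler_sum _ (fun h _ => Hh h)) _.
have sc (x : R) : \sum_(h : E1) x = N1 * x by rewrite sumr_const mulr_natl.
rewrite !big_split/= !sc -mulr_sumr.
rewrite /sA big_ord_recl expr0 invr1 mul1r exchange_big/=.
rewrite (_ : \sum_(j < k) \sum_(h : E1) _ = N1 * \sum_(j < k) N1 ^- (bump 0 j) * ssum absD (bump 0 j).+1 e).
  by rewrite le_eqVlt; apply/orP; left; apply/eqP; ring.
rewrite mulr_sumr; apply: eq_bigr => j _; rewrite -mulr_sumr /bump leq0n add1n.
by rewrite exprS invfM mulrA mulrA mulfV ?gt_eqF// mul1r.
Qed.

(** Truncated at height [kap * tau ^ j], the depth-[j] term of the telescope is at most [tau ^ j]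
    times a fixed quantity, and the geometric series is summable. The free parameter [kap] trades
    height against energy. *)
Lemma poincare n (e : E n) v K kap : v \in ends e -> 0 < kap ->
  (forall k, lE k e <= K) ->
  `|H e - phi (Y v)| <= poincare_cst * (kap + kap `^ (1 - p) * K).
Proof.
move=> ve k0 HK; have K0 : 0 <= K by apply: le_trans (HK 0%N); exact: lE_ge0.
apply/ler_addgt0Pr => eps e0; have [N HN] := mean_telescope e0.
apply: le_trans (HN N n e v (leq_addr _ _) ve) _; rewrite lerD2r /poincare_cst -mulrA.
rewrite ler_wpM2l ?ler0n//.
set c := N1 * kap + kap `^ (1 - p) * (M * K).
have c0 : 0 <= c.
  by rewrite addr_ge0// mulr_ge0 ?powR_ge0 ?(ltW k0) ?(ltW N_gt0)// mulr_ge0// ltW.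
apply: (@le_trans _ _ (\sum_(j < N) tau ^+ j * c)).
  apply: ler_sum => j _; set T := kap * tau ^+ j.
  have tj : 0 < tau ^+ j by rewrite exprn_gt0// tau_gt0.
  have T0 : 0 < T by rewrite mulr_gt0.
  rewrite ler_pdivrMl ?exprn_gt0//.
  apply: le_trans (ssum_le j.+1 e (fun n e => @absDif_le n e T T0)) _.
  rewrite ssum_affine.
  have -> : ssum (@Dpow) j.+1 e = M ^+ j.+1 * lE j.+1 e.
    by rewrite /lE mulVKf// expf_neq0// gt_eqF.
  apply: (@le_trans _ _ (N1 ^+ j.+1 * T + T `^ (1 - p) * (M ^+ j.+1 * K))).
    by rewrite lerD2l ler_wpM2l ?powR_ge0// ler_wpM2l ?exprn_ge0 ?(ltW M_gt0).
  have TE : T `^ (1 - p) * M ^+ j = kap `^ (1 - p) * (N1 ^+ j * tau ^+ j).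
    rewrite /T powRM ?(ltW k0) ?(ltW tj)// -[in RHS]tau_scale exprMn exprVn.
    by field; rewrite expf_neq0// gt_eqF.
  rewrite exprS [M ^+ j.+1]exprS (_ : T `^ _ * _ = (T `^ (1 - p) * M ^+ j) * (M * K)); last by ring.
  rewrite TE /T /c le_eqVlt; apply/orP; left; apply/eqP; ring.
rewrite -mulr_suml [leRHS]mulrAC mulrC; apply: ler_pM => //.
- by apply: sumr_ge0 => j _; rewrite exprn_ge0// ltW// tau_gt0.
- have := mulr_ge0 (ltW M_gt0) (ltW k0); have := mulr_ge0 (ltW N_gt0) (mulr_ge0 (powR_ge0 kap (1 - p)) K0).
  by rewrite /c; lra.
- exact: geometric_le.
Qed.

End MeanFunction.

(** [poincare] is applied in the cells reached after [m] steps along the fiber. Each step multiplies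
    the weighted energy by at most [theta]: one has [M * w a <= theta], and the energies of all
    children add up to at most [M] times that of [e]. *)
Lemma poincare_flow (H : forall n, E n -> R) m n (v : V n) (e : E n) kap :
  (forall n (e : E n), H n e = N1^-1 * \sum_f H n.+1 ((e, f) : E n.+1)) ->
  (forall eps, 0 < eps -> exists N, forall n, (N <= n)%N ->
    forall (e : E n) v, v \in ends e -> `|H n e - Y v| <= eps) ->
  lE_bounded -> v \in ends e -> 0 < kap ->
  `|Y v - flow_mean H m v e| <= poincare_cst * (kap + kap `^ (1 - p) * (theta ^+ m * EE e)).
Proof.
move=> HS HA B ve k0; elim: m n v e ve => [|m IH] n v e ve /=.
  rewrite distrC expr0 mul1r; apply: (@poincare H id) => // k; exact: lE_EE.
rewrite HY -sumrB (le_trans (ler_norm_sum _ _ _))//.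
set Ea := fun a => EE ((e, step_edge v e a) : E n.+1).
set c := poincare_cst; set q := kap `^ (1 - p).
apply: (@le_trans _ _ (\sum_a w a * (c * (kap + q * (theta ^+ m * Ea a))))).
  apply: ler_sum => a _; rewrite -mulrBr normrM ger0_norm// ler_wpM2l//.
  by apply: IH; exact: vdot_step.
have sE : \sum_a w a * Ea a <= theta * EE e.
  rewrite -(ler_pM2l M_gt0) mulr_sumr.
  apply: (@le_trans _ _ (\sum_a theta * Ea a)).
    apply: ler_sum => a _; rewrite mulrA ler_wpM2r ?theta_ge//; exact: EE_ge0.
  rewrite -mulr_sumr mulrCA ler_wpM2l ?theta_ge0//.
  apply: le_trans (sum_EE e B).
  rewrite [leRHS](bigID (mem [set step_edge v e a | a in [set: idx S]]%SET))/=.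
  rewrite big_imset/=; last by move=> a b _ _; exact: step_edge_inj.
  have -> : \sum_(a in [set: idx S]%SET) EE ((e, step_edge v e a) : E n.+1) = \sum_a Ea a.
    by apply: eq_bigl => a; rewrite inE.
  by rewrite lerDl sumr_ge0// => f _; exact: EE_ge0.
rewrite (eq_bigr (fun a => c * kap * w a + c * q * theta ^+ m * (w a * Ea a))); last by move=> a _; ring.
rewrite big_split/= -!mulr_sumr w_sum mulr1 mulrDr lerD2l exprSr.
apply: (@le_trans _ _ (c * q * theta ^+ m * (theta * EE e))).
  have c0 : 0 <= c := poincare_cst_ge0; have q0 : 0 <= q := powR_ge0 _ _.
  have t0 : 0 <= theta ^+ m by rewrite exprn_ge0// theta_ge0.
  by rewrite ler_wpM2l// mulr_ge0// mulr_ge0.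
by rewrite le_eqVlt; apply/orP; left; apply/eqP; ring.
Qed.

Lemma flow_sum_nd n m : (n <= m)%N ->
  \sum_(e : E n) wflow e * `|Dif e| <= \sum_(e : E m) wflow e * `|Dif e|.
Proof.
move=> /subnK <-; elim: (m - n)%N => [//|k IH]; rewrite addSn; apply: (le_trans IH).
move: (k + n)%N => l.
rewrite -(pair_big predT predT (fun (e : E l) f => wflow ((e, f) : E l.+1) * `|Dif ((e, f) : E l.+1)|))/=.
apply: ler_sum => e _; rewrite -(eq_bigr _ (fun f _ => mulrA _ _ _)) -mulr_sumr.
by rewrite ler_wpM2l ?(ltW (wflow_gt0 e))//; exact: norm_Dif_step.
Qed.

End VertexFunction.
End OneExponent.

(** * Energies of continuous functions *)

Section EnergyOfFunctions.
Context (R : realType) (S : ndd_igs) (p : R).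
Hypothesis p1 : 1 < p.
Hypothesis CU : conductively_uniform R S.
Local Notation X := (limit_space S R).
Local Notation V n := (vertex (rgraph S n)).
Local Notation E n := (edge (rgraph S n)).
Local Notation M := (Mconst S p).
Hypothesis Unz : forall e : edge (gen S), absgrad (@Uopt R S p) e != 0.

Let p_gt0 : 0 < p. Proof. by have := p1; lra. Qed.
Let M_gt0 : 0 < M. Proof. exact: Mconst_gt0. Qed.
Let w_ge0 a : 0 <= @Jdens R S p a. Proof. exact/ltW/Jdens_gt0. Qed.
Let w_sum : \sum_a @Jdens R S p a = 1. Proof. exact: sum_Jdens. Qed.

Definition avgs (f : X -> R) n (v : V n) : R := Vavg p f v.

Lemma avgs_step (f : X -> R) : continuous f -> forall n (v : V n),
  avgs f v = \sum_a Jdens p a * avgs f (vdot v a).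
Proof. by move=> cf n v; exact: Vavg_vdot. Qed.

Lemma lE_sum (Y : forall n, V n -> R) k :
  lE p Y k (tt : E 0) = M ^- k * \sum_(e : E k) Dpow p Y e.
Proof. by rewrite /lE ssum_root. Qed.

Lemma lE_avgs (f : X -> R) k :
  lE p (avgs f) k (tt : E 0) = M ^- k * energy p (@Vavg R S p f k).
Proof.
rewrite lE_sum /energy; apply: (congr1 ( *%R _)); apply: eq_bigr => e _.
by rewrite /Dpow /Dif /absgrad distrC.
Qed.

Lemma EpC_lE (f : X -> R) :
  EpC R S p f = limn (fun k => (lE p (avgs f) k (tt : E 0))%:E).
Proof. by rewrite /EpC; congr (limn _); apply/funext => k; rewrite lE_avgs. Qed.

Lemma lE_avgs_cvg (f : X -> R) : continuous f ->
  cvgn (fun k => (lE p (avgs f) k (tt : E 0))%:E).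
Proof.
move=> cf; apply: ereal_nondecreasing_is_cvgn.
by apply/nondecreasing_seqP => k; rewrite lee_fin; exact: (lE_nd p1 CU Unz (avgs_step cf)).
Qed.

Lemma EpC_ge (f : X -> R) k : continuous f ->
  ((lE p (avgs f) k (tt : E 0))%:E <= EpC R S p f)%E.
Proof.
move=> cf; rewrite EpC_lE; apply: lime_ge; first exact: lE_avgs_cvg.
exists k => // n /= kn; rewrite lee_fin.
have nd : nondecreasing_seq (fun k => lE p (avgs f) k (tt : E 0)).
  by apply/nondecreasing_seqP => j; exact: (lE_nd p1 CU Unz (avgs_step cf)).
exact: nd.
Qed.

Lemma EpC_le (f : X -> R) K : continuous f ->
  (forall k, lE p (avgs f) k (tt : E 0) <= K) -> (EpC R S p f <= K%:E)%E.
Proof.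
move=> cf HK; rewrite EpC_lE; apply: lime_le; first exact: lE_avgs_cvg.
by near=> n; rewrite lee_fin.
Unshelve. all: by end_near. Qed.

Lemma DifB (Y Y' Z : forall n, V n -> R) n (e : E n) :
  (forall v, Z n v = Y n v - Y' n v) -> Dif Z e = Dif Y e - Dif Y' e.
Proof. by move=> h; rewrite /Dif !h; ring. Qed.

Lemma Dif_avgsB (f g : X -> R) n (e : E n) : continuous f -> continuous g ->
  Dif (avgs (f \- g)) e = Dif (avgs f) e - Dif (avgs g) e.
Proof. by move=> cf cg; apply: DifB => v; exact: VavgB. Qed.

Lemma lE_avgs_le (f g : X -> R) k : continuous f -> continuous g ->
  lE p (avgs f) k (tt : E 0) <=
    2 `^ p * (lE p (avgs (f \- g)) k (tt : E 0) + lE p (avgs g) k (tt : E 0)).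
Proof.
move=> cf cg; rewrite !lE_sum -mulrDr mulrCA ler_wpM2l ?invr_ge0 ?exprn_ge0 ?(ltW M_gt0)//.
rewrite -big_split/= mulr_sumr; apply: ler_sum => e _.
rewrite /Dpow -[Dif (avgs f) e](subrK (Dif (avgs g) e)) -Dif_avgsB//.
exact: powRD_le.
Qed.

Lemma lE_avgs_cvg0 (u : nat -> X -> R) k :
  (forall e : E k, (fun i => Dif (avgs (u i)) e) @ \oo --> 0) ->
  (fun i => lE p (avgs (u i)) k (tt : E 0)) @ \oo --> 0.
Proof.
move=> H.
have -> : (fun i => lE p (avgs (u i)) k (tt : E 0)) =
    (fun i => M ^- k * \sum_(e : E k) Dpow p (avgs (u i)) e).
  by apply/funext => i; rewrite lE_sum.
rewrite -[X in _ --> X](mulr0 (M ^- k)); apply: cvgMr.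
suff : (fun i => \sum_(e : E k) Dpow p (avgs (u i)) e) @ \oo --> \sum_(e : E k) (0 : R) by rewrite big1.
apply: cvg_big => [|e _]; first exact: add_continuous.
apply/cvgrPdist_le => eps e0; have d0 : 0 < eps `^ p^-1 by rewrite powR_gt0.
have /cvgrPdist_le/(_ _ d0) := H e; apply: filterS => i; rewrite !sub0r !normrN => h.
rewrite ger0_norm ?powR_ge0//.
have -> : eps = (eps `^ p^-1) `^ p by rewrite -powRrM mulVf ?gt_eqF// powRr1// ltW.
by rewrite ge0_ler_powR ?nnegrE ?(ltW p_gt0)// ltW.
Qed.

Lemma EpC_cst (c : R) : EpC R S p (fun=> c) = 0%E.
Proof.
rewrite EpC_lE (_ : (fun k => _) = fun=> 0%E) ?lim_cst//; apply/funext => k.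
rewrite lE_sum big1 ?mulr0// => e _; rewrite /Dpow /Dif.
have h v : @avgs (fun=> c) k v = c by exact: Vavg_cst.
by rewrite !h subrr normr0 powR0// gt_eqF.
Qed.

End EnergyOfFunctions.

(** * L^1 estimates for probability measures *)

Section TotalMassOne.
Context (R : realType) d (T : measurableType d) (mu : {measure set T -> \bar R}).
Hypothesis mu1 : mu setT = 1%E.
Implicit Types (f g : T -> R).

Lemma integral_cst1 (c : R) : (\int[mu]_x c%:E = c%:E)%E.
Proof. by rewrite integral_cst// mu1 mule1. Qed.

Lemma integral_norm_triangle f g : measurable_fun setT f -> measurable_fun setT g ->
  (\int[mu]_x `|f x + g x|%:E <= \int[mu]_x `|f x|%:E + \int[mu]_x `|g x|%:E)%E.
Proof.
move=> mf mg; rewrite -ge0_integralD//.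
- apply: ge0_le_integral => //.
  + apply/measurable_EFinP; apply: measurableT_comp => //; exact: measurable_funD.
  + by apply: emeasurable_funD; apply/measurable_EFinP; exact: measurableT_comp.
  + by move=> x _; rewrite -EFinD lee_fin ler_normD.
- by apply/measurable_EFinP; exact: measurableT_comp.
- by apply/measurable_EFinP; exact: measurableT_comp.
Qed.

Lemma measurable_powR_norm f p : measurable_fun setT f ->
  measurable_fun setT (fun x => (`|f x| `^ p)%:E).
Proof.
move=> mf; apply/measurable_EFinP.
by apply: (measurableT_comp (measurable_powR p)); exact: measurableT_comp.
Qed.

Lemma integral_truncate f p t : 1 < p -> 0 < t -> measurable_fun setT f ->
  (\int[mu]_x `|f x|%:E <= t%:E + (t `^ (1 - p))%:E * \int[mu]_x (`|f x| `^ p)%:E)%E.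
Proof.
move=> p1 t0 mf; rewrite -ge0_integralZl_EFin ?powR_ge0//; last exact: measurable_powR_norm.
rewrite -[X in (X + _)%E]integral_cst1 -ge0_integralD//.
- apply: ge0_le_integral => //.
  + by apply/measurable_EFinP; exact: measurableT_comp.
  + apply: emeasurable_funD => //; apply: emeasurable_funM => //; exact: measurable_powR_norm.
  + by move=> x _; rewrite -EFinM -EFinD lee_fin ler_truncate.
- by move=> x _; rewrite lee_fin ltW.
- by move=> x _; rewrite -EFinM lee_fin mulr_ge0 ?powR_ge0.
- apply: emeasurable_funM => //; exact: measurable_powR_norm.
Qed.

Lemma integral_norm_cvg0 (f : nat -> T -> R) p : 1 < p -> (forall i, measurable_fun setT (f i)) ->
  (fun i => \int[mu]_x (`|f i x| `^ p)%:E)%E @ \oo --> 0%E ->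
  forall eps, 0 < eps -> exists N, forall i, (N <= i)%N ->
    (\int[mu]_x `|f i x|%:E <= eps%:E)%E.
Proof.
move=> p1 mf f0 eps e0; pose t := eps / 2; have t0 : 0 < t by rewrite divr_gt0.
pose q := t `^ (1 - p); have q0 : 0 < q by rewrite powR_gt0.
have : \forall i \near \oo, (\int[mu]_x (`|f i x| `^ p)%:E < (t / q)%:E)%E.
  have h : nbhs (0%E : \bar R) [set y | (y < (t / q)%:E)%E].
    by apply: open_nbhs_nbhs; split; [exact: open_ereal_lt_ereal|rewrite /= lte_fin divr_gt0].
  exact: (f0 _ h).
move=> [N _ HN]; exists N => i /HN/ltW Ni; apply: le_trans (integral_truncate p1 t0 (mf i)) _.
have -> : eps = t + q * (t / q) by rewrite mulrCA mulfV ?gt_eqF// mulr1 -splitr.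
by rewrite EFinD; apply: leeD => //; rewrite EFinM lee_wpmul2l// lee_fin ltW.
Qed.

(** The constant is the mean [m] of [f]: since [|m - c|] is at most the L^1 distance of [f] from
    [c], the mean approximates as well as any [c] up to a factor 2. *)
Lemma ae_cst_of_integral f : measurable_fun setT f ->
  (forall eps, 0 < eps -> exists c, (\int[mu]_x `|f x - c|%:E <= eps%:E)%E) ->
  exists c, (\int[mu]_x `|f x - c|%:E = 0)%E.
Proof.
move=> mf H.
have mfc c : measurable_fun setT (fun x => f x - c) by exact: measurable_funB.
have ifc : mu.-integrable setT (EFin \o f).
  have [c Hc] := H 1 ltr01; apply/integrableP; split; first exact/measurable_EFinP.
  have := integral_norm_triangle (mfc c) (measurable_cst c).
  under eq_integral do rewrite subrK.
  rewrite [X in (_ <= _ + X)%E](integral_cst1 `|c|) => h; apply: le_lt_trans h _.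
  by apply: (@le_lt_trans _ _ (1 + `|c|)%:E); [rewrite EFinD leeD|exact: ltry].
pose m := fine (\int[mu]_x (f x)%:E); exists m.
have mE : (\int[mu]_x (f x)%:E = m%:E)%E.
  by rewrite fineK//; exact: integrable_fin_num.
apply/eqP; rewrite eq_le integral_ge0 ?andbT; last by move=> x _; rewrite lee_fin.
apply/lee_addgt0Pr => eps e0; rewrite add0e; have e2 : 0 < eps / 2 by rewrite divr_gt0.
have [c Hc] := H _ e2.
have mc : (`|m - c|%:E <= \int[mu]_x `|f x - c|%:E)%E.
  rewrite -abse_EFin EFinB -mE -[X in (_ - X)%E]integral_cst1 -integralB//.
    by apply: le_abse_integral => //; apply/measurable_EFinP.
  apply/integrableP; split; first exact/measurable_EFinP.
  by under eq_integral do rewrite abse_EFin; rewrite integral_cst1 ltry.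
apply: le_trans (_ : _ <= \int[mu]_x `|f x - c|%:E + \int[mu]_x `|c - m|%:E)%E _.
  have := integral_norm_triangle (mfc c) (measurable_cst (c - m)).
  by under eq_integral do rewrite addrA subrK.
by rewrite integral_cst1 distrC [eps]splitr EFinD leeD// (le_trans mc).
Qed.

Lemma measurable_neq f c : measurable_fun setT f -> measurable [set x | f x != c].
Proof.
move=> mf; have -> : [set x | f x != c] = setT `&` f @^-1` [set~ c].
  by rewrite setTI; apply/seteqP; split=> x /= /eqP.
by apply: mf => //; exact: measurableC.
Qed.

Lemma ae_of_integral0 f c : measurable_fun setT f -> (\int[mu]_x `|f x - c|%:E = 0)%E ->
  mu [set x | f x != c] = 0%E.
Proof.
move=> mf f0; have mfc : measurable_fun setT (fun x => (f x - c)%:E).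
  by apply/measurable_EFinP; exact: measurable_funB.
have /(ae_eq_integral_abs mu measurableT mfc)[N [mN N0 NN]] : (\int[mu]_x `|(f x - c)%:E| = 0)%E.
  by rewrite -[RHS]f0; apply: eq_integral => x _.
apply: (subset_measure0 _ mN _ N0); last first.
  move=> x /= fc; apply: NN => /=; apply/not_implyP; split => //.
  by move=> -[] /eqP; rewrite subr_eq0 (negbTE fc).
exact: measurable_neq.
Qed.

End TotalMassOne.

Section Scaling.
Context (R : realType).
Implicit Types c z eps : R.

Lemma mul_div_succ_le c eps : 0 <= c -> 0 < eps -> c * (eps / (c + 1)) <= eps.
Proof.
move=> c0 e0; have c1 : 0 < c + 1 by rewrite ltr_wpDl.
by rewrite mulrCA ler_piMr ?(ltW e0)// ler_pdivrMr// mul1r lerDl.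
Qed.

Lemma geometric_small c z eps : 0 <= c -> 0 <= z -> z < 1 -> 0 < eps ->
  exists N, forall n, (N <= n)%N -> c * z ^+ n <= eps.
Proof.
move=> c0 z0 z1 e0; have c1 : 0 < c + 1 by rewrite ltr_wpDl.
have := @cvg_geometric R 1 z; rewrite ger0_norm// => /(_ z1)/cvgrPdist_le/(_ _ (divr_gt0 e0 c1)).
move=> [N _ HN]; exists N => n /HN /=; rewrite mul1r sub0r normrN ger0_norm ?exprn_ge0// => h.
by apply: le_trans (mul_div_succ_le c0 e0); rewrite ler_wpM2l.
Qed.

End Scaling.

Section CellMeans.
Context (R : realType) (S : ndd_igs).
Local Notation X := (limit_space S R).
Local Notation E n := (edge (rgraph S n)).
Local Notation N1 := (#|edge (gen S)|%:R : R).
Local Notation P0 := (bernoulli (edge0 S) (@unif_density R S)).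
Local Notation B0 := (@unif_bernoulli R S).

Definition means (g : X -> R) n (e : E n) : R := mean g e.

(** The L^1 norm of a continuous function, written as the cell mean at the root because
    [flow_mean_le] bounds flow means by that quantity. *)
Definition nrm1 (g : X -> R) : R := means (fun x => `|g x|) (tt : E 0).

Lemma continuous_norm_comp (g : X -> R) : continuous g -> continuous (fun x => `|g x|).
Proof. by move=> cg x; exact: cvg_norm (cg x). Qed.

Lemma continuous_sub (f g : X -> R) : continuous f -> continuous g -> continuous (f \- g).
Proof. by move=> cf cg x; exact: (@continuousB _ _ _ f g x (cf x) (cg x)). Qed.

Lemma means_child (g : X -> R) n (e : E n) : continuous g ->
  means g e = N1^-1 * \sum_f means g ((e, f) : E n.+1).
Proof. by move=> cg; apply: mean_child; exact: ucont_scat. Qed.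

Lemma meansB (f g : X -> R) n (e : E n) : continuous f -> continuous g ->
  means (f \- g) e = means f e - means g e.
Proof. by move=> cf cg; rewrite /means /mean -(IgB B0)//; exact: ucont_scat. Qed.

Lemma norm_means_le (g : X -> R) n (e : E n) : continuous g ->
  `|means g e| <= means (fun x => `|g x|) e.
Proof. by move=> cg; apply: (Ig_norm B0); exact: ucont_scat. Qed.

Lemma mean_rootE (g : X -> R) : means g (tt : E 0) = Ig P0 (fun s => g (chi R s)).
Proof. by apply: (congr1 (Ig P0)); apply/funext => s; rewrite scat0. Qed.

Lemma measurable_chi_comp (f : X -> R) : measurable_fun [set: borelX R S] (f : borelX R S -> R) ->
  measurable_fun [set: mseqspace (edge0 S)] (fun s => f (chi R s)).
Proof. by move=> mf; apply: (measurableT_comp mf); exact: measurable_chi. Qed.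

Lemma nrm1E (g : X -> R) : continuous g ->
  ((nrm1 g)%:E = \int[P0]_s `|g (chi R s)|%:E)%E.
Proof.
move=> cg; rewrite /nrm1 mean_rootE (EFin_Ig B0)//.
by apply: ucont_norm; exact: ucont_chi.
Qed.

Lemma nrm1_ge0 (g : X -> R) : continuous g -> 0 <= nrm1 g.
Proof. by move=> cg; rewrite -lee_fin nrm1E// integral_ge0// => x _; rewrite lee_fin. Qed.

End CellMeans.

(** * Poincaré estimates along approximating sequences *)

Section ApproximatingSequences.
Context (R : realType) (S : ndd_igs) (p : R).
Hypothesis p1 : 1 < p.
Hypothesis CU : conductively_uniform R S.
Local Notation X := (limit_space S R).
Local Notation V n := (vertex (rgraph S n)).
Local Notation E n := (edge (rgraph S n)).
Local Notation M := (Mconst S p).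
Local Notation C := (poincare_cst S p).
Local Notation P0 := (bernoulli (edge0 S) (@unif_density R S)).
Local Notation B0 := (@unif_bernoulli R S).
Hypothesis Unz : forall e : edge (gen S), absgrad (@Uopt R S p) e != 0.

Let p_gt0 : 0 < p. Proof. by have := p1; lra. Qed.
Let M_gt0 : 0 < M. Proof. exact: Mconst_gt0. Qed.
Let w_ge0 a : 0 <= @Jdens R S p a. Proof. exact/ltW/Jdens_gt0. Qed.
Let w_sum : \sum_a @Jdens R S p a = 1. Proof. exact: sum_Jdens. Qed.

Lemma means_approx (f : X -> R) (phi : R -> R) : continuous f ->
  (forall x y, `|phi x - phi y| <= `|x - y|) ->
  forall eps, 0 < eps -> exists N, forall n, (N <= n)%N ->
    forall (e : E n) v, v \in ends e ->
    `|means (fun x => phi (f x)) e - phi (avgs p f v)| <= eps.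
Proof.
move=> cf lphi eps e0; have [N HN] := Vavg_approx w_ge0 w_sum cf e0.
exists N => n Nn e v ve; rewrite -[phi (avgs p f v)](Ig_cst B0).
apply: (Ig_close B0); [|exact: ucont_cst|move=> s].
  by apply: (ucont_lipschitz lphi); exact: ucont_scat.
by apply: le_trans (lphi _ _) _; exact: HN.
Qed.

(** First [kap] makes the height term small, then a large [m] the energy term. The depth depends on
    [f] only through the energy bound [K], so one depth serves a whole approximating sequence. *)
Lemma avgs_flow_approx n (v : V n) (e : E n) K eps : v \in ends e -> 0 <= K -> 0 < eps ->
  exists N, forall m, (N <= m)%N -> forall f : X -> R, continuous f ->
    (forall k, lE p (avgs p f) k (tt : E 0) <= K) ->
    `|avgs p f v - flow_mean p (means f) m v e| <= eps.
Proof.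
move=> ve K0 e0; have e2 : 0 < eps / 2 by rewrite divr_gt0.
have C0 : 0 <= C := poincare_cst_ge0 p1 Unz.
pose kap := eps / 2 / (C + 1); have k0 : 0 < kap by rewrite divr_gt0// ltr_wpDl.
have c0 : 0 <= C * kap `^ (1 - p) * (M ^+ n * K).
  by apply: mulr_ge0; apply: mulr_ge0; rewrite // ?powR_ge0 ?exprn_ge0 ?(ltW M_gt0).
have [N HN] := geometric_small c0 (theta_ge0 p1 Unz) (theta_lt1 p1 Unz) e2.
exists N => m /HN Hm f cf HK.
have B : lE_bounded p (avgs p f) by exists K.
apply: le_trans (@poincare_flow _ _ _ p1 CU Unz _ (avgs_step p1 Unz cf) (means f) m n v e kap _ _ B ve k0) _.
- by move=> n' e'; exact: means_child.
- by apply: (means_approx (phi := id)).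
rewrite [eps]splitr mulrDr lerD ?mul_div_succ_le//.
apply: le_trans Hm; rewrite mulrA -[leRHS]mulrA.
have q0 : 0 <= C * kap `^ (1 - p) by apply: mulr_ge0 => //; exact: powR_ge0.
apply: ler_wpM2l => //.
rewrite [leLHS]mulrC; apply: ler_wpM2r; first by rewrite exprn_ge0// theta_ge0.
apply: limr_le; first exact: (lE_cvg p1 CU Unz (avgs_step p1 Unz cf)).
by near=> k; exact: lE_le.
Unshelve. all: by end_near. Qed.

(** By the Cauchy property the tail differs from [u N] by energy at most 1, and [u N] has finite
    energy as an element of [Cp]. *)
Lemma approx_bounded (f : X -> R) u : approx_seq p f u ->
  exists K N, forall i, (N <= i)%N -> forall k, lE p (avgs p (u i)) k (tt : E 0) <= K.
Proof.
move=> [Hu Hc _]; have [N HN] := Hc _ ltr01.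
have [cN EN] := Hu N.
have [b Eb] : exists b : R, EpC R S p (u N) = b%:E.
  exists (fine (EpC R S p (u N))); rewrite fineK// ge0_fin_numE//.
  apply: le_trans (EpC_ge p1 CU Unz 0 cN); rewrite lee_fin; exact: lE_ge0.
exists (2 `^ p * (1 + b)), N => i Ni k; have [ci _] := Hu i.
apply: le_trans (lE_avgs_le p1 Unz k ci cN) _.
rewrite ler_wpM2l ?powR_ge0// lerD//.
- rewrite -lee_fin (le_trans (EpC_ge p1 CU Unz k (continuous_sub ci cN)))//.
  exact/ltW/HN.
- by rewrite -lee_fin -Eb; exact: EpC_ge.
Qed.

(** The Poincaré inequality at the root for [phi x = |x - c|], which vanishes at the vertex average
    [c]. *)
Lemma nrm1_sub_cst (f : X -> R) K kap : continuous f -> 0 < kap ->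
  (forall k, lE p (avgs p f) k (tt : E 0) <= K) ->
  nrm1 (fun x => f x - avgs p f (true : V 0)) <= C * (kap + kap `^ (1 - p) * K).
Proof.
move=> cf k0 HK; set c := avgs p f _; pose phi x : R := `|x - c|.
have lphi x y : `|phi x - phi y| <= `|x - y|.
  by apply: le_trans (ler_dist_dist _ _) _; rewrite opprB addrA subrK.
have cg : continuous (fun x => phi (f x)).
  have cc : continuous (fun _ : X => c) by exact: cst_continuous.
  exact: continuous_norm_comp (continuous_sub cf cc).
have ve : (true : V 0) \in ends (tt : E 0) by rewrite mem_end1.
have := @poincare _ _ _ p1 Unz _ (avgs_step p1 Unz cf) (means (fun x => phi (f x))) phi lphi _ _
  0 (tt : E 0) (true : V 0) K kap ve k0 HK.
rewrite -/c /phi subrr normr0 subr0 => h; apply: le_trans (h _ _).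
- exact: ler_norm.
- by move=> n e; exact: means_child.
- exact: (means_approx cf lphi).
Qed.

Lemma approx_L1 (f : X -> R) u : measurable_fun [set: borelX R S] (f : borelX R S -> R) ->
  approx_seq p f u -> forall eps, 0 < eps -> exists N, forall i, (N <= i)%N ->
  (\int[P0]_s `|u i (chi R s) - f (chi R s)|%:E <= eps%:E)%E.
Proof.
move=> mf [Hu _ H].
have mu1 i : measurable_fun [set: borelX R S] (u i : borelX R S -> R).
  by have [ci _] := Hu i; exact: measurable_continuous.
apply: (integral_norm_cvg0 (bernoulli_setT B0) p1).
  by move=> i; apply: measurable_funB; exact: measurable_chi_comp.
move: H; rewrite (_ : (fun i => \int[muX R S]_x _)%E = (fun i => \int[P0]_s (`|u i (chi R s) - f (chi R s)| `^ p)%:E)%E)//; apply/funext => i.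
rewrite integral_muX//.
apply: measurable_powR_norm; exact: measurable_funB.
Qed.

End ApproximatingSequences.

(** * Two exponents with the same flow *)

Section RealLemmas.
Context (R : realType).
Implicit Types a b c p eps : R.

Lemma min_le_sqrt a b : 0 <= a -> 0 <= b -> Num.min a b <= Num.sqrt (a * b).
Proof.
move=> a0 b0; rewrite -[leLHS]ger0_norm ?le_min ?a0// -sqrtr_sqr ler_sqrt ?mulr_ge0//.
by rewrite expr2 ler_pM// ?le_min ?a0// ge_min lexx ?orbT.
Qed.

Lemma sqrt_amgm a b : 0 <= a -> 0 <= b -> Num.sqrt (a * b) <= (a + b) / 2.
Proof.
move=> a0 b0; rewrite -[leRHS]ger0_norm ?divr_ge0 ?addr_ge0// -sqrtr_sqr ler_sqrt ?sqr_ge0//.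
by have := sqr_ge0 (a - b); rewrite !expr2; lra.
Qed.

Lemma sqrt_amgm_lt a b : 0 <= a -> 0 <= b -> a != b -> Num.sqrt (a * b) < (a + b) / 2.
Proof.
move=> a0 b0 ab; rewrite -[ltRHS]ger0_norm ?divr_ge0 ?addr_ge0// -sqrtr_sqr ltr_sqrt.
  have : 0 < (a - b) ^+ 2 by rewrite exprn_even_gt0//= subr_eq0.
  by rewrite !expr2; lra.
rewrite exprn_gt0// divr_gt0// lt0r addr_ge0// andbT paddr_eq0//.
by apply: contra ab => /andP[/eqP-> /eqP->].
Qed.

Lemma powR_neg_small c p eps : 0 <= c -> 1 < p -> 0 < eps ->
  exists2 T0, 0 < T0 & forall T, T0 <= T -> T `^ (1 - p) * c <= eps.
Proof.
move=> c0 p1 e0; have p0 : 0 < p - 1 by rewrite subr_gt0.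
pose y := (c + 1) / eps; have y0 : 0 < y by rewrite divr_gt0// ltr_wpDl.
exists (y `^ (p - 1)^-1) => [|T yT]; first exact: powR_gt0.
have T0 : 0 < T by apply: lt_le_trans yT; exact: powR_gt0.
have yTp : y <= T `^ (p - 1).
  have -> : y = (y `^ (p - 1)^-1) `^ (p - 1) by rewrite -powRrM mulVf ?gt_eqF// powRr1// ltW.
  by rewrite ge0_ler_powR ?nnegrE ?powR_ge0 ?(ltW T0)// ltW.
rewrite -opprB powRN mulrC ler_pdivrMr ?powR_gt0//.
have : c + 1 <= eps * T `^ (p - 1) by rewrite -ler_pdivrMl// mulrC.
by apply: le_trans; rewrite lerDl.
Qed.

End RealLemmas.

Section TwoExponents.
Context (R : realType) (S : ndd_igs) (p1 p2 : R).
Hypothesis r1 : 1 < p1.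
Hypothesis r2 : 1 < p2.
Hypothesis CU : conductively_uniform R S.
Local Notation X := (limit_space S R).
Local Notation E1 := (edge (gen S)).
Local Notation V n := (vertex (rgraph S n)).
Local Notation E n := (edge (rgraph S n)).
Local Notation N1 := (#|edge (gen S)|%:R : R).
Hypothesis Unz1 : forall e : E1, absgrad (@Uopt R S p1) e != 0.
Hypothesis Unz2 : forall e : E1, absgrad (@Uopt R S p2) e != 0.
Hypothesis grad_neq : exists e : E1, absgrad (@Uopt R S p1) e != absgrad (@Uopt R S p2) e.
Hypothesis flow_eq : forall v w : vertex (gen S), adj v w -> @Jopt R S p1 v w = Jopt p2 v w.

Lemma Jdens_indep : @Jdens R S p1 = Jdens p2.
Proof. by apply/funext => a; apply: flow_eq; apply: adj_nbr; exact: boundary_phip. Qed.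

Lemma jflow_indep : @jflow R S p1 = jflow p2.
Proof.
apply/funext => e; apply: flow_eq.
by have [[-> ->]|[-> ->]] := eplus_eminus e; [|rewrite (adj_sym _ _ (@gen_ll S))]; exact: adj_end.
Qed.

Lemma wflow_indep n (e : E n) : wflow p1 e = wflow p2 e.
Proof. by elim: n e => [//|n IH] e /=; rewrite IH jflow_indep. Qed.

Lemma flow_mean_indep H m n (v : V n) (e : E n) : flow_mean p1 H m v e = flow_mean p2 H m v e.
Proof.
by elim: m n v e => [//|m IH] n v e /=; apply: eq_bigr => a _; rewrite IH Jdens_indep.
Qed.

(** The Bhattacharyya coefficient of the two densities on the edges of the generator. It dominates
    sums of minima and, unlike them, is multiplicative along words. *)
Definition rho : R := \sum_(f : E1) Num.sqrt
  ((`|jflow p1 f| * absgrad (@Uopt R S p1) f) * (`|jflow p2 f| * absgrad (@Uopt R S p2) f)).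

Lemma rho_ge0 : 0 <= rho. Proof. by apply: sumr_ge0 => f _; exact: sqrtr_ge0. Qed.

Let a f := `|jflow p1 f| * absgrad (@Uopt R S p1) f.
Let b f := `|jflow p2 f| * absgrad (@Uopt R S p2) f.
Let a0 f : 0 <= a f. Proof. by rewrite mulr_ge0 ?normr_ge0. Qed.
Let b0 f : 0 <= b f. Proof. by rewrite mulr_ge0 ?normr_ge0. Qed.

Lemma rho_lt1 : rho < 1.
Proof.
have [f fN] := grad_neq.
have -> : 1 = \sum_f (a f + b f) / 2.
  rewrite -mulr_suml big_split/= (sum_jflow_absgrad r1)// (sum_jflow_absgrad r2)//; lra.
rewrite /rho [ltLHS](bigD1 f)//= [ltRHS](bigD1 f)//= ltr_leD//; last first.
  by apply: ler_sum => g _; exact: (sqrt_amgm (a0 g) (b0 g)).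
(* The common flow factor is nonzero, so at the edge [f] of (B) the two densities differ and the
   inequality of means is strict. *)
apply: (sqrt_amgm_lt (a0 f) (b0 f)); rewrite /a /b -jflow_indep; apply: contra fN => /eqP/mulfI -> //.
by rewrite gt_eqF// norm_jflow_gt0.
Qed.

Local Notation nu1 e := (wflow p1 e * wgrad p1 e).
Local Notation nu2 e := (wflow p2 e * wgrad p2 e).

Lemma sum_sqrt_nu n : \sum_(e : E n) Num.sqrt (nu1 e * nu2 e) = rho ^+ n.
Proof.
elim: n => [|n IH].
  by rewrite (big_pred1 (tt : E 0)) => [|[]//]; rewrite /= !mul1r sqrtr1 expr0.
rewrite -(pair_big predT predT (fun (e : E n) (f : E1) =>
  Num.sqrt (nu1 ((e, f) : E n.+1) * nu2 ((e, f) : E n.+1))))/=.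
rewrite exprSr -IH mulr_suml; apply: eq_bigr => e _.
rewrite mulr_sumr; apply: eq_bigr => f _ /=.
have w1 := wflow_gt0 r1 Unz1 e; have w2 := wflow_gt0 r2 Unz2 e.
have g1 := wgrad_gt0 Unz1 e; have g2 := wgrad_gt0 Unz2 e.
rewrite -sqrtrM ?mulr_ge0 ?(ltW w1) ?(ltW w2) ?(ltW g1) ?(ltW g2)//.
congr Num.sqrt; ring.
Qed.

(** [u] and [u'] will be tails of approximating sequences of one function, each with bounded
    energies for its own exponent. *)
Variables (u u' : nat -> X -> R) (K1 K2 : R).
Hypothesis cu : forall i, continuous (u i).
Hypothesis cu' : forall i, continuous (u' i).
Hypothesis uK : forall i k, lE p1 (avgs p1 (u i)) k (tt : E 0) <= K1.
Hypothesis u'K : forall i k, lE p2 (avgs p2 (u' i)) k (tt : E 0) <= K2.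
Hypothesis uu' : (fun i => nrm1 (u i \- u' i)) @ \oo --> 0.

Let K1_ge0 : 0 <= K1.
Proof. by apply: le_trans (uK 0 0); exact: lE_ge0. Qed.
Let K2_ge0 : 0 <= K2.
Proof. by apply: le_trans (u'K 0 0); exact: lE_ge0. Qed.

(** Each fiber average is compared with its flow mean, at a depth fixed by the energy bounds. The
    two flow means have the same weights, so their difference is controlled by the L^1 norm of
    [u i - u' i]. *)
Lemma avgs_sub_cvg0 n (v : V n) (e : E n) : v \in ends e ->
  (fun i => avgs p1 (u i) v - avgs p2 (u' i) v) @ \oo --> 0.
Proof.
move=> ve; apply/cvgrPdist_le => eps e0.
have tri (x y z t : R) : `|x - y| <= eps / 3 -> `|t - z| <= eps / 3 -> `|y - z| <= eps / 3 -> `|x - t| <= eps.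
  by rewrite !ler_distl; lra.
have e3 : 0 < eps / 3 by rewrite divr_gt0.
have [m1 H1] := avgs_flow_approx r1 CU Unz1 ve K1_ge0 e3.
have [m2 H2] := avgs_flow_approx r2 CU Unz2 ve K2_ge0 e3.
pose m := maxn m1 m2; have {}H1 := H1 m (leq_maxl _ _); have {}H2 := H2 m (leq_maxr _ _).
pose c := N1 ^+ (m + n); have c0 : 0 < c by rewrite exprn_gt0// N1_gt0.
have /cvgrPdist_le/(_ _ (divr_gt0 e3 c0)) := uu'; apply: filterS => i.
rewrite !sub0r !normrN ger0_norm ?nrm1_ge0//; last exact: continuous_sub.
rewrite ler_pdivlMr// mulrC => Hi.
have {}H1 := H1 _ (@cu i) (@uK i); have {}H2 := H2 _ (@cu' i) (@u'K i).
have Hm : `|flow_mean p1 (means (u i)) m v e - flow_mean p1 (means (u' i)) m v e| <= eps / 3.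
  rewrite -flow_meanB; apply: le_trans Hi.
  apply: (@flow_mean_le _ _ _ r1 Unz1 _ (means (fun x => `|u i x - u' i x|))).
    move=> k f; rewrite -meansB//; apply: norm_means_le; exact: continuous_sub.
  by move=> k f; apply: means_child; apply: continuous_norm_comp; exact: continuous_sub.
rewrite flow_mean_indep [in X in _ - X]flow_mean_indep in Hm; rewrite flow_mean_indep in H1.
exact: tri H1 H2 Hm.
Qed.

Lemma Dif_sub_cvg0 n (e : E n) :
  (fun i => Dif (avgs p1 (u i)) e - Dif (avgs p2 (u' i)) e) @ \oo --> 0.
Proof.
have E : (fun i => Dif (avgs p1 (u i)) e - Dif (avgs p2 (u' i)) e) =
    (fun i => (avgs p1 (u i) (end1 e) - avgs p2 (u' i) (end1 e)) -
              (avgs p1 (u i) (end2 e) - avgs p2 (u' i) (end2 e))).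
  have aca (x y z t : R) : x - y - (z - t) = x - z - (y - t) by ring.
  by apply/funext => i; exact: aca.
rewrite E -[X in _ --> X](subr0 0); apply: cvgB.
  exact: avgs_sub_cvg0 (mem_end1 e).
exact: avgs_sub_cvg0 (mem_end2 e).
Qed.

(** The height [T] is fixed by the energy bounds, then a level [m] at least [n] makes [T * rho ^ m]
    small, and only then is the index [i] taken large. Monotonicity in the level carries the bound
    from [m] back to [n]. *)
Lemma flow_sum_cvg0 n : (fun i => \sum_(e : E n) wflow p1 e * `|Dif (avgs p1 (u i)) e|) @ \oo --> 0.
Proof.
apply/cvgrPdist_le => eps e0; have e4 : 0 < eps / 4 by rewrite divr_gt0.
have ar0 (x y : R) : `|x| <= `|y| + `|x - y|.
  by rewrite -[x in leLHS](subrK y) addrC; exact: ler_normD.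
have ar1 (x y z c d r : R) : x <= y + c -> y <= z -> 0 <= d -> 0 <= r -> x <= z + (c + d) + r by lra.
have ar2 (x x' y z c d r : R) : x <= x' + r -> x' <= y + d -> y <= z -> 0 <= c -> x <= z + (c + d) + r by lra.
have ar3 (x y z t y' z' : R) : x <= eps / 4 -> y <= y' -> y' <= eps / 4 -> z <= z' -> z' <= eps / 4 ->
  t <= eps / 4 -> x + (y + z) + t <= eps by lra.
have [T1 T10 HT1] := powR_neg_small K1_ge0 r1 e4.
have [T2 T20 HT2] := powR_neg_small K2_ge0 r2 e4.
pose T := Num.max T1 T2; have T0 : 0 < T by rewrite lt_max T10.
have {}HT1 : T `^ (1 - p1) * K1 <= eps / 4 by apply: HT1; rewrite le_max lexx.
have {}HT2 : T `^ (1 - p2) * K2 <= eps / 4 by apply: HT2; rewrite le_max lexx orbT.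
have [N HN] := geometric_small (ltW T0) rho_ge0 rho_lt1 e4.
pose m := maxn N n; have Hm : T * rho ^+ m <= eps / 4 by apply: HN; exact: leq_maxl.
pose err i (e : E m) := wflow p1 e * `|Dif (avgs p1 (u i)) e - Dif (avgs p2 (u' i)) e|.
have : (fun i => \sum_(e : E m) err i e) @ \oo --> 0.
  suff : (fun i => \sum_(e : E m) err i e) @ \oo --> \sum_(e : E m) (0 : R) by rewrite big1.
  apply: cvg_big => [|e _]; first exact: add_continuous.
  rewrite -[X in _ --> X](mulr0 (wflow p1 e)); apply: cvgMr.
  by apply/norm_cvg0P; exact: Dif_sub_cvg0.
move=> /cvgrPdist_le/(_ _ e4); apply: filterS => i; rewrite !sub0r !normrN => Herr.
have {}Herr := le_trans (ler_norm _) Herr.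
rewrite ger0_norm; last by apply: sumr_ge0 => e _; rewrite mulr_ge0 ?normr_ge0 ?ltW// wflow_gt0.
apply: le_trans (flow_sum_nd r1 CU Unz1 (avgs_step r1 Unz1 (@cu i)) (leq_maxr N n)) _.
have sum4 (f g h k : E m -> R) :
    \sum_e (f e + (g e + h e) + k e) = \sum_e f e + (\sum_e g e + \sum_e h e) + \sum_e k e.
  by rewrite !big_split.
pose b1 (e : E m) := T `^ (1 - p1) * (Mconst S p1 ^- m * Dpow p1 (avgs p1 (u i)) e).
pose b2 (e : E m) := T `^ (1 - p2) * (Mconst S p2 ^- m * Dpow p2 (avgs p2 (u' i)) e).
have b1E : \sum_e b1 e = T `^ (1 - p1) * lE p1 (avgs p1 (u i)) m (tt : E 0).
  by rewrite -mulr_sumr -mulr_sumr lE_sum.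
have b2E : \sum_e b2 e = T `^ (1 - p2) * lE p2 (avgs p2 (u' i)) m (tt : E 0).
  by rewrite -mulr_sumr -mulr_sumr lE_sum.
apply: (@le_trans _ _ (\sum_(e : E m) (T * Num.sqrt (nu1 e * nu2 e) + (b1 e + b2 e) + err i e))).
  apply: ler_sum => e _.
  have h1 := wflow_truncate r1 Unz1 e (normr_ge0 (Dif (avgs p1 (u i)) e)) T0.
  have h2 := wflow_truncate r2 Unz2 e (normr_ge0 (Dif (avgs p2 (u' i)) e)) T0.
  have w1 := wflow_gt0 r1 Unz1 e.
  have n1 : 0 <= nu1 e by rewrite mulr_ge0 ?ltW// wgrad_gt0.
  have n2 : 0 <= nu2 e by rewrite -wflow_indep mulr_ge0 ?ltW// wgrad_gt0.
  have := min_le_sqrt n1 n2; rewrite ge_min => /orP smin.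
  have q1 : 0 <= b1 e.
    by rewrite mulr_ge0 ?powR_ge0// mulr_ge0 ?Dpow_ge0// invr_ge0 exprn_ge0// ltW// Mconst_gt0.
  have q2 : 0 <= b2 e.
    by rewrite mulr_ge0 ?powR_ge0// mulr_ge0 ?Dpow_ge0// invr_ge0 exprn_ge0// ltW// Mconst_gt0.
  have er0 : 0 <= err i e by rewrite mulr_ge0 ?normr_ge0 ?ltW.
  (* If the first density is the small one, truncation with [p1] is enough. Otherwise the gradient
     of [u i] is replaced by that of [u' i] at the cost [err], and truncation with [p2] applies. *)
  case: smin => /(ler_wpM2l (ltW T0)) smin; first exact: ar1 h1 smin q2 er0.
  have hd : wflow p1 e * `|Dif (avgs p1 (u i)) e| <= wflow p1 e * `|Dif (avgs p2 (u' i)) e| + err i e.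
    rewrite /err -mulrDr ler_wpM2l ?(ltW w1)//.
  by apply: ar2 hd _ smin q1; rewrite wflow_indep.
have s0 : \sum_(e : E m) T * Num.sqrt (nu1 e * nu2 e) = T * rho ^+ m by rewrite -mulr_sumr sum_sqrt_nu.
rewrite (sum4 (fun e => T * Num.sqrt (nu1 e * nu2 e)) b1 b2 (err i)).
rewrite s0.
have l1 : \sum_e b1 e <= T `^ (1 - p1) * K1 by rewrite b1E ler_wpM2l ?powR_ge0.
have l2 : \sum_e b2 e <= T `^ (1 - p2) * K2 by rewrite b2E ler_wpM2l ?powR_ge0.
exact: ar3 Hm l1 HT1 l2 HT2 Herr.
Qed.

Lemma Dif_cvg0 n (e : E n) : (fun i => Dif (avgs p1 (u i)) e) @ \oo --> 0.
Proof.
have w1 := wflow_gt0 r1 Unz1 e.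
apply/cvgrPdist_le => eps e0.
have /cvgrPdist_le/(_ _ (mulr_gt0 w1 e0)) := flow_sum_cvg0 n.
apply: filterS => i; rewrite !sub0r !normrN => /(le_trans (ler_norm _)) h.
rewrite -(ler_pM2l w1); apply: le_trans h; rewrite (bigD1 e)//= lerDl.
by apply: sumr_ge0 => f _; rewrite mulr_ge0 ?normr_ge0 ?ltW// wflow_gt0.
Qed.

End TwoExponents.

(** * Sobolev functions *)

Section AlmostEverywhere.
Context (R : realType) (S : ndd_igs).
Local Notation X := (limit_space S R).
Local Notation P0 := (bernoulli (edge0 S) (@unif_density R S)).
Local Notation B0 := (@unif_bernoulli R S).
Implicit Types (f : X -> R) (c p : R).

(** [muX] is typed as a bare set function, so null sets are moved to the sequence space, which
    carries a measure. *)
Lemma ae_muX_cst f c : measurable_fun [set: borelX R S] (f : borelX R S -> R) ->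
  (\forall x \ae muX R S, f x = c) <-> P0 [set s | f (chi R s) != c] = 0%E.
Proof.
move=> mf; have mA : measurable ([set x | f x != c] : set (borelX R S)) := measurable_neq c mf; split; last first.
  by move=> A0; exists [set x | f x != c]; split=> // x /= /eqP.
move=> [N [mN N0 fN]].
have mcN : measurable (chi R @^-1` N : set (mseqspace (edge0 S))).
  by rewrite -[_ @^-1` _]setTI; exact: (@measurable_chi R S).
apply: (subset_measure0 _ mcN _ N0) => [|s /= /eqP sc]; last exact: fN.
exact: (measurable_neq c (measurable_chi_comp mf)).
Qed.

Lemma integral_muX_norm f p : measurable_fun [set: borelX R S] (f : borelX R S -> R) ->
  (\int[muX R S]_x (`|f x| `^ p)%:E = \int[P0]_s (`|f (chi R s)| `^ p)%:E)%E.
Proof.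
by move=> mf; rewrite integral_muX//; exact: measurable_powR_norm.
Qed.

Lemma integral_ae_cst f c p : measurable_fun [set: borelX R S] (f : borelX R S -> R) ->
  (\forall x \ae muX R S, f x = c) ->
  (\int[muX R S]_x (`|f x| `^ p)%:E = (`|c| `^ p)%:E)%E.
Proof.
move=> mf /(ae_muX_cst c mf) A0; rewrite integral_muX_norm//.
rewrite -[RHS](integral_cst1 (bernoulli_setT B0)).
have mfc := measurable_chi_comp mf.
apply: ge0_ae_eq_integral => //; first exact: measurable_powR_norm.
exists [set s | f (chi R s) != c]; split=> //.
  exact: (measurable_neq c mfc).
by move=> s /= H; apply/eqP => fc; apply: H => _; rewrite fc.
Qed.

Lemma memLp1_of_memLp f p : 1 < p -> memLp p f -> memLp 1 f.
Proof.
move=> p1 [mf fp]; split=> //; rewrite integral_muX_norm//; rewrite integral_muX_norm// in fp.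
under eq_integral do rewrite powRr1//.
have := integral_truncate (bernoulli_setT B0) p1 ltr01 (measurable_chi_comp mf).
rewrite powR1 mul1e => h; apply: le_lt_trans h _.
by rewrite lte_add_pinfty ?ltry.
Qed.

Lemma nrm1_sub_le (g h f : X -> R) : continuous g -> continuous h ->
  measurable_fun [set: borelX R S] (f : borelX R S -> R) ->
  ((nrm1 (g \- h))%:E <= \int[P0]_s `|g (chi R s) - f (chi R s)|%:E +
                         \int[P0]_s `|h (chi R s) - f (chi R s)|%:E)%E.
Proof.
move=> cg ch mf; rewrite nrm1E; last exact: continuous_sub.
have mg := measurable_chi_comp (measurable_continuous cg).
have mh := measurable_chi_comp (measurable_continuous ch).
have mf' := measurable_chi_comp mf.
have := @integral_norm_triangle _ _ _ P0 (fun s => g (chi R s) - f (chi R s))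
  (fun s => f (chi R s) - h (chi R s)) (measurable_funB mg mf') (measurable_funB mf' mh).
under eq_integral do rewrite addrA subrK.
by under [X in (_ <= _ + X)%E]eq_integral do rewrite distrC.
Qed.

Lemma integral_sub_cst_le (g f : X -> R) c : continuous g ->
  measurable_fun [set: borelX R S] (f : borelX R S -> R) ->
  (\int[P0]_s `|f (chi R s) - c|%:E <=
   \int[P0]_s `|g (chi R s) - f (chi R s)|%:E + (nrm1 (fun x => g x - c))%:E)%E.
Proof.
move=> cg mf; rewrite nrm1E; last by apply: continuous_sub cg _; exact: cst_continuous.
have mg := measurable_chi_comp (measurable_continuous cg).
have mf' := measurable_chi_comp mf.
have := @integral_norm_triangle _ _ _ P0 (fun s => f (chi R s) - g (chi R s))
  (fun s => g (chi R s) - c) (measurable_funB mf' mg) (measurable_funB mg (measurable_cst c)).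
under eq_integral do rewrite addrA subrK.
by under [X in (_ <= X + _)%E]eq_integral do rewrite distrC.
Qed.

End AlmostEverywhere.

Section OneExponentSobolev.
Context (R : realType) (S : ndd_igs) (p : R).
Hypothesis p1 : 1 < p.
Hypothesis CU : conductively_uniform R S.
Local Notation X := (limit_space S R).
Local Notation V n := (vertex (rgraph S n)).
Local Notation E n := (edge (rgraph S n)).
Local Notation C := (poincare_cst S p).
Local Notation P0 := (bernoulli (edge0 S) (@unif_density R S)).
Local Notation B0 := (@unif_bernoulli R S).
Hypothesis Unz : forall e : edge (gen S), absgrad (@Uopt R S p) e != 0.

(** [sobolev_energy] evaluates a sequence picked by choice, so finiteness is shown for any pick; if
    the energies had no limit, [limn] would be a finite default. *)
Lemma approx_energy_lty (f : X -> R) u : approx_seq p f u ->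
  (limn (fun i => EpC R S p (u i)) < +oo)%E.
Proof.
move=> H; have [Hu _ _] := H; have [K [N HK]] := approx_bounded p1 CU Unz H.
have [cv|ncv] := pselect (cvgn (fun i => EpC R S p (u i))); last first.
  by rewrite (dvgP ncv) ltry.
apply: (@le_lt_trans _ _ K%:E); last exact: ltry.
apply: lime_le => //; exists N => // i /= Ni.
by apply: (EpC_le p1 CU Unz) => [|k]; [have [] := Hu i|exact: HK].
Qed.

Lemma sobolev_of_ae_cst (f : X -> R) c : measurable_fun [set: borelX R S] (f : borelX R S -> R) ->
  (\forall x \ae muX R S, f x = c) -> sobolev R S p f.
Proof.
move=> mf fc; split; first by split=> //; rewrite (integral_ae_cst p mf fc) ltry.
rewrite /sobolev_energy; case: pselect => [ex|]; last first.
  case; exists (fun _ _ => c); split.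
  - by move=> i; split; [exact: cst_continuous|rewrite (EpC_cst p1 Unz)// ltry].
  - move=> eps e0; exists 0%N => i j _ _.
    by rewrite (_ : (fun=> c) \- (fun=> c) = fun=> c - c)// (EpC_cst p1 Unz).
  - have -> : (fun _ : nat => \int[muX R S]_x (`|c - f x| `^ p)%:E)%E = fun=> 0%E; last exact: cvg_cst.
    apply/funext => i.
    rewrite (@integral_ae_cst _ _ (fun x => c - f x) 0).
    + by rewrite normr0 powR0// gt_eqF//; have := p1; lra.
    + exact: measurable_funB.
    + have [N [mN N0 NN]] := fc; exists N; split=> // x /= cx; apply: NN => /= fx.
      by apply: cx; rewrite fx subrr.
exact: approx_energy_lty (projT2 (cid ex)).
Qed.

(** Smallness at each fixed level is upgraded to smallness at all levels of one [u i]: for every [k]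
    some late [u j] has small energy at level [k], while the energy of [u i - u j] is small
    uniformly in [k] by the Cauchy property. The Poincaré inequality then puts [f] close to
    constants in L^1. *)
Lemma ae_cst_of_energy_cvg0 (f : X -> R) u :
  measurable_fun [set: borelX R S] (f : borelX R S -> R) -> approx_seq p f u ->
  (forall k n delta, 0 < delta -> exists2 j, (n <= j)%N & lE p (avgs p (u j)) k (tt : E 0) <= delta) ->
  exists c, \forall x \ae muX R S, f x = c.
Proof.
move=> mf au Hu0; have [Hu Hc _] := au.
have cu i : continuous (u i) by have [] := Hu i.
have small delta : 0 < delta -> exists n, forall i, (n <= i)%N -> forall k,
    lE p (avgs p (u i)) k (tt : E 0) <= 2 `^ p * delta.
  move=> d0; have d2 : 0 < delta / 2 by rewrite divr_gt0.
  have [n Hn] := Hc _ d2; exists n => i ni k; have [j nj Hj] := Hu0 k n _ d2.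
  apply: le_trans (lE_avgs_le p1 Unz k (@cu i) (@cu j)) _.
  have h : lE p (avgs p (u i \- u j)) k (tt : E 0) <= delta / 2.
    rewrite -lee_fin; apply: le_trans (EpC_ge p1 CU Unz k (continuous_sub (@cu i) (@cu j))) _.
    exact/ltW/Hn.
  apply: ler_wpM2l; first exact: powR_ge0.
  rewrite [leRHS]splitr; exact: lerD h Hj.
have mfc := measurable_chi_comp mf.
have [|c c0] := @ae_cst_of_integral _ _ _ P0 (bernoulli_setT B0) (fun s => f (chi R s)) mfc.
  move=> eps e0; have e2 : 0 < eps / 2 by rewrite divr_gt0.
  have e4 : 0 < eps / 2 / 2 by rewrite divr_gt0.
  have C0 : 0 <= C := poincare_cst_ge0 p1 Unz.
  pose kap := eps / 2 / 2 / (C + 1); have k0 : 0 < kap by rewrite divr_gt0// ltr_wpDl.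
  pose q := C * (kap `^ (1 - p) * 2 `^ p).
  have q0 : 0 <= q by rewrite mulr_ge0// mulr_ge0// powR_ge0.
  (* [kap] is fixed before [delta], because the coefficient [q] of the energy depends on [kap]. *)
  pose delta := eps / 2 / 2 / (q + 1); have d0 : 0 < delta by rewrite divr_gt0// ltr_wpDl.
  have [n1 H1] := approx_L1 p1 mf au e2; have [n2 H2] := small _ d0.
  pose i := maxn n1 n2; pose c := avgs p (u i) (true : V 0); exists c.
  apply: le_trans (integral_sub_cst_le c (@cu i) mf) _.
  rewrite [eps]splitr EFinD; apply: leeD; first exact/H1/leq_maxl.
  rewrite lee_fin.
  apply: le_trans (nrm1_sub_cst p1 Unz (@cu i) k0 (H2 _ (leq_maxr _ _))) _.
  rewrite [eps / 2]splitr mulrDr; apply: lerD; first exact: mul_div_succ_le.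
  have -> : C * (kap `^ (1 - p) * (2 `^ p * delta)) = q * delta by rewrite /q !mulrA.
  exact: mul_div_succ_le.
exists c; apply/(ae_muX_cst c mf).
exact: ae_of_integral0 mfc c0.
Qed.

End OneExponentSobolev.

Lemma sobolev_approx (R : realType) (S : ndd_igs) (p : R) (f : limit_space S R -> R) :
  sobolev R S p f -> exists u, approx_seq p f u.
Proof. by move=> [_]; rewrite /sobolev_energy; case: pselect. Qed.

Theorem theorem8p1 (R : realType) (S : ndd_igs) (p1 p2 : R)
  (CU : conductively_uniform R S)
  (p1_gt1 : 1 < p1) (p2_gt1 : 1 < p2) (p1_neq_p2 : p1 != p2)
  (condA : forall p : R, (p = p1 \/ p = p2) ->
     forall e : edge (gen S), absgrad (Uopt p) e != 0)
  (condB : exists e : edge (gen S),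
     absgrad (Uopt p1) e != absgrad (Uopt p2) e)
  (condC : forall v w : vertex (gen S), adj v w -> Jopt p1 v w = Jopt p2 v w) :
  sobolev R S p1 `&` sobolev R S p2 = const_ae R S.
Proof.
have U1 := condA p1 (or_introl erefl); have U2 := condA p2 (or_intror erefl).
apply/seteqP; split=> f; last first.
  by move=> [[mf _] [c fc]]; split; exact: sobolev_of_ae_cst fc.
move=> [f1 f2]; have [m1 _] := f1; split; first exact: memLp1_of_memLp m1.
have [mf _] := m1; have [u au] := sobolev_approx f1; have [u' au'] := sobolev_approx f2.
have [K1 [M1 HK1]] := approx_bounded p1_gt1 CU U1 au.
have [K2 [M2 HK2]] := approx_bounded p2_gt1 CU U2 au'.
(* Dropping the first [N] terms makes both energy bounds valid for all indices. *)
pose N := maxn M1 M2; pose v i := u (N + i)%N; pose v' i := u' (N + i)%N.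
have [Hu Hc _] := au; have [Hu' _ _] := au'.
have cv i : continuous (v i) by have [] := Hu (N + i)%N.
have cv' i : continuous (v' i) by have [] := Hu' (N + i)%N.
have vK i k : lE p1 (avgs p1 (v i)) k (tt : edge (rgraph S 0)) <= K1.
  by apply: HK1; rewrite (leq_trans (leq_maxl M1 M2))// leq_addr.
have v'K i k : lE p2 (avgs p2 (v' i)) k (tt : edge (rgraph S 0)) <= K2.
  by apply: HK2; rewrite (leq_trans (leq_maxr M1 M2))// leq_addr.
have L1 := approx_L1 p1_gt1 mf au; have L2 := approx_L1 p2_gt1 mf au'.
have vv' : (fun i => nrm1 (v i \- v' i)) @ \oo --> 0.
  apply/cvgrPdist_le => eps e0; have e2 : 0 < eps / 2 by rewrite divr_gt0.
  have [n1 H1] := L1 _ e2; have [n2 H2] := L2 _ e2.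
  exists (maxn n1 n2) => // i /=; rewrite geq_max => /andP[i1 i2].
  have cd := continuous_sub (@cv i) (@cv' i).
  rewrite sub0r normrN ger0_norm ?nrm1_ge0// -lee_fin.
  apply: le_trans (nrm1_sub_le (@cv i) (@cv' i) mf) _.
  rewrite [eps]splitr EFinD; apply: leeD.
    by apply: H1; rewrite (leq_trans i1)// leq_addl.
  by apply: H2; rewrite (leq_trans i2)// leq_addl.
have D0 n (e : edge (rgraph S n)) := Dif_cvg0 p1_gt1 p2_gt1 CU U1 U2 condB condC cv cv' vK v'K vv' e.
apply: (ae_cst_of_energy_cvg0 p1_gt1 CU U1 mf au) => k n delta d0.
have /cvgrPdist_le/(_ _ d0)[m _ Hm] := lE_avgs_cvg0 p1_gt1 (D0 k).
(* The required index counts in [u], the limit in the shifted sequence [v]; [maxn n m] serves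
   both. *)
exists (N + maxn n m)%N; first by rewrite (leq_trans (leq_maxl n m))// leq_addl.
have := Hm _ (leq_maxr n m); rewrite /= sub0r normrN; exact: le_trans (ler_norm _).
Qed.
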